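(* There is a $\Gamma$- and $\tau$-stable connected open neighborhood $U$ of $\mathsf T_{\mathbb R}$ in $\mathsf T$ over which the $\Gamma$-invariant section $\sigma_{\mathbb R}\in\mathcal F(\mathsf T_{\mathbb R})$ can be extended (uniquely) to a $\Gamma$-invariant section $\sigma\in\mathcal F(U)$.
   Context: $\Lambda$: K3 lattice (even unimodular, signature $(3,19)$); $\Omega=\{[x]\in\mathbb P(\Lambda_{\mathbb C})\mid\langle x,x\rangle=0,\langle x,\bar x\rangle>0\}$; $\Gamma=\mathrm O^+(\Lambda)$, the index-two subgroup of $\mathrm O(\Lambda)$ preserving orientation in the three positive directions; $\Delta=\{\delta\in\Lambda\mid\langle\delta,\delta\rangle=-2\}$. Cycles: $\mathbb G^+$ is the set of complex three-spaces $V\subset\Lambda_{\mathbb C}$ with $\langle v,\bar v\rangle>0$ for $0\neq v\in V$; $\psi(V)=[\mathbb P(V)\cap\Omega]$ embeds it as an open subset of the Douady space of $\Omega$; $C_1(\Omega)$ is the connected component containing $\psi(\mathbb G^+)$ of the space of smooth rational curves of degree 2 in $\Omega$; $\mathcal C=\{([C],p)\mid p\in C\}\subset C_1(\Omega)\times\Omega$. $\tau$ is the antiholomorphic involution of $C_1(\Omega)$ induced by complex conjugation on $\Lambda_{\mathbb C}$. $\mathsf T=\psi(\{V\in\mathbb G^+\mid V\not\subset\delta^\perp\ \forall\delta\in\Delta\})$ and $\mathsf T_{\mathbb R}=\{[C]\in\mathsf T\mid C=\overline C\}$. Sheaf $\mathcal F$: for $p=[x]\in\Omega$, $V_p$ is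 one of the two components of $\{\kappa\in\Lambda_{\mathbb R}\mid\langle\kappa,x\rangle=0,\langle\kappa,\kappa\rangle>0\}$, chosen continuously in $p$, and $V_p^\circ=\{\kappa\in V_p\mid\langle\kappa,\delta\rangle\neq0\ \forall\delta\in\Delta,\ \langle\delta,x\rangle=0\}$. $\tilde\Omega=\{([\kappa],p)\mid p\in\Omega,\ [\kappa]\in\pi_0(V_p^\circ)\}$ with the quotient topology from $\{(\kappa,p)\mid\kappa\in V_p^\circ\}\subset\Lambda_{\mathbb R}\times\Omega$ is étale over $\Omega$. $\tilde{\mathcal C}=\{([C],([\kappa],p))\in C_1(\Omega)\times\tilde\Omega\mid p\in C\}$ with projection $q_1$ to $\mathcal C$. $\mathcal F$ is the direct image on $C_1(\Omega)$ of the sheaf of sections of $q_1$: sections over $W\subset C_1(\Omega)$ are continuous sections of $q_1$ over $\mathcal C|_W$. $\Gamma$ acts equivariantly on all these spaces and on sections by $\gamma(\sigma)\colon x\mapsto\gamma(\sigma(\gamma^{-1}x))$. $\sigma_{\mathbb R}$ is the $\Gamma$-invariant section $([C],p)\mapsto([C],([\kappa([C],p)],p))$ over $\mathcal C|_{\mathsf T_{\mathbb R}}$, where for $C=\mathbb P(V)\cap\Omega$ with $V=\overline V$ and $p=[x]\in C$, $\kappa([C],p)\in V_p^\circ$ is the class with $\langle\kappa,\kappa\rangle=1$ and $V=\mathbb Cx\oplus\mathbb C\kappa\oplus\mathbb C\bar x$. *)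

(* Defs.v *)
From HB Require Import structures.
From mathcomp Require Import all_boot all_order all_algebra.
From mathcomp Require Import complex.
From mathcomp Require Import all_classical all_reals all_analysis.

Set Implicit Arguments.
Unset Strict Implicit.
Unset Printing Implicit Defensive.

Import Order.TTheory GRing.Theory Num.Theory.
Import numFieldTopology.Exports numFieldNormedType.Exports.
Local Open Scope classical_set_scope.
Local Open Scope ring_scope.

HB.instance Definition _ (R : realType) := NormedModule.copy R[i] R[i]^o.

(* The final topology on X for f : S -> X.  Points outside the range of f are
   isolated, so on [range f], with the subspace topology, this is the quotient
   topology.  It is used below with S of the form [subspace D], where the
   points outside D are isolated as well and impose no condition. *)
Definition final_topology {S X : Type} (f : S -> X) : Type := X.

Section final_topology.
Variables (S : topologicalType) (X : choiceType) (f : S -> X).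

Definition final_open (A : set X) : Prop := open (f @^-1` A).

Let final_openT : final_open setT.
Proof. by rewrite /final_open preimage_setT; exact: openT. Qed.

Let final_openI : setI_closed final_open.
Proof. by move=> A B oA oB; exact: openI. Qed.

Let final_open_bigU (I : Type) (g : I -> set X) :
  (forall i, final_open (g i)) -> final_open (\bigcup_i g i).
Proof.
move=> og; rewrite /final_open preimage_bigcup.
by apply: bigcup_open => i _; exact: og.
Qed.

HB.instance Definition _ := Choice.on (final_topology f).
HB.instance Definition _ := isOpenTopological.Build (final_topology f)
  final_openT final_openI final_open_bigU.

End final_topology.

(* The lattice is Z^22 with Gram matrix G; Lambda_R and Lambda_C are the
   spaces of real and complex column vectors. *)

Definition ext (K : pzRingType) m n (M : 'M[int]_(m, n)) : 'M[K]_(m, n) :=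
  map_mx intr M.
Arguments ext K {m n} M.

Definition bform (K : pzRingType) (G : 'M[int]_22) (x y : 'cV[K]_22) : K :=
  (x^T *m ext K G *m y) 0 0.

Definition K3_gram (R : realType) (G : 'M[int]_22) : Prop :=
  [/\ G^T = G,
      forall x : 'cV[int]_22, (2 %| bform G x x)%Z,
      G \in unitmx &
      exists2 P : 'M[R]_22, P \in unitmx &
        P^T *m ext R G *m P = diag_mx (\row_j (if (j < 3)%N then 1 else -1))].

Definition Delta (G : 'M[int]_22) : set 'cV[int]_22 :=
  [set d | bform G d d = -2].

(* The columns of E span a positive definite three-space. *)
Definition positive_frame (R : realType) (G : 'M[int]_22)
    (E : 'M[R]_(22, 3)) : Prop :=
  forall v : 'cV[R]_3, v != 0 -> 0 < bform G (E *m v) (E *m v).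

(* Two positive frames E, F induce the same orientation of the positive
   directions iff the orthogonal projection of span F onto span E, expressed in
   the bases F and E, has positive determinant, i.e. iff det (E^T G F) > 0. *)
Definition Gamma (R : realType) (G : 'M[int]_22) : set 'M[int]_22 :=
  [set g | [/\ g \in unitmx, g^T *m G *m g = G &
    forall E : 'M[R]_(22, 3), positive_frame G E ->
      0 < \det (E^T *m ext R G *m (ext R g *m E))]].

Definition conjv (R : realType) (x : 'cV[R[i]]_22) : 'cV[R[i]]_22 :=
  map_mx (@conjc R) x.

Definition complexv (R : realType) (k : 'cV[R]_22) : 'cV[R[i]]_22 :=
  map_mx (real_complex R) k.

Definition conjs (R : realType) (W : {vspace 'cV[R[i]]_22}) :
    {vspace 'cV[R[i]]_22} := <<map (@conjv R) (vbasis W)>>%VS.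

(* Points of P(Lambda_C) are the lines <[x]>, x != 0; only these carry
   information, other subspaces being isolated points of the type. *)
Definition projsp (R : realType) := final_topology
  (fun x : subspace [set x : 'cV[R[i]]_22 | x != 0] => <[x]>%VS).

Definition Omega (R : realType) (G : 'M[int]_22) : set (projsp R) :=
  [set p | exists2 x : 'cV[R[i]]_22, p = <[x]>%VS &
    bform G x x = 0 /\ 0 < bform G x (conjv x)].

(* A smooth rational curve of degree 2 in P(Lambda_C) is the image of an
   embedding of P^1 given by binary quadratic forms,
   [s : t] |-> [s^2 a + s t b + t^2 c] with a, b, c linearly independent;
   a, b, c are the columns of F. *)
Definition conic (R : realType) (F : 'M[R[i]]_(22, 3)) : set (projsp R) :=
  [set p | exists s t : R[i], ((s != 0) || (t != 0)) /\
    p = <[F *m \col_(k < 3) (s ^+ (2 - k) * t ^+ k)]>%VS].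

(* The Douady topology on smooth conics: the quotient of the space of
   parametrizations by reparametrization and rescaling. *)
Definition conicsp (R : realType) := final_topology
  (fun F : subspace [set F : 'M[R[i]]_(22, 3) | \rank F = 3%N] => conic F).

Definition conics_in_Omega (R : realType) (G : 'M[int]_22) : set (conicsp R) :=
  [set C | (exists2 F : 'M[R[i]]_(22, 3), \rank F = 3%N & C = conic F) /\
           C `<=` Omega G].

Definition Gplus (R : realType) (G : 'M[int]_22) :
    set {vspace 'cV[R[i]]_22} :=
  [set W | \dim W = 3%N /\
    forall v, v \in W -> v != 0 -> 0 < bform G v (conjv v)].

Definition psi (R : realType) (G : 'M[int]_22) (W : {vspace 'cV[R[i]]_22}) :
    conicsp R := [set p : projsp R | Omega G p /\ (p <= W)%VS].

(* Gplus is connected, so this union is a single connected component. *)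
Definition C1 (R : realType) (G : 'M[int]_22) : set (conicsp R) :=
  \bigcup_(W in @Gplus R G) connected_component (@conics_in_Omega R G) (psi G W).

Definition tau (R : realType) (C : conicsp R) : conicsp R :=
  [set conjs p | p in C].

Definition Tset (R : realType) (G : 'M[int]_22) : set (conicsp R) :=
  psi G @` [set W | Gplus G W /\
    forall d, Delta G d ->
      ~ (forall v, v \in W -> bform G (ext R[i] d) v = 0)].

Definition TR (R : realType) (G : 'M[int]_22) : set (conicsp R) :=
  [set C | Tset G C /\ tau C = C].

Definition positive_cone (R : realType) (G : 'M[int]_22) (p : projsp R) :
    set 'cV[R]_22 :=
  [set k | (forall x, x \in (p : {vspace _}) -> bform G (complexv k) x = 0) /\
           0 < bform G k k].

(* V is a choice of a component of the positive cone at each point of Omega;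
   it is continuous iff the chosen components form an open subset of the total
   space of the positive cones. *)
Definition continuous_component (R : realType) (G : 'M[int]_22)
    (V : projsp R -> set 'cV[R]_22) : Prop :=
  (forall p, Omega G p -> exists2 k, positive_cone G p k &
     V p = connected_component (positive_cone G p) k) /\
  open ([set kp | Omega G kp.2 /\ V kp.2 kp.1] :
    set (subspace [set kp : 'cV[R]_22 * projsp R |
                    Omega G kp.2 /\ positive_cone G kp.2 kp.1])).

Definition Vcirc (R : realType) (G : 'M[int]_22)
    (V : projsp R -> set 'cV[R]_22) (p : projsp R) : set 'cV[R]_22 :=
  [set k | V p k /\ forall d, Delta G d ->
    (forall x, x \in (p : {vspace _}) -> bform G (ext R[i] d) x = 0) ->
    bform G k (ext R d) != 0].

Definition kappa_class (R : realType) (G : 'M[int]_22)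
    (V : projsp R -> set 'cV[R]_22) (kp : 'cV[R]_22 * projsp R) :
    set 'cV[R]_22 * projsp R :=
  (connected_component (Vcirc G V kp.2) kp.1, kp.2).

Definition kappa_total (R : realType) (G : 'M[int]_22)
    (V : projsp R -> set 'cV[R]_22) : set ('cV[R]_22 * projsp R) :=
  [set kp | Omega G kp.2 /\ Vcirc G V kp.2 kp.1].

Definition tOmegasp (R : realType) (G : 'M[int]_22)
    (V : projsp R -> set 'cV[R]_22) := final_topology
  (fun kp : subspace (kappa_total G V) => kappa_class G V kp).

Definition tOmega (R : realType) (G : 'M[int]_22)
    (V : projsp R -> set 'cV[R]_22) : set (tOmegasp G V) :=
  kappa_class G V @` kappa_total G V.

(* The universal curve restricted to W `<=` C1. *)
Definition univ (R : realType) (G : 'M[int]_22) (W : set (conicsp R)) :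
    set (conicsp R * projsp R) :=
  [set z | [/\ C1 G z.1, W z.1 & z.1 z.2]].

Definition tuniv (R : realType) (G : 'M[int]_22)
    (V : projsp R -> set 'cV[R]_22) : set (conicsp R * tOmegasp G V) :=
  [set w | [/\ C1 G w.1, @tOmega R G V w.2 & w.1 w.2.2]].

Definition q1 (R : realType) (G : 'M[int]_22)
    (V : projsp R -> set 'cV[R]_22) (w : conicsp R * tOmegasp G V) :
    conicsp R * projsp R := (w.1, w.2.2).

(* s represents an element of F(W); its values outside [univ G W] are
   irrelevant. *)
Definition is_section (R : realType) (G : 'M[int]_22)
    (V : projsp R -> set 'cV[R]_22) (W : set (conicsp R))
    (s : conicsp R * projsp R -> conicsp R * tOmegasp G V) : Prop :=
  {within univ G W, continuous s} /\
  forall z, univ G W z -> tuniv (s z) /\ q1 (s z) = z.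

Definition act_line (R : realType) (g : 'M[int]_22) (p : projsp R) : projsp R :=
  (linfun (mulmx (ext R[i] g)) @: p)%VS.

Definition act_conic (R : realType) (g : 'M[int]_22) (C : conicsp R) :
    conicsp R := [set act_line g p | p in C].

Definition act_univ (R : realType) (g : 'M[int]_22)
    (z : conicsp R * projsp R) : conicsp R * projsp R :=
  (act_conic g z.1, act_line g z.2).

Definition act_tuniv (R : realType) (G : 'M[int]_22)
    (V : projsp R -> set 'cV[R]_22) (g : 'M[int]_22)
    (w : conicsp R * tOmegasp G V) : conicsp R * tOmegasp G V :=
  (act_conic g w.1, ([set ext R g *m k | k in w.2.1], act_line g w.2.2)).

Definition act_section (R : realType) (G : 'M[int]_22)
    (V : projsp R -> set 'cV[R]_22) (g : 'M[int]_22)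
    (s : conicsp R * projsp R -> conicsp R * tOmegasp G V) :
    conicsp R * projsp R -> conicsp R * tOmegasp G V :=
  fun z => act_tuniv g (s (act_univ (invmx g) z)).

Definition Gamma_invariant (R : realType) (G : 'M[int]_22)
    (V : projsp R -> set 'cV[R]_22) (W : set (conicsp R))
    (s : conicsp R * projsp R -> conicsp R * tOmegasp G V) : Prop :=
  forall g, Gamma R G g -> {in univ G W, act_section g s =1 s}.

Definition is_kappa (R : realType) (G : 'M[int]_22)
    (V : projsp R -> set 'cV[R]_22) (z : conicsp R * projsp R)
    (k : 'cV[R]_22) : Prop :=
  [/\ Vcirc G V z.2 k, bform G k k = 1 &
    exists W, [/\ Gplus G W, conjs W = W, z.1 = psi G W,
      W = (z.2 + <[complexv k]> + conjs z.2)%VS &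
      directv (z.2 + <[complexv k]> + conjs z.2)]].

Definition sigma_R (R : realType) (G : 'M[int]_22)
    (V : projsp R -> set 'cV[R]_22) (z : conicsp R * projsp R) :
    conicsp R * tOmegasp G V :=
  (z.1, kappa_class G V (xget 0 (is_kappa G V z), z.2)).

Definition invariant_extension (R : realType) (G : 'M[int]_22)
    (V : projsp R -> set 'cV[R]_22) (U : set (conicsp R))
    (s : conicsp R * projsp R -> conicsp R * tOmegasp G V) : Prop :=
  [/\ is_section U s, Gamma_invariant U s &
      {in univ G (@TR R G), s =1 @sigma_R R G V}].

(* Main.v *)
(* Write Lambda_R = R^3 + R^19. The graphs of the contractions M : C^3 -> C^19
   are exactly the members of G+, so conics are parametrized by the convex set
   of such M. For W in G+ and p = [x] in P(W), a vector y of W with y^2 > 0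
   orthogonal to x and conj x is unique up to a real factor; k = Re y, with
   the sign prescribed by V, extends kappa from real to arbitrary W. Call W
   good when k lies on no wall of p, that is, when no root is orthogonal to one
   of the positive three-spaces <Re x, Im x, k>. Roots are locally finite on
   positive three-spaces and P(W) meets Omega in a compact conic, so goodness is
   open, and it holds on T_R. U is the connected component of the good locus
   that contains T_R; here T_R is connected because two real contractions can
   be joined through a third one by segments that avoid the countably many
   bad points. Gamma preserves V, because the orientation of (Re x, Im x, k) is
   constant on Omega, so the section is invariant. It is unique because, for a
   fixed root d, the sign of <k, d> at the points of C on d^perp is locally
   constant in C: these points are roots of a quadratic equation, and move
   continuously with C. *)
Require Import Defs.
From mathcomp Require Import all_boot all_order all_algebra.
From mathcomp Require Import complex.
From mathcomp Require Import ring lra zify.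
From mathcomp Require Import all_classical all_reals all_analysis.
Set Implicit Arguments.
Unset Strict Implicit.
Unset Printing Implicit Defensive.
Import Order.TTheory GRing.Theory Num.Theory.
Import Normc.
Import numFieldTopology.Exports numFieldNormedType.Exports.
Local Open Scope classical_set_scope.
Local Open Scope ring_scope.
Local Open Scope complex_scope.
Local Notation Re := complex.Re.
Local Notation Im := complex.Im.

(** * Limits of matrices and complex numbers *)

(** The spaces of lines and of conics carry quotient topologies, so limits are computed with
    matrices: [cvg_final] pushes limits down to a quotient, while [near_line] and [near_Cc] lift
    neighborhoods by means of open saturated sets. This calls for a parametrization of the conics
    that is continuous over all contractions. A basis of [W] orthonormal for the complex bilinear
    form supplies it: in Gram-Schmidt every pivot has positive real part, where the principal square
    root is continuous. In such a basis all conics are copies of [x^2 + y^2 + z^2 = 0], and the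
    vector [y] is a multiple of a cross product.

    Local finiteness of the roots rests on a uniform negative bound for the form on the complements
    of positive frames: a root has square -2, so its integral coordinates are bounded.

    A point of [tOmega] is a chamber, determined by the signs of the roots orthogonal to [p]. This
    set of roots jumps with [p], which is why two sections are compared one root at a time, and only
    at the points of the conic on its wall. *)

Section filter_limits.
Variables (T : Type) (F : set_system T) (FF : Filter F).

Lemma near_all_fin (I : finType) (P : I -> T -> Prop) :
  (forall i, F (P i)) -> F (fun t => forall i, P i t).
Proof. by move=> H; exact: (@filter_forall T I P F FF H). Qed.

Lemma cvg_mx (X : topologicalType) m n (f : T -> 'M[X]_(m, n)) (a : 'M[X]_(m, n)) :
  (forall i j, (fun t => f t i j) @ F --> a i j) -> f @ F --> a.
Proof.
move=> fa A [P aP PA]; rewrite /fmap /=.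
have : F (fun t => forall i j, P i j (f t i j)).
  apply: (@near_all_fin _ (fun i t => forall j, P i j (f t i j))) => i.
  apply: (@near_all_fin _ (fun j t => P i j (f t i j))) => j; exact: (fa i j _ (aP i j)).
by apply: (@filterS _ F FF) => t Pt; apply: PA.
Qed.

Lemma cvg_entry (X : topologicalType) m n (f : T -> 'M[X]_(m, n)) (a : 'M[X]_(m, n)) :
  f @ F --> a -> forall i j, (fun t => f t i j) @ F --> a i j.
Proof.
move=> fa i j A aA.
pose P i' j' : set X := if (i' == i) && (j' == j) then A else setT.
have : nbhs a [set M : 'M[X]_(m, n) | A (M i j)].
  exists P => [i' j'|M]; first by rewrite /P; case: ifP => [/andP[/eqP-> /eqP->]//|_]; exact: filterT.
  by move/(_ i j); rewrite /P !eqxx.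
by move/fa.
Qed.

Variable K : numFieldType.
Implicit Types (f g : T -> K) (a b : K).

Lemma cvg_addf f g a b : f @ F --> a -> g @ F --> b -> (fun t => f t + g t) @ F --> a + b.
Proof. by move=> fa gb; exact: (@cvgD K K^o T F FF f g a b fa gb). Qed.

Lemma cvg_mulf f g a b : f @ F --> a -> g @ F --> b -> (fun t => f t * g t) @ F --> a * b.
Proof. by move=> fa gb; exact: (@cvgM K T F FF f g a b fa gb). Qed.

Lemma cvg_oppf f a : f @ F --> a -> (fun t => - f t) @ F --> - a.
Proof. by move=> fa; exact: (@cvgN K K^o T F FF f a fa). Qed.

Lemma cvg_subf f g a b : f @ F --> a -> g @ F --> b -> (fun t => f t - g t) @ F --> a - b.
Proof. by move=> fa gb; exact: (@cvgB K K^o T F FF f g a b fa gb). Qed.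

Lemma cvg_invf f a : a != 0 -> f @ F --> a -> (fun t => (f t)^-1) @ F --> a^-1.
Proof. by move=> a0 fa; apply: cvgV. Qed.

Lemma cvg_sumf (I : Type) (r : seq I) (f : I -> T -> K) (a : I -> K) :
  (forall i, f i @ F --> a i) -> (fun t => \sum_(i <- r) f i t) @ F --> \sum_(i <- r) a i.
Proof.
move=> fa; elim: r => [|i r IH].
  by rewrite big_nil; under eq_fun do rewrite big_nil; exact: cvg_cst.
by rewrite big_cons; under eq_fun do rewrite big_cons; exact: cvg_addf.
Qed.

Lemma cvg_prodf (I : Type) (r : seq I) (f : I -> T -> K) (a : I -> K) :
  (forall i, f i @ F --> a i) -> (fun t => \prod_(i <- r) f i t) @ F --> \prod_(i <- r) a i.
Proof.
move=> fa; elim: r => [|i r IH].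
  by rewrite big_nil; under eq_fun do rewrite big_nil; exact: cvg_cst.
by rewrite big_cons; under eq_fun do rewrite big_cons; exact: cvg_mulf.
Qed.

Lemma cvg_det n (f : T -> 'M[K]_n) (a : 'M[K]_n) :
  f @ F --> a -> (fun t => \det (f t)) @ F --> \det a.
Proof.
move=> fa; apply: cvg_sumf => s; apply: cvg_mulf; first exact: cvg_cst.
by apply: cvg_prodf => i; exact: cvg_entry.
Qed.

Lemma cvg_mulmx m n p (f : T -> 'M[K]_(m, n)) (g : T -> 'M[K]_(n, p)) (a : 'M[K]_(m, n)) (b : 'M[K]_(n, p)) :
  f @ F --> a -> g @ F --> b -> (fun t => f t *m g t) @ F --> a *m b.
Proof.
move=> fa gb; apply: cvg_mx => i j; rewrite mxE; under eq_fun do rewrite mxE.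
by apply: cvg_sumf => k; apply: cvg_mulf; exact: cvg_entry.
Qed.

Lemma cvg_addmx m n (f g : T -> 'M[K]_(m, n)) (a b : 'M[K]_(m, n)) :
  f @ F --> a -> g @ F --> b -> (fun t => f t + g t) @ F --> a + b.
Proof.
move=> fa gb; apply: cvg_mx => i j; rewrite mxE; under eq_fun do rewrite mxE.
by apply: cvg_addf; exact: cvg_entry.
Qed.

Lemma cvg_oppmx m n (f : T -> 'M[K]_(m, n)) (a : 'M[K]_(m, n)) : f @ F --> a -> (fun t => - f t) @ F --> - a.
Proof.
move=> fa; apply: cvg_mx => i j; rewrite mxE; under eq_fun do rewrite mxE.
by apply: cvg_oppf; exact: cvg_entry.
Qed.

Lemma cvg_scalemx m n (f : T -> K) (g : T -> 'M[K]_(m, n)) a (b : 'M[K]_(m, n)) :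
  f @ F --> a -> g @ F --> b -> (fun t => f t *: g t) @ F --> a *: b.
Proof.
move=> fa gb; apply: cvg_mx => i j; rewrite mxE; under eq_fun do rewrite mxE.
by apply: cvg_mulf => //; exact: cvg_entry.
Qed.

Lemma cvg_trmx m n (f : T -> 'M[K]_(m, n)) (a : 'M[K]_(m, n)) : f @ F --> a -> (fun t => (f t)^T) @ F --> a^T.
Proof.
move=> fa; apply: cvg_mx => i j; rewrite mxE; under eq_fun do rewrite mxE.
exact: cvg_entry.
Qed.

Lemma cvg_bform (G : 'M[int]_22) (f g : T -> 'cV[K]_22) (a b : 'cV[K]_22) :
  f @ F --> a -> g @ F --> b -> (fun t => bform G (f t) (g t)) @ F --> bform G a b.
Proof.
move=> fa gb; rewrite /bform; apply: cvg_entry.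
by apply: cvg_mulmx => //; apply: cvg_mulmx; [exact: cvg_trmx|exact: cvg_cst].
Qed.

End filter_limits.

Section complex_limits.
Variables (R : realType) (T : Type) (F : set_system T) (FF : Filter F).
Implicit Types (f : T -> R[i]) (a : R[i]).

(** The norm of [R[i]] takes its values in [R[i]], so the radii of balls are complex numbers that
    are positive for the partial order, hence real. This is the form of limits with radii in [R]. *)
Lemma cvg_complexP f a : (forall e : R, 0 < e -> F (fun t => normc (a - f t) < e)) <-> f @ F --> a.
Proof.
split=> [H|/cvgrPdist_lt H e e0].
  apply/cvgrPdist_lt => e e0.
  have e0' : 0 < Re e by move: e0; rewrite ltcE => /andP[].
  have eE : e = (Re e)%:C.
    by apply/eqP; move: e0; rewrite ltcE eq_complex /= => /andP[/eqP-> _]; rewrite !eqxx.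
  by apply: (@filterS _ F FF _ _ _ (H _ e0')) => t; rewrite eE ltcR.
have := H e%:C; rewrite ltcR => /(_ e0).
by apply: (@filterS _ F FF) => t; rewrite ltcR.
Qed.

Lemma le_Re_normc (z : R[i]) : `|Re z| <= normc z.
Proof. by rewrite -lecR; exact: normc_ge_Re. Qed.

Lemma le_Im_normc (z : R[i]) : `|Im z| <= normc z.
Proof.
rewrite -[leRHS]mul1r.
have -> : (1 : R) = normc ('i : R[i]) by rewrite /normc /= expr0n /= add0r expr1n sqrtr1.
rewrite -normcM -normrN; have -> : - Im z = Re ('i * z) by rewrite mulrC ReiNIm.
exact: le_Re_normc.
Qed.

Lemma le_normc_ReIm (z : R[i]) : normc z <= `|Re z| + `|Im z|.
Proof.
have -> : normc z = normc ((Re z)%:C + 'i * (Im z)%:C) by rewrite -complexE.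
apply: (le_trans (le_normcD _ _)).
rewrite normcM; have E (x : R) : normc x%:C = `|x| by rewrite /normc /= expr0n /= addr0 sqrtr_sqr.
rewrite !E; have -> : normc ('i : R[i]) = 1 by rewrite /normc /= expr0n /= add0r expr1n sqrtr1.
by rewrite mul1r.
Qed.

Lemma cvg_Re f a : f @ F --> a -> (fun t => Re (f t)) @ F --> Re a.
Proof.
move/cvg_complexP => H; apply/cvgrPdist_lt => e e0.
apply: (@filterS _ F FF _ _ _ (H e e0)) => t; apply: le_lt_trans.
have -> : Re a - Re (f t) = Re (a - f t) by case: (a) (f t) => [? ?] [? ?]. exact: le_Re_normc.
Qed.

Lemma cvg_Im f a : f @ F --> a -> (fun t => Im (f t)) @ F --> Im a.
Proof.
move/cvg_complexP => H; apply/cvgrPdist_lt => e e0.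
apply: (@filterS _ F FF _ _ _ (H e e0)) => t; apply: le_lt_trans.
have -> : Im a - Im (f t) = Im (a - f t) by case: (a) (f t) => [? ?] [? ?].
exact: le_Im_normc.
Qed.

Lemma cvg_ReIm f a : (fun t => Re (f t)) @ F --> Re a -> (fun t => Im (f t)) @ F --> Im a -> f @ F --> a.
Proof.
move=> /cvgrPdist_lt Hr /cvgrPdist_lt Hi; apply/cvg_complexP => e e0; near=> t.
apply: (le_lt_trans (le_normc_ReIm _)); rewrite (splitr e); apply: ltrD.
  have -> : Re (a - f t) = Re a - Re (f t) by case: (a) (f t) => [? ?] [? ?].
  by near: t; apply: Hr; rewrite divr_gt0.
have -> : Im (a - f t) = Im a - Im (f t) by case: (a) (f t) => [? ?] [? ?].
by near: t; apply: Hi; rewrite divr_gt0.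
Unshelve. all: by end_near. Qed.

Lemma cvg_conjc f a : f @ F --> a -> (fun t => (f t)^*) @ F --> a^*.
Proof.
move=> fa; have E (z : R[i]) : Re z^* = Re z /\ Im z^* = - Im z by case: z.
apply: cvg_ReIm; rewrite ?(E a).1 ?(E a).2.
  by under eq_fun do rewrite (E _).1; exact: cvg_Re.
by under eq_fun do rewrite (E _).2; apply: cvg_oppf; exact: cvg_Im.
Qed.

Lemma cvg_real_complex (f : T -> R) (a : R) : f @ F --> a -> (fun t => (f t)%:C) @ F --> a%:C.
Proof. by move=> fa; apply: cvg_ReIm => //=; exact: cvg_cst. Qed.

Lemma cvg_map_mx (A B : topologicalType) m n (h : A -> B) (f : T -> 'M[A]_(m, n)) (a : 'M[A]_(m, n)) :
  (forall (g : T -> A) b, g @ F --> b -> (fun t => h (g t)) @ F --> h b) ->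
  f @ F --> a -> (fun t => map_mx h (f t)) @ F --> map_mx h a.
Proof.
move=> H fa; apply: cvg_mx => i j; rewrite mxE; under eq_fun do rewrite mxE.
by apply: H; exact: cvg_entry.
Qed.

Lemma cvg_conjv (f : T -> 'cV[R[i]]_22) (a : 'cV[R[i]]_22) : f @ F --> a -> (fun t => conjv (f t)) @ F --> conjv a.
Proof. by apply: cvg_map_mx => g b; exact: cvg_conjc. Qed.

Lemma cvg_Remx m n (f : T -> 'M[R[i]]_(m, n)) (a : 'M[R[i]]_(m, n)) : f @ F --> a -> (fun t => map_mx (@Re R) (f t)) @ F --> map_mx (@Re R) a.
Proof. by apply: cvg_map_mx => g b; exact: cvg_Re. Qed.

Lemma cvg_Immx m n (f : T -> 'M[R[i]]_(m, n)) (a : 'M[R[i]]_(m, n)) : f @ F --> a -> (fun t => map_mx (@Im R) (f t)) @ F --> map_mx (@Im R) a.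
Proof. by apply: cvg_map_mx => g b; exact: cvg_Im. Qed.

End complex_limits.

(** * The bilinear form *)

Section bilinear.
Variables (K : comNzRingType) (G : 'M[int]_22).
Implicit Types x y z : 'cV[K]_22.

Lemma bformDl x y z : bform G (x + y) z = bform G x z + bform G y z.
Proof. by rewrite /bform linearD !mulmxDl mxE. Qed.

Lemma bformDr x y z : bform G x (y + z) = bform G x y + bform G x z.
Proof. by rewrite /bform mulmxDr mxE. Qed.

Lemma bformZl a x z : bform G (a *: x) z = a * bform G x z.
Proof. by rewrite /bform linearZ /= -!scalemxAl mxE. Qed.

Lemma bformZr a x z : bform G x (a *: z) = a * bform G x z.
Proof. by rewrite /bform -!scalemxAr mxE. Qed.

Lemma bformNl x z : bform G (- x) z = - bform G x z.
Proof. by rewrite -scaleN1r bformZl mulN1r. Qed.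

Lemma bformNr x z : bform G x (- z) = - bform G x z.
Proof. by rewrite -scaleN1r bformZr mulN1r. Qed.

Lemma bform0l x : bform G 0 x = 0.
Proof. by rewrite -(scale0r (0 : 'cV[K]_22)) bformZl mul0r. Qed.

Lemma bform0r x : bform G x 0 = 0.
Proof. by rewrite -(scale0r (0 : 'cV[K]_22)) bformZr mul0r. Qed.

Lemma bformBl x y z : bform G (x - y) z = bform G x z - bform G y z.
Proof. by rewrite bformDl bformNl. Qed.

Lemma bformBr x y z : bform G x (y - z) = bform G x y - bform G x z.
Proof. by rewrite bformDr bformNr. Qed.

Lemma bformC x y : G^T = G -> bform G x y = bform G y x.
Proof.
move=> GT; rewrite /bform.
transitivity ((x^T *m ext K G *m y)^T 0 0); first by rewrite [RHS]mxE.
by rewrite !trmx_mul trmxK mulmxA /ext matrix.map_trmx GT.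
Qed.

Lemma mxE_bform m n (E : 'M[K]_(22, m)) (F : 'M[K]_(22, n)) i j :
  (E^T *m ext K G *m F) i j = bform G (col i E) (col j F).
Proof.
rewrite /bform !mxE; apply: eq_bigr => k _; rewrite !mxE; congr (_ * _).
by apply: eq_bigr => l _; rewrite !mxE.
Qed.

Lemma bform_mulmx (g : 'M[int]_22) x y : g^T *m G *m g = G ->
  bform G (ext K g *m x) (ext K g *m y) = bform G x y.
Proof.
move=> gG; have E : (ext K g)^T *m ext K G *m ext K g = ext K G.
  by rewrite /ext matrix.map_trmx -!map_mxM gG.
by rewrite /bform trmx_mul -[in RHS]E !mulmxA.
Qed.

End bilinear.

Lemma ext_mul (K : pzRingType) m n p (A : 'M[int]_(m, n)) (B : 'M[int]_(n, p)) :
  ext K (A *m B) = ext K A *m ext K B.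
Proof. exact: map_mxM. Qed.

Lemma ext1 (K : pzRingType) n : ext K (1%:M : 'M[int]_n) = 1%:M.
Proof. exact: map_mx1. Qed.

Section real_and_imaginary_parts.
Variable R : realType.
Local Notation C := R[i].
Implicit Types (x y : 'cV[C]_22) (k l : 'cV[R]_22).

Definition Rev x : 'cV[R]_22 := map_mx (@Re R) x.
Definition Imv x : 'cV[R]_22 := map_mx (@Im R) x.

Lemma conjvD x y : conjv (x + y) = conjv x + conjv y.
Proof. exact: map_mxD. Qed.

Lemma conjvZ (a : C) x : conjv (a *: x) = a^* *: conjv x.
Proof. exact: map_mxZ. Qed.

Lemma conjvK : involutive (@conjv R).
Proof. by move=> x; apply/matrixP => i j; rewrite !mxE conjcK. Qed.

Lemma conjv_eq0 x : (conjv x == 0) = (x == 0).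
Proof.
have conj0 : conjv (0 : 'cV[C]_22) = 0 by exact: map_mx0.
apply/eqP/eqP => [x0|->//]; by rewrite -[x]conjvK x0.
Qed.

Lemma conjv_complexv k : conjv (complexv k) = complexv k.
Proof. by apply/matrixP => i j; rewrite !mxE /= oppr0. Qed.

Lemma conjv_mulmx_ext (g : 'M[int]_22) x : conjv (ext C g *m x) = ext C g *m conjv x.
Proof.
rewrite /conjv map_mxM; congr (_ *m _); apply/matrixP => i j.
by rewrite !mxE /= rmorph_int.
Qed.

Lemma complexv_mulmx_ext (g : 'M[int]_22) k : complexv (ext R g *m k) = ext C g *m complexv k.
Proof.
rewrite /complexv map_mxM; congr (_ *m _); apply/matrixP => i j.
by rewrite !mxE /= rmorph_int.
Qed.

Lemma complexv_ext (d : 'cV[int]_22) : complexv (ext R d) = ext C d.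
Proof. by apply/matrixP => i j; rewrite !mxE /= rmorph_int. Qed.

Lemma complexvD k l : complexv (k + l) = complexv k + complexv l.
Proof. exact: map_mxD. Qed.

Lemma complexvZ (a : R) k : complexv (a *: k) = a%:C *: complexv k.
Proof. exact: map_mxZ. Qed.

Lemma complexv_inj : injective (@complexv R).
Proof. by move=> k l /matrixP kl; apply/matrixP => i j; move: (kl i j); rewrite !mxE => -[]. Qed.

Lemma Rev_complexv k : Rev (complexv k) = k.
Proof. by apply/matrixP => i j; rewrite !mxE. Qed.

Lemma complexvE x : x = complexv (Rev x) + 'i *: complexv (Imv x).
Proof. by apply/matrixP => i j; rewrite !mxE -complexE. Qed.

Lemma complexv_Rev x : complexv (Rev x) = 2^-1 *: (x + conjv x).
Proof. by apply/matrixP => i j; rewrite !mxE ReJ_add mulrC. Qed.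

Lemma RevZ (a : R) x : Rev (a%:C *: x) = a *: Rev x.
Proof. by apply/matrixP => i j; rewrite !mxE; case: (x i j) => u v /=; rewrite mul0r subr0. Qed.

Lemma Rev_conjv x : Rev (conjv x) = Rev x.
Proof. by apply/matrixP => i j; rewrite !mxE; case: (x i j). Qed.

Lemma Rev_mulmx_ext (g : 'M[int]_22) x : Rev (ext C g *m x) = ext R g *m Rev x.
Proof.
apply: complexv_inj; rewrite complexv_mulmx_ext !complexv_Rev conjv_mulmx_ext.
by rewrite -mulmxDr -scalemxAr.
Qed.

Lemma Imv_mulmx_ext (g : 'M[int]_22) x : Imv (ext C g *m x) = ext R g *m Imv x.
Proof.
have ImE z : Imv z = - Rev ('i *: z).
  by apply/matrixP => i j; rewrite !mxE mulrC ReiNIm opprK.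
by rewrite !ImE scalemxAr Rev_mulmx_ext mulmxN.
Qed.

Variable G : 'M[int]_22.

Lemma bform_conjv x y : bform G (conjv x) (conjv y) = (bform G x y)^*.
Proof.
rewrite /bform; transitivity ((map_mx (@conjc R) (x^T *m ext C G *m y)) 0 0); last by rewrite mxE.
rewrite !map_mxM /conjv matrix.map_trmx; congr ((_ *m _ *m _) 0 0).
by apply/matrixP => i j; rewrite !mxE /= rmorph_int.
Qed.

Lemma bform_complexv k l : bform G (complexv k) (complexv l) = (bform G k l)%:C.
Proof.
rewrite /bform; transitivity ((map_mx (real_complex R) (k^T *m ext R G *m l)) 0 0); last by rewrite mxE.
rewrite !map_mxM /complexv matrix.map_trmx; congr ((_ *m _ *m _) 0 0).
by apply/matrixP => i j; rewrite !mxE /= rmorph_int.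
Qed.

Lemma bform_complexvl k x : bform G (complexv k) x = bform G k (Rev x) +i* bform G k (Imv x).
Proof.
rewrite {1}[x]complexvE bformDr bformZr !bform_complexv.
by rewrite [RHS]complexE.
Qed.

Lemma bform_complexvl_eq0 k x :
  bform G (complexv k) x = 0 <-> bform G k (Rev x) = 0 /\ bform G k (Imv x) = 0.
Proof. by rewrite bform_complexvl; split=> [[-> ->]//|[-> ->]]. Qed.

Lemma bform_Rev_r k x : bform G k (Rev x) = Re (bform G (complexv k) x).
Proof. by rewrite bform_complexvl. Qed.

Hypothesis GT : G^T = G.

Lemma hermE x : bform G x (conjv x) =
  (bform G (Rev x) (Rev x) + bform G (Imv x) (Imv x))%:C.
Proof.
have ii : 'i * 'i = -1 :> C by rewrite -expr2 sqr_i.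
have cx : conjv x = complexv (Rev x) - 'i *: complexv (Imv x).
  by apply/matrixP => i j; rewrite !mxE; case: (x i j) => u v; rewrite /=; apply/eqP; rewrite eq_complex /=; apply/andP; split; apply/eqP; ring.
rewrite cx {1}[x]complexvE !(bformDl, bformBr, bformZl, bformZr) !bform_complexv.
rewrite (@bformC _ _ (Imv x) (Rev x) GT) rmorphD /=.
ring: ii.
Qed.

Lemma bform_selfE x : bform G x x =
  (bform G (Rev x) (Rev x) - bform G (Imv x) (Imv x)) +i* (2 * bform G (Rev x) (Imv x)).
Proof.
rewrite [in LHS](complexvE x) !(bformDl, bformDr, bformZl, bformZr) !bform_complexv.
rewrite (@bformC _ _ (Imv x) (Rev x) GT).
by apply/eqP; rewrite eq_complex /=; apply/andP; split; apply/eqP; ring.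
Qed.

Lemma bform_isoE x : bform G x x = 0 <->
  bform G (Rev x) (Imv x) = 0 /\ bform G (Rev x) (Rev x) = bform G (Imv x) (Imv x).
Proof.
rewrite bform_selfE; split=> [[/eqP e1 /eqP e2]|[-> ->]]; last by rewrite mulr0 subrr.
by move: e1 e2; rewrite subr_eq0 mulf_eq0 pnatr_eq0 /= => /eqP-> /eqP->.
Qed.

End real_and_imaginary_parts.

Section squared_norms.
Variable R : realType.
Local Notation C := R[i].

Definition rsq n (u : 'cV[R]_n) : R := \sum_k u k 0 ^+ 2.
Definition nsq n (u : 'cV[C]_n) : R := \sum_k (Re (u k 0) ^+ 2 + Im (u k 0) ^+ 2).

Lemma rsq_ge0 n (u : 'cV[R]_n) : 0 <= rsq u.
Proof. by apply: sumr_ge0 => k _; exact: sqr_ge0. Qed.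

Lemma rsq_eq0 n (u : 'cV[R]_n) : rsq u = 0 -> u = 0.
Proof.
move=> /eqP; rewrite psumr_eq0 => [/allP u0|k _]; last exact: sqr_ge0.
apply/matrixP => i j; rewrite mxE (ord1 j); apply/eqP.
by rewrite -sqrf_eq0; apply: (u0 i); rewrite mem_index_enum.
Qed.

Lemma nsq_ge0 n (u : 'cV[C]_n) : 0 <= nsq u.
Proof. by apply: sumr_ge0 => k _; rewrite addr_ge0 ?sqr_ge0. Qed.

Lemma nsq_eq0 n (u : 'cV[C]_n) : nsq u = 0 -> u = 0.
Proof.
move=> /eqP; rewrite psumr_eq0 => [/allP u0|k _]; last by rewrite addr_ge0 ?sqr_ge0.
apply/matrixP => i j; rewrite mxE (ord1 j).
have := u0 i (mem_index_enum _).
rewrite paddr_eq0 ?sqr_ge0 // !sqrf_eq0; case: (u i 0) => a b /=.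
by move=> /andP[/eqP-> /eqP->].
Qed.

Lemma nsq_gt0 n (u : 'cV[C]_n) : u != 0 -> 0 < nsq u.
Proof.
move=> u0; rewrite lt_neqAle nsq_ge0 andbT eq_sym.
by apply: contra u0 => /eqP/nsq_eq0->.
Qed.

Lemma nsqE n (u : 'cV[C]_n) : (u^T *m map_mx (@conjc R) u) 0 0 = (nsq u)%:C.
Proof.
rewrite mxE /nsq rmorph_sum /=; apply: eq_bigr => k _; rewrite !mxE.
by case: (u k 0) => a b; apply/eqP; rewrite eq_complex /=; apply/andP; split; apply/eqP; ring.
Qed.

Lemma rsqE n (u : 'cV[R]_n) : (u^T *m u) 0 0 = rsq u.
Proof. by rewrite mxE; apply: eq_bigr => k _; rewrite !mxE expr2. Qed.

Lemma nsq_conj n (u : 'cV[C]_n) : nsq (map_mx (@conjc R) u) = nsq u.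
Proof. by apply: eq_bigr => k _; rewrite mxE; case: (u k 0) => a b /=; rewrite sqrrN. Qed.

(** The product on the left is bilinear, not Hermitian. Entrywise, with real and imaginary parts
    [a, b] and [c, d], the claim is [0 <= (a - c)^2 + (b + d)^2]. *)
Lemma Re_dot_le n (u v : 'cV[C]_n) : 2 * Re ((u^T *m v) 0 0) <= nsq u + nsq v.
Proof.
have ReS (I : Type) (r : seq I) (f : I -> C) : Re (\sum_(i <- r) f i) = \sum_(i <- r) Re (f i).
  elim: r => [|i r IH]; first by rewrite !big_nil.
  by rewrite !big_cons -IH; case: (f i) (\sum_(j <- r) f j) => [? ?] [? ?].
rewrite mxE ReS mulr_sumr /nsq -big_split /=; apply: ler_sum => k _; rewrite mxE.
case: (u k 0) (v k 0) => [a b] [c d] /=.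
have := sqr_ge0 (a - c); have := sqr_ge0 (b + d); nra.
Qed.

End squared_norms.

Section signature.
Variables (R : realType) (G : 'M[int]_22).
Local Notation C := R[i].

(** The matrix [P] diagonalizes the form, so the first 3 and the last 19 rows of its inverse are
    coordinates in the positive and the negative directions. *)
Lemma K3_gram_split : K3_gram R G ->
  exists (U : 'M[R]_(3, 22)) (D : 'M[R]_(19, 22)) (Pu : 'M[R]_(22, 3)) (Pd : 'M[R]_(22, 19)),
  [/\ U *m Pu = 1%:M, D *m Pu = 0, U *m Pd = 0 & D *m Pd = 1%:M] /\
  Pu *m U + Pd *m D = 1%:M /\ ext R G = U^T *m U - D^T *m D.
Proof.
move=> [_ _ _ [P0 P0u PGP]].
pose P : 'M[R]_(22, 3 + 19) := P0; pose Q : 'M[R]_(3 + 19, 22) := invmx P0.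
have PQ : P *m Q = 1%:M by rewrite /P /Q mulmxV.
have QP : Q *m P = 1%:M by rewrite /P /Q mulVmx.
exists (usubmx Q), (dsubmx Q), (lsubmx P), (rsubmx P).
have E : block_mx (usubmx Q *m lsubmx P) (usubmx Q *m rsubmx P)
     (dsubmx Q *m lsubmx P) (dsubmx Q *m rsubmx P) = block_mx 1%:M 0 0 1%:M.
  by rewrite -mul_col_row vsubmxK hsubmxK QP -scalar_mx_block.
have [-> -> -> ->] := eq_block_mx E; split=> //; split.
  by rewrite -mul_row_col hsubmxK vsubmxK PQ.
have diagE : diag_mx (\row_(j < 3 + 19) (if (j < 3)%N then 1 else -1)) =
    block_mx 1%:M 0 0 (- 1%:M) :> 'M[R]_(3 + 19).
  apply/matrixP => i j; rewrite -(splitK i) -(splitK j).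
  case: (fintype.split i) => i'; case: (fintype.split j) => j' /=;
    rewrite ?(block_mxEul, block_mxEur, block_mxEdl, block_mxEdr) !mxE.
  - by rewrite /= ltn_ord (inj_eq (@lshift_inj _ _)).
  - by rewrite eq_lrshift.
  - by rewrite eq_rlshift.
  - by rewrite (inj_eq (@rshift_inj _ _)) /= mulNrn.
have -> : ext R G = Q^T *m (P^T *m ext R G *m P) *m Q.
  by rewrite !mulmxA -trmx_mul PQ trmx1 mul1mx -mulmxA PQ mulmx1.
rewrite [P^T *m _ *m P]PGP diagE -{1 2}[Q]vsubmxK tr_col_mx mul_row_block.
by rewrite !mulmx1 !mulmx0 addr0 add0r mulmxN mulmx1 mul_row_col mulNmx.
Qed.

End signature.

(** * Coordinates of signature (3, 19) *)

Section complex_square_root.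
Variable R : realType.
Local Notation C := R[i].

(* The principal square root, holomorphic on the right half-plane, in the
   form [(m + |m|) / sqrt (2 |m| + 2 Re m)]. *)
Definition csq (m : C) : C :=
  (m + (normc m)%:C) * ((Num.sqrt (2 * normc m + 2 * Re m))^-1)%:C.

Lemma normc_ge0 (m : C) : 0 <= normc m.
Proof. by case: m => a b; exact: sqrtr_ge0. Qed.

Lemma sqr_normc_ReIm (m : C) : normc m ^+ 2 = Re m ^+ 2 + Im m ^+ 2.
Proof. by case: m => a b; rewrite /= sqr_sqrtr // addr_ge0 ?sqr_ge0. Qed.

Lemma sqr_csq (m : C) : 0 < Re m -> csq m ^+ 2 = m.
Proof.
move=> m0; have d0 : 0 < 2 * normc m + 2 * Re m by have := normc_ge0 m; lra.
rewrite /csq exprMn -rmorphXn /= exprVn sqr_sqrtr ?(ltW d0) //.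
have s2 := sqr_normc_ReIm m.
set r := normc m in d0 s2 *.
(* As [r^2] is [m] times its conjugate, the square is [m] times the sum of [m], [2 r] and the
   conjugate of [m]. *)
have -> : (m + r%:C) ^+ 2 = m * (2 * r + 2 * Re m)%:C.
  case: m @r m0 d0 s2 => a b r /= m0 d0 s2; apply/eqP; rewrite eq_complex /=.
  rewrite addr0 mulr0 subr0 mulr0 add0r; apply/andP; split; apply/eqP; last by ring.
  have -> : (a + r) * (a + r) - b * b = a ^+ 2 + 2 * a * r + r ^+ 2 - b ^+ 2 by ring.
  by rewrite s2; ring.
by rewrite -mulrA -rmorphM /= divff ?mulr1 // gt_eqF.
Qed.

Lemma csq_neq0 (m : C) : 0 < Re m -> csq m != 0.
Proof.
move=> m0; apply/eqP => s0; have := sqr_csq m0; rewrite s0 expr0n /= => m00.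
by move: m0; rewrite -m00 /= ltxx.
Qed.

Variables (T : Type) (F : set_system T) (FF : Filter F).

Lemma cvg_sqrt (f : T -> R) (a : R) : f @ F --> a -> (fun t => Num.sqrt (f t)) @ F --> Num.sqrt a.
Proof. by move=> fa; apply: (cvg_comp f (@Num.sqrt R) fa); exact: sqrt_continuous. Qed.

Lemma cvg_normc (f : T -> C) a : f @ F --> a -> (fun t => normc (f t)) @ F --> normc a.
Proof.
have E (z : C) : normc z = Num.sqrt (Re z * Re z + Im z * Im z) by case: z => u v; rewrite /= !expr2.
move=> fa; rewrite E; under eq_fun do rewrite E.
by apply: cvg_sqrt; apply: cvg_addf; apply: cvg_mulf; first [exact: cvg_Re|exact: cvg_Im].
Qed.

Lemma cvg_csq (f : T -> C) a : 0 < Re a -> f @ F --> a -> (fun t => csq (f t)) @ F --> csq a.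
Proof.
move=> a0 fa; pose proof (cvg_normc fa) as fn; pose proof (cvg_Re FF fa) as fr.
apply: cvg_mulf.
  by apply: cvg_addf; [exact: fa|exact: cvg_real_complex].
apply: cvg_real_complex; apply: cvg_invf.
  by rewrite gt_eqF // sqrtr_gt0; have := normc_ge0 a; lra.
by apply: cvg_sqrt; apply: cvg_addf; (apply: cvg_mulf; [exact: cvg_cst|]).
Qed.

End complex_square_root.

(* Coordinates adapted to the signature (3, 19): [up] and [dn] are the
   coordinates in the positive and the negative directions. *)
Record splitting (R : realType) (G : 'M[int]_22) := Splitting {
  up : 'M[R]_(3, 22);
  dn : 'M[R]_(19, 22);
  iup : 'M[R]_(22, 3);
  idn : 'M[R]_(22, 19);
  upK : up *m iup = 1%:M;
  up_idn : up *m idn = 0;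
  dn_iup : dn *m iup = 0;
  dnK : dn *m idn = 1%:M;
  updnK : iup *m up + idn *m dn = 1%:M;
  gram_updn : ext R G = up^T *m up - dn^T *m dn;
  gram_sym : G^T = G }.

Lemma K3_splitting (R : realType) (G : 'M[int]_22) : K3_gram R G -> inhabited (splitting R G).
Proof.
move=> hG; have [U [D [Pu [Pd [[e1 e2 e3 e4] [e5 e6]]]]]] := K3_gram_split hG.
have [GT _ _ _] := hG.
by constructor; exact: (Splitting e1 e3 e2 e4 e5 e6 GT).
Qed.

Lemma unitmx_kernel (K : fieldType) n (A : 'M[K]_n) :
  (forall v : 'cV[K]_n, A *m v = 0 -> v = 0) -> A \in unitmx.
Proof.
move=> H; rewrite -unitmx_tr -row_free_unit -kermx_eq0; apply/rowV0P => v /sub_kermxP vA.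
by apply: trmx_inj; rewrite trmx0; apply: H; rewrite -[A]trmxK -trmx_mul vA trmx0.
Qed.

Section coordinates.
Variables (R : realType) (G : 'M[int]_22) (S : splitting R G).
Local Notation C := R[i].
Local Notation rc := (map_mx (real_complex R)).

Definition upc (x : 'cV[C]_22) : 'cV[C]_3 := rc (up S) *m x.
Definition dnc (x : 'cV[C]_22) : 'cV[C]_19 := rc (dn S) *m x.
Definition hsq (x : 'cV[C]_22) : R := nsq (upc x) - nsq (dnc x).

Lemma ext_complex : ext C G = rc (ext R G).
Proof. by apply/matrixP => i j; rewrite !mxE /= rmorph_int. Qed.

Lemma bform_updn (x y : 'cV[C]_22) :
  bform G x y = ((upc x)^T *m upc y) 0 0 - ((dnc x)^T *m dnc y) 0 0.
Proof.
rewrite /bform ext_complex (gram_updn S) rmorphB /= mulmxBr mulmxBl [LHS]mxE.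
congr (_ + _); last rewrite [LHS]mxE; [|congr (- _)];
  by rewrite !map_mxM /= /upc /dnc trmx_mul !mulmxA !matrix.map_trmx.
Qed.

Lemma bform_updnR (k l : 'cV[R]_22) :
  bform G k l = ((up S *m k)^T *m (up S *m l)) 0 0 - ((dn S *m k)^T *m (dn S *m l)) 0 0.
Proof.
rewrite /bform (gram_updn S) mulmxBr mulmxBl [LHS]mxE.
by congr (_ + _); last rewrite [LHS]mxE; [|congr (- _)]; rewrite trmx_mul !mulmxA.
Qed.

Lemma bformR_rsq (k : 'cV[R]_22) : bform G k k = rsq (up S *m k) - rsq (dn S *m k).
Proof. by rewrite bform_updnR !rsqE. Qed.

Lemma upc_conjv x : upc (conjv x) = map_mx (@conjc R) (upc x).
Proof.
rewrite /upc map_mxM /conjv; congr (_ *m _).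
by apply/matrixP => i j; rewrite !mxE /= oppr0.
Qed.

Lemma dnc_conjv x : dnc (conjv x) = map_mx (@conjc R) (dnc x).
Proof.
rewrite /dnc map_mxM /conjv; congr (_ *m _).
by apply/matrixP => i j; rewrite !mxE /= oppr0.
Qed.

Lemma herm_hsq x : bform G x (conjv x) = (hsq x)%:C.
Proof. by rewrite bform_updn upc_conjv dnc_conjv !nsqE -rmorphB. Qed.

Lemma herm_gt0 x : (0 < bform G x (conjv x)) = (0 < hsq x).
Proof. by rewrite herm_hsq ltcR. Qed.

Lemma hsq_conjv x : hsq (conjv x) = hsq x.
Proof. by rewrite /hsq upc_conjv dnc_conjv !nsq_conj. Qed.

Lemma updncE x : x = rc (iup S) *m upc x + rc (idn S) *m dnc x.
Proof.
by rewrite /upc /dnc !mulmxA -mulmxDl -!map_mxM -map_mxD updnK map_mx1 mul1mx.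
Qed.

Lemma updnRE (k : 'cV[R]_22) : k = iup S *m (up S *m k) + idn S *m (dn S *m k).
Proof. by rewrite !mulmxA -mulmxDl updnK mul1mx. Qed.

(** On the positive coordinates the bilinear product is then the squared norm itself; on the
    negative ones it is only bounded, by [Re_dot_le]. This estimate is what keeps the Gram-Schmidt
    pivots in the right half-plane. *)
Lemma Re_bform_ge (x x' : 'cV[C]_22) : upc x' = map_mx (@conjc R) (upc x) ->
  hsq x + hsq x' <= 2 * Re (bform G x x').
Proof.
move=> xx'; rewrite /hsq bform_updn xx' nsq_conj nsqE.
have := Re_dot_le (dnc x) (dnc x').
move: (((dnc x)^T *m dnc x') 0 0) => [a b] /=; lra.
Qed.

(** The form is negative definite on the kernel of [up S]. *)
Lemma bformR_up0 k : up S *m k = 0 -> 0 <= bform G k k -> k = 0.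
Proof.
move=> uk; have r0 : rsq (0 : 'cV[R]_3) = 0 by apply: big1 => i _; rewrite mxE expr0n.
rewrite bformR_rsq uk r0 sub0r oppr_ge0 => dk.
have := rsq_ge0 (dn S *m k); move=> dk'.
have /rsq_eq0 d0 : rsq (dn S *m k) = 0 by apply/eqP; rewrite eq_le dk dk'.
by rewrite [k]updnRE uk d0 !mulmx0 addr0.
Qed.

Lemma positive_frame_up (F : 'M[R]_(22, 3)) : positive_frame G F -> up S *m F \in unitmx.
Proof.
move=> pF; apply: unitmx_kernel => v Fv; apply/eqP; apply/negP => /negP v0.
have p := pF _ v0; have Fv0 := bformR_up0 (etrans (mulmxA _ _ _) Fv) (ltW p).
by move: p; rewrite Fv0 bform0l ltxx.
Qed.

(* The signature is (3, 19), so nothing outside a positive three-space is both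
   orthogonal to it and nonnegative. *)
Lemma perp_frame_neg (F : 'M[R]_(22, 3)) (v : 'cV[R]_22) :
  positive_frame G F -> F^T *m ext R G *m v = 0 -> v != 0 -> bform G v v < 0.
Proof.
move=> pF Fv v0; have uF := positive_frame_up pF.
rewrite ltNge; apply/negP => vp.
(* With this [a] the vector [F *m a + v] has no positive coordinates, so its square is negative
   unless it vanishes; but its two terms are orthogonal and have nonnegative squares. *)
pose a := - (invmx (up S *m F) *m (up S *m v)).
have Fav : bform G (F *m a) v = 0 by rewrite /bform trmx_mul -!mulmxA [_ *m (_ *m v)]mulmxA Fv mulmx0 mxE.
have w0 : up S *m (F *m a + v) = 0.
  by rewrite mulmxDr mulmxA /a mulmxN mulmxA mulmxV // mul1mx addNr.
have qw : bform G (F *m a + v) (F *m a + v) = bform G (F *m a) (F *m a) + bform G v v.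
  rewrite bformDl !bformDr Fav (bformC v _ (gram_sym S)) Fav; ring.
have [a0|a0] := eqVneq a 0.
  have := bformR_up0 w0; rewrite a0 mulmx0 add0r => /(_ vp) v00.
  by rewrite v00 eqxx in v0.
have p := pF _ a0; have := bformR_up0 w0; rewrite qw => H.
have w00 := H (addr_ge0 (ltW p) vp); move: qw; rewrite w00 bform0l; lra.
Qed.

End coordinates.

(** * Charts and orthonormal frames *)

Section chart.
Variables (R : realType) (G : 'M[int]_22) (S : splitting R G).
Local Notation C := R[i].
Local Notation rc := (map_mx (real_complex R)).

Definition chart (M : 'M[C]_(19, 3)) : 'M[C]_(22, 3) := rc (iup S) + rc (idn S) *m M.

Definition contractive (M : 'M[C]_(19, 3)) : Prop :=
  forall u : 'cV[C]_3, u != 0 -> nsq (M *m u) < nsq u.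

Lemma upc_chart M (u : 'cV[C]_3) : upc S (chart M *m u) = u.
Proof.
rewrite /upc mulmxA /chart mulmxDr mulmxA -!map_mxM upK up_idn map_mx1 map_mx0.
by rewrite mul0mx addr0 mul1mx.
Qed.

Lemma dnc_chart M (u : 'cV[C]_3) : dnc S (chart M *m u) = M *m u.
Proof.
rewrite /dnc mulmxA /chart mulmxDr mulmxA -!map_mxM dn_iup dnK map_mx1 map_mx0.
by rewrite mul1mx add0r.
Qed.

Lemma hsq_chart M (u : 'cV[C]_3) : hsq S (chart M *m u) = nsq u - nsq (M *m u).
Proof. by rewrite /hsq upc_chart dnc_chart. Qed.

Lemma contractive_hsq M (u : 'cV[C]_3) : contractive M -> u != 0 -> 0 < hsq S (chart M *m u).
Proof. by move=> cM u0; rewrite hsq_chart subr_gt0; exact: cM. Qed.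

Lemma nsq_convex n (u v : 'cV[C]_n) (s : R) : 0 <= s <= 1 ->
  nsq ((1 - s)%:C *: u + s%:C *: v) <= (1 - s) * nsq u + s * nsq v.
Proof.
move=> /andP[s0 s1]; rewrite /nsq !mulr_sumr -big_split /=; apply: ler_sum => k _.
rewrite !mxE; case: (u k 0) (v k 0) => [a b] [c d] /=.
rewrite !mul0r !subr0 !addr0.
have s10 : 0 <= s * (1 - s) by rewrite mulr_ge0 // subr_ge0.
have := mulr_ge0 s10 (sqr_ge0 (a - c)); have := mulr_ge0 s10 (sqr_ge0 (b - d)).
nra.
Qed.

Lemma contractive_convex A B (s : R) : contractive A -> contractive B -> 0 <= s <= 1 ->
  contractive ((1 - s)%:C *: A + s%:C *: B).
Proof.
move=> cA cB s01 u u0; rewrite mulmxDl -!scalemxAl.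
apply: le_lt_trans (nsq_convex _ _ s01) _.
have := cA u u0; have := cB u u0; move/andP: s01 => [s0 s1].
set a := nsq (A *m u); set b := nsq (B *m u); set c := nsq u => hb ha.
(* One of the weights [1 - s] and [s] is at least one half, which keeps the inequality strict. *)
have [s12|s12] := leP s 2^-1; nra.
Qed.

Lemma contractive0 : contractive 0.
Proof.
move=> u u0; rewrite mul0mx; suff -> : nsq (0 : 'cV[C]_19) = 0 by exact: nsq_gt0.
by apply: big1 => k _; rewrite mxE /= !expr0n /= addr0.
Qed.

Lemma cvg_chart (T : Type) (F : set_system T) (FF : Filter F) (f : T -> 'M[C]_(19, 3)) M :
  f @ F --> M -> (fun t => chart (f t)) @ F --> chart M.
Proof.
by move=> fM; apply: cvg_addmx; [exact: cvg_cst|apply: cvg_mulmx; [exact: cvg_cst|exact: fM]].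
Qed.

End chart.

Section columns.
Variables (K : comNzRingType) (n : nat).

Definition col3 (a b c : 'cV[K]_n) : 'M[K]_(n, 3) :=
  \matrix_(i, j) (if j == 0 then a i 0 else if j == 1 then b i 0 else c i 0).

Definition vec3 (a b c : K) : 'cV[K]_3 :=
  \col_k (if k == 0 then a else if k == 1 then b else c).

Lemma vec3E a b c : [/\ vec3 a b c 0 0 = a, vec3 a b c 1 0 = b & vec3 a b c 2 0 = c].
Proof. by split; rewrite mxE. Qed.

Lemma mulmx_col3 (a b c : 'cV[K]_n) (v : 'cV[K]_3) :
  col3 a b c *m v = v 0 0 *: a + v 1 0 *: b + v 2 0 *: c.
Proof.
apply/matrixP => i j; rewrite (ord1 j) !mxE !big_ord_recl big_ord0 !mxE /=.
rewrite addr0 addrA mulrC (mulrC (b i 0)) (mulrC (c i 0)).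
by congr (v _ _ * _ + v _ _ * _ + v _ _ * _); apply: val_inj.
Qed.

Lemma ord3_cases (i : 'I_3) : [\/ i = 0, i = 1 | i = 2].
Proof.
by case: i => [[|[|[|m]]] Hi] //; [constructor 1|constructor 2|constructor 3]; apply: val_inj.
Qed.

Lemma col_col3 (a b c : 'cV[K]_n) :
  [/\ col 0 (col3 a b c) = a, col 1 (col3 a b c) = b & col 2 (col3 a b c) = c].
Proof. by split; apply/matrixP => i j; rewrite (ord1 j) !mxE. Qed.

Lemma col3_cols (E : 'M[K]_(n, 3)) : col3 (col 0 E) (col 1 E) (col 2 E) = E.
Proof. by apply/matrixP => i j; rewrite !mxE; case: (ord3_cases j) => ->. Qed.

Lemma mulmx_vec3 (E : 'M[K]_(n, 3)) a b c :
  E *m vec3 a b c = a *: col 0 E + b *: col 1 E + c *: col 2 E.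
Proof. by rewrite -[in LHS](col3_cols E) mulmx_col3 !mxE. Qed.

Lemma col_mulmx p (E : 'M[K]_(n, p)) m (A : 'M[K]_(p, m)) j : col j (E *m A) = E *m col j A.
Proof. by apply/matrixP => i k; rewrite !mxE; apply: eq_bigr => l _; rewrite mxE. Qed.

Lemma vec3_eta (v : 'cV[K]_3) : v = vec3 (v 0 0) (v 1 0) (v 2 0).
Proof. by apply/matrixP => i j; rewrite (ord1 j) !mxE; case: (ord3_cases i) => ->. Qed.

Lemma vec3B a b c a' b' c' : vec3 a b c - vec3 a' b' c' = vec3 (a - a') (b - b') (c - c').
Proof. by apply/matrixP => i j; rewrite !mxE; case: (ord3_cases i) => ->. Qed.

Lemma vec3_neq0 a b c : [|| a == 1, b == 1 | c == 1] -> vec3 a b c != 0.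
Proof.
move=> H; apply/eqP => /matrixP z; have := z 0 0; have := z 1 0; have := z 2 0.
by rewrite !mxE /= => c0 b0 a0; move: H; rewrite a0 b0 c0 !(eq_sym 0) oner_eq0.
Qed.

End columns.

Lemma map_vec3 (K L : comNzRingType) (f : K -> L) a b c :
  map_mx f (vec3 a b c) = vec3 (f a) (f b) (f c).
Proof. by apply/matrixP => i j; rewrite !mxE; case: (ord3_cases i) => ->. Qed.

Lemma cvg_col3 (K : numFieldType) n (T : Type) (F : set_system T) (FF : Filter F)
    (f g h : T -> 'cV[K]_n) (a b c : 'cV[K]_n) :
  f @ F --> a -> g @ F --> b -> h @ F --> c ->
  (fun t => col3 (f t) (g t) (h t)) @ F --> col3 a b c.
Proof.
move=> fa gb hc; apply: cvg_mx => i j; rewrite mxE; under eq_fun do rewrite mxE.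
by case: (ord3_cases j) => -> /=; exact: cvg_entry.
Qed.

(** * Gram-Schmidt orthonormalization for a complex bilinear form *)

Section gram_schmidt.
Variables (K : fieldType) (G : 'M[int]_22) (sq : K -> K).
Local Notation V := 'cV[K]_22.
Local Notation B := (bform G).

(** Gram-Schmidt is run with the bilinear form and not with the Hermitian one, because the points of
    the conic are isotropic for the former. The function [sq] is any candidate for a square root;
    [good] below says that a pivot is nonzero and that [sq] is correct on its square. Primed vectors
    are not yet normalized. *)
Definition nrm (x : V) : V := (sq (B x x))^-1 *: x.
Definition gs1 (E : 'M[K]_(22, 3)) : V := nrm (col 0 E).
Definition gs2' (E : 'M[K]_(22, 3)) : V := col 1 E - B (col 1 E) (gs1 E) *: gs1 E.
Definition gs2 (E : 'M[K]_(22, 3)) : V := nrm (gs2' E).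
Definition gs3' (E : 'M[K]_(22, 3)) : V :=
  (col 2 E - B (col 2 E) (gs1 E) *: gs1 E) - B (col 2 E) (gs2 E) *: gs2 E.
Definition gs3 (E : 'M[K]_(22, 3)) : V := nrm (gs3' E).
Definition gs (E : 'M[K]_(22, 3)) : 'M[K]_(22, 3) := col3 (gs1 E) (gs2 E) (gs3 E).

Definition good (x : V) : Prop := B x x != 0 /\ sq (B x x) ^+ 2 = B x x.

Hypothesis GT : G^T = G.

Lemma good_sq x : good x -> sq (B x x) != 0.
Proof. by move=> [x0 xx]; rewrite -sqrf_eq0 xx. Qed.

Lemma nrm_nrm x : good x -> B (nrm x) (nrm x) = 1.
Proof.
move=> [x0 xx]; rewrite /nrm bformZl bformZr mulrA -invfM -expr2 xx.
exact: mulVf.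
Qed.

Lemma nrm_perp x y : B x y = 0 -> B (nrm x) y = 0.
Proof. by move=> xy; rewrite /nrm bformZl xy mulr0. Qed.

Lemma perp_nrm x y : good x -> B y (nrm x) = 0 -> B y x = 0.
Proof.
move=> gx; rewrite /nrm bformZr => /eqP.
by rewrite mulf_eq0 invr_eq0 (negPf (good_sq gx)) => /eqP.
Qed.

Variable E : 'M[K]_(22, 3).

Lemma gs2'_perp : good (col 0 E) -> B (gs2' E) (gs1 E) = 0.
Proof. by move=> /nrm_nrm e; rewrite /gs2' bformBl bformZl e mulr1 subrr. Qed.

(** The coefficient 1 shows in [pivot2] that the pivot vector comes from a nonzero vector of
    coordinates, and the zero leaves only the first column in the difference between that vector and
    its conjugate. *)
Lemma gs2'_span : exists a, gs2' E = E *m vec3 a 1 0.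
Proof.
exists (- (B (col 1 E) (gs1 E) * (sq (B (col 0 E) (col 0 E)))^-1)).
by rewrite mulmx_vec3 scale0r addr0 scale1r scaleNr -scalerA addrC.
Qed.

Lemma gs2'_perp0 : good (col 0 E) -> B (gs2' E) (col 0 E) = 0.
Proof. by move=> g0; apply: perp_nrm => //; exact: gs2'_perp. Qed.

Lemma gs3'_perp : good (col 0 E) -> good (gs2' E) ->
  B (gs3' E) (gs1 E) = 0 /\ B (gs3' E) (gs2 E) = 0.
Proof.
move=> g0 g1; have e11 := nrm_nrm g0; have e22 := nrm_nrm g1.
have e21 : B (gs2 E) (gs1 E) = 0 by apply: nrm_perp; exact: gs2'_perp.
have e12 : B (gs1 E) (gs2 E) = 0 by rewrite (bformC _ _ GT) e21.
rewrite -/(gs1 E) in e11; rewrite -/(gs2 E) in e22; split.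
  by rewrite /gs3' bformBl bformZl e21 mulr0 subr0 bformBl bformZl e11 mulr1 subrr.
by rewrite /gs3' bformBl bformZl e22 mulr1 bformBl bformZl e12 mulr0 subr0 subrr.
Qed.

Lemma gs3'_span : exists a b, gs3' E = E *m vec3 a b 1.
Proof.
have [a g2] := gs2'_span.
set s1 := (sq (B (col 0 E) (col 0 E)))^-1; set s2 := (sq (B (gs2' E) (gs2' E)))^-1.
set c1 := B (col 2 E) (gs1 E); set c2 := B (col 2 E) (gs2 E).
exists (- (c1 * s1) - c2 * s2 * a), (- (c2 * s2)).
have -> : gs3' E = col 2 E - c1 *: (s1 *: col 0 E) - c2 *: (s2 *: gs2' E) by [].
rewrite g2 !mulmx_vec3; apply/matrixP => i j; rewrite !mxE; ring.
Qed.

Lemma gs3'_perp01 : good (col 0 E) -> good (gs2' E) ->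
  B (gs3' E) (col 0 E) = 0 /\ B (gs3' E) (col 1 E) = 0.
Proof.
move=> g0 g1; have [e1 e2] := gs3'_perp g0 g1.
have f0 : B (gs3' E) (col 0 E) = 0 by exact: perp_nrm.
split=> //; have := perp_nrm g1 e2; have [a ->] := gs2'_span.
by rewrite mulmx_vec3 scale0r addr0 scale1r bformDr bformZr f0 mulr0 add0r.
Qed.

Hypotheses (g0 : good (col 0 E)) (g1 : good (gs2' E)) (g2 : good (gs3' E)).

Lemma gs_orthonormal : (gs E)^T *m ext K G *m gs E = 1%:M.
Proof.
have e11 := nrm_nrm g0; rewrite -/(gs1 E) in e11.
have e22 := nrm_nrm g1; rewrite -/(gs2 E) in e22.
have e33 := nrm_nrm g2; rewrite -/(gs3 E) in e33.
have e21 : B (gs2 E) (gs1 E) = 0 by apply: nrm_perp; exact: gs2'_perp.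
have [e31' e32'] := gs3'_perp g0 g1.
have e31 : B (gs3 E) (gs1 E) = 0 by apply: nrm_perp.
have e32 : B (gs3 E) (gs2 E) = 0 by apply: nrm_perp.
have e12 : B (gs1 E) (gs2 E) = 0 by rewrite (bformC _ _ GT).
have e13 : B (gs1 E) (gs3 E) = 0 by rewrite (bformC _ _ GT).
have e23 : B (gs2 E) (gs3 E) = 0 by rewrite (bformC _ _ GT).
apply/matrixP => i j; rewrite mxE_bform mxE /gs.
have [c0 c1 c2] := col_col3 (gs1 E) (gs2 E) (gs3 E).
by case: (ord3_cases i) => ->; case: (ord3_cases j) => ->; rewrite ?c0 ?c1 ?c2.
Qed.

Lemma gs_span : exists2 A, A \in unitmx & gs E = E *m A.
Proof.
have [a e2] := gs2'_span; have [b [c e3]] := gs3'_span.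
set s1 := (sq (B (col 0 E) (col 0 E)))^-1; set s2 := (sq (B (gs2' E) (gs2' E)))^-1.
set s3 := (sq (B (gs3' E) (gs3' E)))^-1.
pose A := col3 (s1 *: vec3 1 0 0) (s2 *: vec3 a 1 0) (s3 *: vec3 b c 1).
have FA : gs E = E *m A.
  rewrite -[RHS]col3_cols !col_mulmx.
  have [-> -> ->] := col_col3 (s1 *: vec3 1 0 0) (s2 *: vec3 a 1 0) (s3 *: vec3 b c 1).
  rewrite -!scalemxAr -e2 -e3 /gs; congr (col3 (_ *: _) _ _).
  by rewrite mulmx_vec3 scale1r !scale0r !addr0.
(* Orthonormality exhibits the identity as a product with left factor [A^T], so [A] is
   invertible. *)
exists A => //; have := gs_orthonormal; rewrite FA trmx_mul -!mulmxA => /mulmx1_unit[].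
by rewrite unitmx_tr.
Qed.

End gram_schmidt.

Section chart_frame.
Variables (R : realType) (G : 'M[int]_22) (S : splitting R G).
Local Notation C := R[i].
Local Notation B := (bform G).

(** A basis of the three-space that is orthonormal for the complex bilinear form and continuous in
    [M] over all contractions. Through it the conics of all members of [Gplus] become the image of a
    single standard conic. *)
Definition frame (M : 'M[C]_(19, 3)) : 'M[C]_(22, 3) := gs G (@csq R) (chart S M).

Variable M : 'M[C]_(19, 3).
Hypothesis cM : contractive M.
Let E := chart S M.
Let GT := gram_sym S.

(* A pivot vector is [E u] with one coordinate of [u] equal to 1, and it is
   orthogonal to the earlier columns, hence to [E (conj u - u)]; so its square
   is [B (E u) (E (conj u))], whose real part is positive. *)
Lemma Re_pivot (u : 'cV[C]_3) : u != 0 ->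
  B (E *m u) (E *m (map_mx (@conjc R) u - u)) = 0 -> 0 < Re (B (E *m u) (E *m u)).
Proof.
move=> u0; rewrite mulmxBr bformBr => /eqP; rewrite subr_eq0 => /eqP <-.
have cu0 : map_mx (@conjc R) u != 0.
  apply: contra u0 => /eqP cu; apply/eqP/matrixP => i j; move/matrixP/(_ i j): cu.
  by rewrite !mxE; case: (u i j) => a b /= [-> /eqP]; rewrite oppr_eq0 => /eqP->.
have h : upc S (E *m map_mx (@conjc R) u) = map_mx (@conjc R) (upc S (E *m u)).
  by rewrite !upc_chart.
have h1 := contractive_hsq S cM u0; have h2 := contractive_hsq S cM cu0.
have h3 := Re_bform_ge h; rewrite -/E in h1 h2.
move: h1 h2 h3; set p := hsq S _; set q := hsq S _; set r := Re _; lra.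
Qed.

Lemma good_Re x : 0 < Re (B x x) -> good G (@csq R) x.
Proof.
move=> x0; split; last exact: sqr_csq.
by apply: contraTneq x0 => ->; rewrite /= ltxx.
Qed.

Lemma pivot1 : 0 < Re (B (col 0 E) (col 0 E)).
Proof.
have -> : col 0 E = E *m vec3 1 0 0 by rewrite mulmx_vec3 scale1r !scale0r !addr0.
apply: Re_pivot; first by rewrite vec3_neq0 ?eqxx.
by rewrite map_vec3 conjc1 conjc0 subrr mulmx0 bform0r.
Qed.

Lemma pivot2 : 0 < Re (B (gs2' G (@csq R) E) (gs2' G (@csq R) E)).
Proof.
have [a g2] := gs2'_span G (@csq R) E; have p := gs2'_perp0 (good_Re pivot1).
rewrite g2 in p *; apply: Re_pivot; first by rewrite vec3_neq0 ?eqxx ?orbT.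
rewrite map_vec3 conjc1 conjc0 vec3B !subrr (mulmx_vec3 _ (_ - a)) !scale0r !addr0.
by rewrite bformZr p mulr0.
Qed.

Lemma pivot3 : 0 < Re (B (gs3' G (@csq R) E) (gs3' G (@csq R) E)).
Proof.
have [a [b g3]] := gs3'_span G (@csq R) E.
have [p q] := gs3'_perp01 GT (good_Re pivot1) (good_Re pivot2).
rewrite g3 in p q *; apply: Re_pivot; first by rewrite vec3_neq0 ?eqxx ?orbT.
rewrite map_vec3 conjc1 vec3B subrr (mulmx_vec3 _ (_ - a)) scale0r addr0.
by rewrite bformDr !bformZr p q !mulr0 addr0.
Qed.

Lemma frame_orthonormal : (frame M)^T *m ext C G *m frame M = 1%:M.
Proof. exact: (gs_orthonormal GT (good_Re pivot1) (good_Re pivot2) (good_Re pivot3)). Qed.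

Lemma frame_chart : exists2 A, A \in unitmx & frame M = chart S M *m A.
Proof. exact: (gs_span GT (good_Re pivot1) (good_Re pivot2) (good_Re pivot3)). Qed.

(** At a contraction all three pivots have positive real part; there [csq] is continuous and its
    value can be inverted. *)
Lemma cvg_frame (T : Type) (F : set_system T) (FF : Filter F) (f : T -> 'M[C]_(19, 3)) :
  f @ F --> M -> (fun t => frame (f t)) @ F --> frame M.
Proof.
move=> fM; pose proof (@cvg_chart _ _ S _ _ FF _ _ fM) as cE.
have cnrm (g : T -> 'cV[C]_22) (x : 'cV[C]_22) : 0 < Re (B x x) -> g @ F --> x ->
      (fun t => nrm G (@csq R) (g t)) @ F --> nrm G (@csq R) x.
  move=> x0 gx; apply: cvg_scalemx; last exact: gx.
  by apply: cvg_invf; [exact: csq_neq0|apply: cvg_csq; [exact: x0|apply: cvg_bform; exact: gx]].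
have ccol (j : 'I_3) : (fun t => col j (chart S (f t))) @ F --> col j E.
  by apply: cvg_mx => i k; rewrite mxE; under eq_fun do rewrite mxE; exact: cvg_entry.
have c1 : (fun t => gs1 G (@csq R) (chart S (f t))) @ F --> gs1 G (@csq R) E by apply: cnrm; [exact: pivot1|exact: ccol].
have csub (g h : T -> 'cV[C]_22) (x y : 'cV[C]_22) : g @ F --> x -> h @ F --> y ->
    (fun t => g t - B (g t) (h t) *: h t) @ F --> x - B x y *: y.
  move=> gx hy; apply: cvg_addmx; first exact: gx.
  by apply: cvg_oppmx; apply: cvg_scalemx; [apply: cvg_bform; [exact: gx|exact: hy]|exact: hy].
have c2 : (fun t => gs2 G (@csq R) (chart S (f t))) @ F --> gs2 G (@csq R) E.
  by apply: cnrm; [exact: pivot2|apply: csub; [exact: ccol|exact: c1]].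
have c3 : (fun t => gs3 G (@csq R) (chart S (f t))) @ F --> gs3 G (@csq R) E.
  apply: cnrm; first exact: pivot3.
  apply: cvg_addmx; first by apply: csub; [exact: ccol|exact: c1].
  apply: cvg_oppmx; apply: cvg_scalemx; last exact: c2.
  by apply: cvg_bform; [exact: ccol|exact: c2].
by apply: cvg_col3; [exact: c1|exact: c2|exact: c3].
Qed.

End chart_frame.

Section column_space.
Variable K : fieldType.
Local Notation V := 'cV[K]_22.

Definition gspace (F : 'M[K]_(22, 3)) : {vspace V} := limg (linfun (mulmx F)).

Lemma memv_gspaceP (F : 'M[K]_(22, 3)) v : reflect (exists u : 'cV[K]_3, v = F *m u) (v \in gspace F).
Proof.
apply: (iffP memv_imgP) => [[u _ ->]|[u ->]]; first by exists u; rewrite lfunE.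
by exists u; rewrite ?memvf // lfunE.
Qed.

Lemma memv_gspace (F : 'M[K]_(22, 3)) (u : 'cV[K]_3) : F *m u \in gspace F.
Proof. by apply/memv_gspaceP; exists u. Qed.

Lemma dim_gspace (F : 'M[K]_(22, 3)) : (forall u : 'cV[K]_3, F *m u = 0 -> u = 0) -> \dim (gspace F) = 3%N.
Proof.
move=> F0; rewrite /gspace limg_dim_eq; first by rewrite dimvf /dim /= muln1.
apply/eqP; rewrite -subv0; apply/subvP => u; rewrite memv_cap memv_ker lfunE /= => /andP[_ /eqP/F0->].
exact: mem0v.
Qed.

Lemma gspace_mulmx (F : 'M[K]_(22, 3)) (A : 'M[K]_3) : A \in unitmx -> gspace (F *m A) = gspace F.
Proof.
move=> uA; apply/vspaceP => v; apply/memv_gspaceP/memv_gspaceP => -[u ->].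
  by exists (A *m u); rewrite mulmxA.
by exists (invmx A *m u); rewrite mulmxA mulmxK.
Qed.

Lemma gspace_of_dim (W : {vspace V}) : \dim W = 3%N ->
  exists2 F, W = gspace F & forall u : 'cV[K]_3, F *m u = 0 -> u = 0.
Proof.
move=> dW; pose b := vbasis W.
have sz : size b = 3%N by rewrite size_tuple dW.
pose F := col3 b`_0 b`_1 b`_2 : 'M[K]_(22, 3).
have bE : (b : seq V) = [:: b`_0; b`_1; b`_2].
  by case: (b : seq V) sz => [|b0 [|b1 [|b2 [|? ?]]]].
have WF : W = gspace F.
  apply/vspaceP => v; rewrite -{1}(span_basis (vbasisP W)) -/b bE.
  rewrite span_cons span_cons span_seq1.
  apply/memv_addP/memv_gspaceP => [[x /vlineP[k0 ->] [y /memv_addP[z /vlineP[k1 ->] [w /vlineP[k2 ->] ->]] ->]]|[u ->]].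
    by exists (vec3 k0 k1 k2); rewrite /F mulmx_col3 !mxE addrA.
  rewrite /F mulmx_col3 -addrA; exists (u 0 0 *: b`_0); first exact: memvZ (memv_line _).
  exists (u 1 0 *: b`_1 + u 2 0 *: b`_2) => //; apply: memv_add; exact: memvZ (memv_line _).
exists F => // u Fu; have fb := basis_free (vbasisP W); rewrite -/b bE in fb.
have /freeP fr : free (in_tuple [:: b`_0; b`_1; b`_2]) by [].
have := fr (fun i => u i 0); rewrite !big_ord_recl big_ord0 /= addr0 => H.
have {}H : forall i : 'I_3, u i 0 = 0.
  apply: H; rewrite -[RHS]Fu /F mulmx_col3 addrA.
  by congr (u _ _ *: _ + u _ _ *: _ + u _ _ *: _); apply: val_inj.
by apply/matrixP => i j; rewrite (ord1 j) H mxE.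
Qed.

Lemma sub_gspace_mulmx (F F' : 'M[K]_(22, 3)) : (gspace F' <= gspace F)%VS -> exists A, F' = F *m A.
Proof.
move=> /subvP H; have h j : exists u : 'cV[K]_3, col j F' = F *m u.
  apply/memv_gspaceP/H; rewrite colE; exact: memv_gspace.
exists (\matrix_(i, j) (xget 0 [set u | col j F' = F *m u]) i 0).
apply/matrixP => i j; have e := xgetPex 0 (h j); move/matrixP/(_ i 0): e.
by rewrite !mxE => ->; apply: eq_bigr => k _; rewrite !mxE.
Qed.

End column_space.

Section positive_spaces.
Variables (R : realType) (G : 'M[int]_22) (S : splitting R G).
Local Notation C := R[i].
Local Notation rc := (map_mx (real_complex R)).

Lemma hsq_up0 x : upc S x = 0 -> 0 < hsq S x -> False.
Proof.
move=> u0; rewrite /hsq u0; have -> : nsq (0 : 'cV[C]_3) = 0.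
  by apply: big1 => k _; rewrite mxE /= expr0n /= addr0.
by rewrite sub0r oppr_gt0 ltNge nsq_ge0.
Qed.

Lemma chart_Gplus M : contractive M -> Gplus G (gspace (chart S M)).
Proof.
move=> cM; split=> [|v /memv_gspaceP[u ->] v0].
  by apply: dim_gspace => u Eu; have := upc_chart S M u; rewrite Eu /upc mulmx0.
rewrite (herm_gt0 S); apply: contractive_hsq => //.
by apply: contraNneq v0 => ->; rewrite mulmx0.
Qed.

Lemma Gplus_contractive M : Gplus G (gspace (chart S M)) -> contractive M.
Proof.
move=> [_ H] u u0; have Eu0 : chart S M *m u != 0.
  by apply: contra u0 => /eqP Eu; have := upc_chart S M u; rewrite Eu /upc mulmx0 => <-.
by have := H _ (memv_gspace _ u) Eu0; rewrite (herm_gt0 S) hsq_chart subr_gt0.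
Qed.

Definition upm (F : 'M[C]_(22, 3)) : 'M[C]_3 := rc (up S) *m F.
(** Changing the basis [F] so that its positive coordinates become the identity leaves a matrix of
    the form [chart S M]; this is its [M]. It inverts [chart] on column spaces and is visibly
    continuous in [F]. *)
Definition chart_of (F : 'M[C]_(22, 3)) : 'M[C]_(19, 3) := (rc (dn S) *m F) *m invmx (upm F).

Lemma chart_of_factor F : upm F \in unitmx -> chart S (chart_of F) *m upm F = F.
Proof.
move=> uF; rewrite /chart mulmxDl /chart_of -!mulmxA mulVmx // mulmx1 /upm.
by rewrite !mulmxA -mulmxDl -!map_mxM -map_mxD updnK map_mx1 mul1mx.
Qed.

Lemma gspace_chart_of F : upm F \in unitmx -> gspace (chart S (chart_of F)) = gspace F.
Proof. by move=> uF; rewrite -[in RHS](chart_of_factor uF) gspace_mulmx. Qed.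

(** A nonzero vector of [W] without positive coordinates would have a nonpositive Hermitian square,
    so the positive coordinates of a basis of [W] form an invertible matrix. *)
Lemma Gplus_chart W : Gplus G W -> exists2 M, contractive M & W = gspace (chart S M).
Proof.
move=> /[dup] gW [dW pW]; have [F WF F0] := gspace_of_dim dW.
have uF : upm F \in unitmx.
  apply: unitmx_kernel => v; rewrite /upm -mulmxA => Fv; apply: F0; apply/eqP.
  apply/negP => /negP Fv0; have := pW (F *m v); rewrite WF memv_gspace => /(_ isT Fv0).
  by rewrite (herm_gt0 S); exact: hsq_up0.
exists (chart_of F); last by rewrite gspace_chart_of.
by apply: Gplus_contractive; rewrite gspace_chart_of // -WF.
Qed.

Lemma chart_of_gspace F M : gspace F = gspace (chart S M) ->
  (forall u : 'cV[C]_3, F *m u = 0 -> u = 0) -> upm F \in unitmx /\ chart_of F = M.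
Proof.
move=> FM F0; have [A FA] : exists A, F = chart S M *m A.
  by apply: sub_gspace_mulmx; rewrite FM subvv.
have uA : A \in unitmx.
  by apply: unitmx_kernel => v Av; apply: F0; rewrite FA -mulmxA Av mulmx0.
have upA : upm F = A.
  by rewrite /upm FA /chart mulmxA mulmxDr mulmxA -!map_mxM upK up_idn map_mx1 map_mx0 mul0mx addr0 mul1mx.
split; first by rewrite upA.
rewrite /chart_of upA FA /chart mulmxA mulmxDr mulmxA -!map_mxM dn_iup dnK map_mx1 map_mx0.
by rewrite add0r mul1mx mulmxK.
Qed.

Lemma gspace_chart_inj M N : gspace (chart S M) = gspace (chart S N) -> M = N.
Proof.
move=> MN; have [] := @chart_of_gspace (chart S M) N MN.
  by move=> u Eu; have := upc_chart S M u; rewrite Eu /upc mulmx0.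
move=> _ <-; symmetry; apply: (chart_of_gspace _ _).2 => // u Eu.
by have := upc_chart S M u; rewrite Eu /upc mulmx0.
Qed.

Lemma gspace_frame M : contractive M -> gspace (frame S M) = gspace (chart S M).
Proof. by move=> cM; have [A uA ->] := frame_chart S cM; exact: gspace_mulmx. Qed.

End positive_spaces.

Lemma nbhs_neq0 (K : numFieldType) (T : Type) (F : set_system T) (FF : Filter F) (f : T -> K) a :
  a != 0 -> f @ F --> a -> F (fun t => f t != 0).
Proof. by move=> a0 fa; exact: (@cvgr_neq0 K K^o T F FF f a fa a0). Qed.

Section inverse_limit.
Variables (K : numFieldType) (T : Type) (F : set_system T) (FF : Filter F).

Lemma cvg_invmx n (f : T -> 'M[K]_n) (a : 'M[K]_n) : a \in unitmx ->
  f @ F --> a -> (fun t => invmx (f t)) @ F --> invmx a.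
Proof.
move=> ua fa.
have fu : \forall t \near F, f t \in unitmx.
  have da : \det a != 0 by rewrite unitmxE unitfE in ua.
  have := nbhs_neq0 FF da (cvg_det FF fa).
  by apply: (@filterS _ F FF) => t; rewrite unitmxE unitfE.
have E : {near F, (fun t => (\det (f t))^-1 *: \adj (f t)) =1 (fun t => invmx (f t))}.
  by apply: (@filterS _ F FF _ _ _ fu) => t ut; rewrite /invmx ut.
have -> : invmx a = (\det a)^-1 *: \adj a by rewrite /invmx ua.
apply: cvg_trans; first exact: near_eq_cvg E.
apply: cvg_scalemx.
  by apply: cvg_invf; [rewrite unitmxE unitfE in ua|exact: cvg_det].
apply: cvg_mx => i j; rewrite mxE; under eq_fun do rewrite mxE.
apply: cvg_mulf; first exact: cvg_cst.
apply: cvg_det; apply: cvg_mx => k l; rewrite !mxE; under eq_fun do rewrite !mxE.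
exact: cvg_entry.
Qed.

End inverse_limit.

Section chart_of_limit.
Variables (R : realType) (G : 'M[int]_22) (S : splitting R G).
Local Notation C := R[i].
Variables (T : Type) (F : set_system T) (FF : Filter F).

Lemma cvg_upm (f : T -> 'M[C]_(22, 3)) a : f @ F --> a -> (fun t => upm S (f t)) @ F --> upm S a.
Proof. by move=> fa; apply: cvg_mulmx; [exact: cvg_cst|exact: fa]. Qed.

Lemma cvg_chart_of (f : T -> 'M[C]_(22, 3)) a : upm S a \in unitmx ->
  f @ F --> a -> (fun t => chart_of S (f t)) @ F --> chart_of S a.
Proof.
move=> ua fa; apply: cvg_mulmx; first by apply: cvg_mulmx; [exact: cvg_cst|exact: fa].
by apply: cvg_invmx; [exact: ua|exact: cvg_upm].
Qed.

Lemma near_unit_upm (f : T -> 'M[C]_(22, 3)) a : upm S a \in unitmx ->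
  f @ F --> a -> F (fun t => upm S (f t) \in unitmx).
Proof.
move=> ua fa; have H := cvg_det FF (cvg_upm fa).
have da : \det (upm S a) != 0 by rewrite -unitfE -unitmxE.
apply: (@filterS _ F FF _ _ _ (nbhs_neq0 FF da H)) => t.
by rewrite unitmxE unitfE.
Qed.

End chart_of_limit.

(** * The spaces of lines and of conics *)

Section final_topology_theory.
Variables (S : topologicalType) (X : choiceType) (D : set S) (f : S -> X).
Local Notation fD := (fun x : subspace D => f x).
Local Notation XD := (final_topology fD).

(** The points outside [D] are isolated in [subspace D], so a limit in [S] passes to the quotient
    only along a filter that eventually stays in [D]. *)
Lemma cvg_final (T : Type) (F : set_system T) (FF : Filter F) (g : T -> S) (x : S) :
  D x -> g @ F --> x -> F (fun t => D (g t)) ->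
  (fun t => f (g t) : XD) @ F --> (f x : XD).
Proof.
move=> Dx gx gD A; rewrite nbhsE => -[N [oN Nx] NA]; apply: (@filterS _ _ _ _ _ NA); rewrite /fmap /=.
have := oN : open (fD @^-1` N); rewrite openE => /(_ x Nx).
move=> H; have : within D (nbhs x) (fD @^-1` N) by rewrite nbhs_subspace_in.
rewrite withinE => -[V Vx VE].
apply: (@filterS _ F FF _ _ _ (filterI gD (gx _ Vx))) => t [Dt Vt].
have : ([set y | (fD @^-1` N) y] `&` D) (g t) by rewrite VE.
by move=> [].
Qed.

(** The last condition is saturation: it makes [A] the full preimage of its image. *)
Lemma open_final_image (A : set S) : open A -> A `<=` D ->
  (forall x y, A x -> f x = f y -> A y) -> open ([set f x | x in A] : set XD).
Proof.
move=> oA AD Asat; change (open (fD @^-1` [set f x | x in A])).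
have -> : fD @^-1` [set f x | x in A] = A.
  apply/seteqP; split=> [x [y Ay yx]|x Ax]; last by exists x.
  exact: Asat Ay yx.
exact: open_subspaceW.
Qed.

End final_topology_theory.

Section lines.
Variable R : realType.
Local Notation C := R[i].
Local Notation V := 'cV[C]_22.

Lemma line_eqP (x y : V) : x != 0 -> <[x]>%VS = <[y]>%VS -> exists2 a : C, a != 0 & y = a *: x.
Proof.
move=> x0 xy; have /vlineP[a ya] : y \in <[x]>%VS by rewrite xy memv_line.
exists a => //; apply/eqP => a0; move: ya xy; rewrite a0 scale0r => -> /esym xy.
by have := memv_line x; rewrite -xy memv0 (negPf x0).
Qed.

Lemma line_scale (x : V) (a : C) : a != 0 -> <[a *: x]>%VS = <[x]>%VS.
Proof.
move=> a0; apply/vspaceP => v; apply/vlineP/vlineP => -[b ->].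
  by exists (b * a); rewrite scalerA.
by exists (b / a); rewrite scalerA mulfVK.
Qed.

Lemma cvg_line (T : Type) (F : set_system T) (FF : Filter F) (g : T -> V) (x : V) :
  x != 0 -> g @ F --> x -> (fun t => <[g t]>%VS : projsp R) @ F --> (<[x]>%VS : projsp R).
Proof.
move=> x0 gx.
have [i xi] : exists i, x i 0 != 0.
  apply: contrapT => H; move/eqP: x0; apply; apply/matrixP => i j; rewrite (ord1 j) mxE.
  by apply/eqP/negPn/negP => xi; apply: H; exists i.
apply: (@cvg_final _ _ [set x : V | x != 0] (fun x => <[x]>%VS)) => //.
have gi : (fun t => g t i 0) @ F --> x i 0 by exact: cvg_entry.
apply: (@filterS _ F FF _ _ _ (nbhs_neq0 FF xi gi)) => t /=.
by apply: contra => /eqP ->; rewrite mxE.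
Qed.

(** The projection onto lines is an open map: the nonzero vectors with some nonzero multiple in a
    given open set form an open saturated set. *)
Lemma near_line (x : V) (A : set V) : x != 0 -> nbhs x A ->
  nbhs (<[x]>%VS : projsp R) [set <[y]>%VS | y in [set y | A y /\ y != 0]].
Proof.
move=> x0; rewrite nbhsE => -[A' [oA' A'x] A'A].
pose A'' : set V := [set y | exists2 a : C, a != 0 & A' (a *: y)] `&` [set y | y != 0].
have oA'' : open A''.
  rewrite openE => y [[a a0 A'y] y0]; apply: filterI.
    have cv : (fun z : V => a *: z) @ (nbhs y) --> a *: y by apply: cvg_scalemx; [exact: cvg_cst|exact: cvg_id].
    have : nbhs y (fun z => A' (a *: z)) by apply: cv; apply: open_nbhs_nbhs; split.
    by apply: filterS => z A'z; exists a.
  have [i yi] : exists i, y i 0 != 0.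
    apply: contrapT => H; move/eqP: y0; apply; apply/matrixP => i j; rewrite (ord1 j) mxE.
    by apply/eqP/negPn/negP => yi; apply: H; exists i.
  have gi : (fun z : V => z i 0) @ (nbhs y) --> y i 0 by apply: cvg_entry; exact: cvg_id.
  by have := nbhs_neq0 (nbhs_filter y) yi gi; apply: filterS => z /=; apply: contra => /eqP ->; rewrite mxE.
rewrite nbhsE; exists [set <[y]>%VS | y in A'']; last first.
  move=> p [y [[a a0 A'y] y0] <-]; exists (a *: y); last exact: line_scale.
  by split; [exact: A'A|rewrite scaler_eq0 negb_or a0].
split; last by exists x => //; split=> //; exists 1; rewrite ?oner_eq0 // scale1r.
apply: (@open_final_image _ _ [set x : V | x != 0] (fun x => <[x]>%VS)) => // [y []//|y z [[a a0 A'y] y0] yz].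
have [b b0 zy] := line_eqP y0 yz; split; last by rewrite /= zy scaler_eq0 negb_or b0.
by exists (a / b); rewrite ?mulf_neq0 ?invr_eq0 // zy scalerA mulfVK.
Qed.

End lines.

Section standard_conic.
Variable K : comNzRingType.

(* The two affine charts of the Veronese conic. *)
Definition cvec (b : bool) (z : K) : 'cV[K]_3 :=
  if b then vec3 1 z (z ^+ 2) else vec3 (z ^+ 2) z 1.

Lemma cvec_neq0 b z : cvec b z != 0.
Proof. by case: b; rewrite vec3_neq0 // eqxx ?orbT. Qed.

Lemma mulmx_tr_vec3 (a b c a' b' c' : K) :
  ((vec3 a b c)^T *m vec3 a' b' c') 0 0 = a * a' + b * b' + c * c'.
Proof. by rewrite !mxE !big_ord_recl big_ord0 !mxE /= addr0 addrA. Qed.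

Lemma bform_orthonormal (G : 'M[int]_22) (F : 'M[K]_(22, 3)) (u v : 'cV[K]_3) :
  F^T *m ext K G *m F = 1%:M -> bform G (F *m u) (F *m v) = (u^T *m v) 0 0.
Proof.
move=> F1; rewrite /bform trmx_mul -!mulmxA (mulmxA (ext K G)) (mulmxA F^T) (mulmxA F^T).
by rewrite F1 mul1mx.
Qed.

Lemma vec3_scale (k a b c : K) : k *: vec3 a b c = vec3 (k * a) (k * b) (k * c).
Proof. by apply/matrixP => i j; rewrite !mxE; case: (ord3_cases i) => ->. Qed.

Lemma vec3D (a b c a' b' c' : K) : vec3 a b c + vec3 a' b' c' = vec3 (a + a') (b + b') (c + c').
Proof. by apply/matrixP => i j; rewrite !mxE; case: (ord3_cases i) => ->. Qed.

End standard_conic.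

(** The three points have coordinates [(1, 0, 0)], [(0, 0, 1)] and [(1, 1, 1)], and these span: the
    missing basis vector is the third minus the other two. *)
Lemma mulmx_cvec_mem (K : fieldType) (F : 'M[K]_(22, 3)) (W : {vspace 'cV[K]_22}) :
  F *m cvec true 0 \in W -> F *m cvec false 0 \in W -> F *m cvec true 1 \in W ->
  forall u, F *m u \in W.
Proof.
move=> h0 h2 h1 u; have {}h1 : F *m vec3 0 1 0 \in W.
  have -> : vec3 0 1 0 = cvec true 1 - cvec true 0 - cvec false 0 :> 'cV[K]_3.
    by rewrite /cvec !vec3B; congr vec3; ring.
  rewrite !mulmxBr; apply: memvB; last exact: h2.
  by apply: memvB; [exact: h1|exact: h0].
have -> : u = u 0 0 *: cvec true 0 + u 1 0 *: vec3 0 1 0 + u 2 0 *: cvec false 0.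
  by rewrite {1}(vec3_eta u) /cvec !vec3_scale !vec3D; congr vec3; ring.
rewrite !mulmxDr -!scalemxAr; apply: memvD; last by apply: memvZ; exact: h2.
by apply: memvD; apply: memvZ; [exact: h0|exact: h1].
Qed.

Lemma cvg_cvec (K : numFieldType) (T : Type) (F : set_system T) (FF : Filter F) b (g : T -> K) (z : K) :
  g @ F --> z -> (fun t => cvec b (g t)) @ F --> cvec b z.
Proof.
move=> gz; have gz2 : (fun t => g t ^+ 2) @ F --> z ^+ 2 by apply: cvg_mulf; exact: gz.
apply: cvg_mx => i j; case: b; rewrite /cvec mxE; under eq_fun do rewrite mxE;
  by case: (ord3_cases i) => -> /=; first [exact: cvg_cst|exact: gz|exact: gz2].
Qed.

Section isotropic_conic.
Variables (K : fieldType) (im : K).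
Hypotheses (im2 : im * im = -1) (two : (2 : K) != 0).

(** It encodes the identity [(s^2 - t^2)^2 + (2 s t)^2 = (s^2 + t^2)^2]: applied to
    [(s^2, s t, t^2)] it parametrizes the conic [x^2 + y^2 + z^2 = 0]. *)
Definition jmx : 'M[K]_3 := col3 (vec3 1 0 im) (vec3 0 2 0) (vec3 (-1) 0 im).

Lemma jmxE (a b c : K) : jmx *m vec3 a b c = vec3 (a - c) (2 * b) (im * (a + c)).
Proof.
have [e0 e1 e2] := vec3E a b c.
rewrite /jmx mulmx_col3 e0 e1 e2 !vec3_scale !vec3D; congr vec3; ring.
Qed.

Lemma im_neq0 : im != 0.
Proof. by apply/eqP => i0; move/eqP: im2; rewrite i0 mul0r eq_sym oppr_eq0 oner_eq0. Qed.

Lemma jmx_unit : jmx \in unitmx.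
Proof.
apply: unitmx_kernel => v; rewrite (vec3_eta v) jmxE.
set a := v 0 0; set b := v 1 0; set c := v 2 0 => /matrixP e.
have := e 0 0; have := e 1 0; have := e 2 0; rewrite !mxE /=.
move=> /eqP; rewrite mulf_eq0 (negPf im_neq0) /= => /eqP e2.
move=> /eqP; rewrite mulf_eq0 (negPf two) /= => /eqP b0 /eqP; rewrite subr_eq0 => /eqP ac.
move: e2; rewrite ac -mulr2n -mulr_natl => /eqP; rewrite mulf_eq0 (negPf two) /= => /eqP c0.
by apply/matrixP => i j; rewrite !mxE b0 c0; case: ifP => // _; case: ifP.
Qed.

Lemma jmx_isotropic b z : ((jmx *m cvec b z)^T *m (jmx *m cvec b z)) 0 0 = 0.
Proof.
case: b; rewrite /cvec jmxE mulmx_tr_vec3.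
  have -> : (1 - z ^+ 2) * (1 - z ^+ 2) + 2 * z * (2 * z) + im * (1 + z ^+ 2) * (im * (1 + z ^+ 2)) =
    (1 + im * im) * ((1 + z ^+ 2) ^+ 2) by ring.
  by rewrite im2 subrr mul0r.
have -> : (z ^+ 2 - 1) * (z ^+ 2 - 1) + 2 * z * (2 * z) + im * (z ^+ 2 + 1) * (im * (z ^+ 2 + 1)) =
  (1 + im * im) * ((1 + z ^+ 2) ^+ 2) by ring.
by rewrite im2 subrr mul0r.
Qed.

(** Stereographic projection. The equation reads [(a - im c) (a + im c) = - b^2], so [s = a - im c]
    and [t = b] give the point [2 (a - im c) x]. When [a = im c], the vector is a multiple of
    [(im, 0, 1)], which comes from [s = 0], [t = 1]. *)
Lemma isotropic_param (x : 'cV[K]_3) : x != 0 -> (x^T *m x) 0 0 = 0 ->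
  exists (s t k : K), [/\ (s != 0) || (t != 0), k != 0 &
    jmx *m vec3 (s ^+ 2) (s * t) (t ^+ 2) = k *: x].
Proof.
rewrite (vec3_eta x); set a := x 0 0; set b := x 1 0; set c := x 2 0.
rewrite mulmx_tr_vec3 => x0 xx.
have [e|e] := eqVneq (a - im * c) 0.
  have aE : a = im * c by apply/eqP; rewrite -subr_eq0 e.
  have b0 : b = 0.
    apply/eqP; rewrite -sqrf_eq0 expr2; apply/eqP; rewrite -[RHS]xx aE.
    have -> : im * c * (im * c) + b * b + c * c = (im * im + 1) * (c * c) + b * b by ring.
    by rewrite im2 addNr mul0r add0r.
  have c0 : c != 0.
    apply: contra x0 => /eqP c0; rewrite aE b0 c0 mulr0; apply/eqP/matrixP => i j.
    by rewrite !mxE; do 2?case: ifP.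
  exists 0, 1, (im / c); split; rewrite ?oner_eq0 ?orbT //.
    by rewrite mulf_neq0 ?im_neq0 ?invr_eq0.
  rewrite jmxE vec3_scale aE b0 !mulr0; congr vec3; rewrite ?expr1n ?expr0n /=.
  - by rewrite sub0r -im2 mulrA mulrAC divfK.
  - by rewrite mul0r mulr0.
  - by rewrite add0r mulr1 divfK.
exists (a - im * c), b, (2 * (a - im * c)); split; rewrite ?e ?mulf_neq0 //.
rewrite jmxE vec3_scale; have bb : b ^+ 2 = - (a * a + c * c).
  by apply/eqP; rewrite -addr_eq0 expr2 -xx; apply/eqP; ring.
rewrite bb; congr vec3.
- have -> : (a - im * c) ^+ 2 - - (a * a + c * c) = 2 * (a - im * c) * a + (im * im + 1) * (c * c) by ring.
  by rewrite im2 addNr mul0r addr0.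
- by ring.
- have -> : im * ((a - im * c) ^+ 2 - (a * a + c * c)) =
    2 * (a - im * c) * c + (im * im + 1) * (im * c * c - 2 * a * c) by ring.
  by rewrite im2 addNr mul0r addr0.
Qed.

End isotropic_conic.

Section conics.
Variable R : realType.
Local Notation C := R[i].

Lemma conic_colE (s t : C) :
  \col_(k < 3) (s ^+ (2 - k) * t ^+ k) = vec3 (s ^+ 2) (s * t) (t ^+ 2).
Proof.
apply/matrixP => i j; rewrite !mxE; case: (ord3_cases i) => -> /=.
- by rewrite expr0 mulr1.
- by rewrite !expr1.
- by rewrite expr0 mul1r.
Qed.

(** Dividing by the larger of [s] and [t] brings the parameter into the closed unit disc of one of
    the two affine charts. This presents a conic as the image of two compact discs, ready for the
    tube lemma. *)
Lemma conicP (F : 'M[C]_(22, 3)) (p : projsp R) :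
  conic F p <-> exists b z, normc z <= 1 /\ p = <[F *m cvec b z]>%VS.
Proof.
have sc (x y : 'cV[C]_3) (k : C) : k != 0 -> x = k *: y -> <[F *m x]>%VS = <[F *m y]>%VS.
  by move=> k0 ->; rewrite -scalemxAr line_scale.
split=> [[s [t [st ->]]]|[b [z [z1 ->]]]]; last first.
  case: b; [exists 1, z|exists z, 1]; rewrite ?oner_eq0 ?orbT conic_colE /cvec;
    by rewrite ?expr1n ?mul1r ?mulr1.
rewrite conic_colE.
have [ts|st'] := leP (normc t) (normc s).
  have s0 : s != 0.
    apply: contraTneq st => s0; move: ts; rewrite s0 normc0 eqxx /= => ts.
    have /eq0_normc -> : normc t = 0 by apply/eqP; rewrite eq_le ts normc_ge0.
    by rewrite eqxx.
  have ns : 0 < normc s.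
    by rewrite lt_neqAle normc_ge0 andbT eq_sym; apply: contra s0 => /eqP/eq0_normc ->.
  exists true, (t / s); split; first by rewrite normcM normcV ler_pdivrMr ?mul1r.
  apply: (sc _ _ (s ^+ 2)); first by rewrite expf_neq0.
  by rewrite /cvec vec3_scale; congr vec3; field.
have t0 : t != 0.
  by apply: contraTneq st' => ->; rewrite normc0 -leNgt normc_ge0.
have nt : 0 < normc t := le_lt_trans (normc_ge0 _) st'.
exists false, (s / t); split; first by rewrite normcM normcV ler_pdivrMr // mul1r ltW.
apply: (sc _ _ (t ^+ 2)); first by rewrite expf_neq0.
by rewrite /cvec vec3_scale; congr vec3; field.
Qed.

Lemma rank3_injective (F : 'M[C]_(22, 3)) :
  \rank F = 3%N <-> (forall u : 'cV[C]_3, F *m u = 0 -> u = 0).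
Proof.
rewrite -mxrank_tr; split=> [rF u Fu|H].
  have rf : row_free F^T by rewrite /row_free rF.
  by apply: trmx_inj; apply: (row_free_inj rf); rewrite -trmx_mul Fu !trmx0 mul0mx.
apply/eqP; rewrite -/(row_free _) -kermx_eq0; apply/rowV0P => v /sub_kermxP vA.
by apply: trmx_inj; rewrite trmx0; apply: H; rewrite -[F]trmxK -trmx_mul vA trmx0.
Qed.

(** The images of three points of the standard conic already span the columns of [F]; hence a conic
    determines its three-space. *)
Lemma conic_gspace (F F' : 'M[C]_(22, 3)) : conic F `<=` conic F' -> (gspace F <= gspace F')%VS.
Proof.
move=> FF'; have two : (2 : C) != 0 by rewrite pnatr_eq0.
have H b z : normc z <= 1 -> F *m cvec b z \in gspace F'.
  move=> z1; have /conicP[b' [z' [_ e]]] : conic F' (<[F *m cvec b z]>%VS : projsp R).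
    by apply: FF'; apply/conicP; exists b, z.
  have : F *m cvec b z \in <[F *m cvec b z]>%VS by exact: memv_line.
  by rewrite e => /vlineP[k ->]; apply: memvZ; exact: memv_gspace.
have n0 : normc (0 : C) <= 1 by rewrite normc0 ler01.
have n1 : normc (1 : C) <= 1 by rewrite normc1.
have h0 := H true 0 n0; have h2 := H false 0 n0; have h1 := H true 1 n1.
by apply/subvP => v /memv_gspaceP[u ->]; exact: mulmx_cvec_mem h0 h2 h1 u.
Qed.

Variables (G : 'M[int]_22) (S : splitting R G).

(** The factor [jmx 'i] turns the Veronese conic into the isotropic conic of the orthonormal frame,
    so that [Cc M] consists of the isotropic lines of the three-space ([psi_chart]). *)
Definition cframe (M : 'M[C]_(19, 3)) : 'M[C]_(22, 3) := frame S M *m jmx 'i.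
Definition Cc (M : 'M[C]_(19, 3)) : conicsp R := conic (cframe M).
Definition pt (M : 'M[C]_(19, 3)) (b : bool) (z : C) : 'cV[C]_22 := cframe M *m cvec b z.

Lemma i_i : ('i : C) * 'i = -1.
Proof. by rewrite -expr2 sqr_i. Qed.

Lemma two_neq0 : (2 : C) != 0. Proof. by rewrite pnatr_eq0. Qed.

Section contractive_chart.
Variable M : 'M[C]_(19, 3).
Hypothesis cM : contractive M.

Lemma frame_inj (u : 'cV[C]_3) : frame S M *m u = 0 -> u = 0.
Proof.
move=> Fu; have := frame_orthonormal S cM; move/(congr1 (mulmx^~ u)).
by rewrite -mulmxA Fu mulmx0 mul1mx.
Qed.

Lemma cframe_inj (u : 'cV[C]_3) : cframe M *m u = 0 -> u = 0.
Proof.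
rewrite -mulmxA => /frame_inj Ju; have uJ := jmx_unit i_i two_neq0.
by rewrite -[u](mulKmx uJ) Ju mulmx0.
Qed.

Lemma gspace_cframe : gspace (cframe M) = gspace (chart S M).
Proof. by rewrite (gspace_mulmx _ (jmx_unit i_i two_neq0)); exact: gspace_frame. Qed.

Lemma pt_neq0 b z : pt M b z != 0.
Proof. by apply/eqP => /cframe_inj/eqP; rewrite (negPf (cvec_neq0 b z)). Qed.

Lemma pt_isotropic b z : bform G (pt M b z) (pt M b z) = 0.
Proof.
rewrite /pt /cframe -mulmxA (bform_orthonormal _ _ (frame_orthonormal S cM)).
exact: jmx_isotropic i_i b z.
Qed.

Lemma pt_mem b z : pt M b z \in gspace (chart S M).
Proof. by rewrite -gspace_cframe memv_gspace. Qed.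

Lemma pt_Omega b z : Omega G (<[pt M b z]>%VS : projsp R).
Proof.
exists (pt M b z) => //; split; first exact: pt_isotropic.
by have [_ H] := chart_Gplus S cM; apply: H; [exact: pt_mem|exact: pt_neq0].
Qed.

Lemma pt_onto x : x \in gspace (chart S M) -> x != 0 -> bform G x x = 0 ->
  exists b z, normc z <= 1 /\ exists2 k : C, k != 0 & x = k *: pt M b z.
Proof.
rewrite -gspace_frame // => /memv_gspaceP[u ->] Fu0.
rewrite (bform_orthonormal _ _ (frame_orthonormal S cM)) => uu.
have u0 : u != 0 by apply: contraNneq Fu0 => ->; rewrite mulmx0.
have [s [t [k [st k0 e]]]] := isotropic_param i_i two_neq0 u0 uu.
have /conicP[b [z [z1 ez]]] : conic (cframe M) (<[frame S M *m u]>%VS : projsp R).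
  exists s, t; split=> //; rewrite conic_colE /cframe -mulmxA e -scalemxAr.
  by rewrite line_scale.
exists b, z; split=> //; apply: line_eqP; [exact: pt_neq0|exact: esym ez].
Qed.

Lemma psi_chart : psi G (gspace (chart S M)) = Cc M.
Proof.
apply/seteqP; split=> [p [[x -> [xx hx]]]|p /conicP[b [z [z1 ->]]]].
  rewrite -memvE => xW; have x0 : x != 0.
    by apply: contraTneq hx => ->; rewrite bform0l ltxx.
  have [b [z [z1 [k k0 ->]]]] := pt_onto xW x0 xx.
  by apply/conicP; exists b, z; split=> //; exact: line_scale.
by split; [exact: pt_Omega|rewrite -memvE; exact: pt_mem].
Qed.

Lemma Cc_in_Omega : conics_in_Omega G (Cc M).
Proof.
split; last by rewrite -psi_chart => p [].
by exists (cframe M) => //; apply/rank3_injective; exact: cframe_inj.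
Qed.

Lemma Cc_C1 : C1 G (Cc M).
Proof.
exists (gspace (chart S M)); first exact: chart_Gplus.
by rewrite psi_chart; apply: connected_component_refl; exact: Cc_in_Omega.
Qed.

Variables (T : Type) (F : set_system T) (FF : Filter F) (f : T -> 'M[C]_(19, 3)).
Hypothesis fM : f @ F --> M.

Lemma cvg_cframe : (fun t => cframe (f t)) @ F --> cframe M.
Proof. by apply: cvg_mulmx; [exact: cvg_frame|exact: cvg_cst]. Qed.

Lemma cvg_pt b (g : T -> C) (z : C) : g @ F --> z -> (fun t => pt (f t) b (g t)) @ F --> pt M b z.
Proof. by move=> gz; apply: cvg_mulmx; [exact: cvg_cframe|exact: cvg_cvec]. Qed.

End contractive_chart.

Lemma cframe_rank M : contractive M -> \rank (cframe M) = 3%N.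
Proof. by move=> cM; apply/rank3_injective; exact: cframe_inj. Qed.

Lemma cvg_Cc (T : Type) (F : set_system T) (FF : Filter F) (f : T -> 'M[C]_(19, 3)) M :
  contractive M -> F (fun t => contractive (f t)) -> f @ F --> M ->
  (fun t => Cc (f t)) @ F --> Cc M.
Proof.
move=> cM Fc fM.
apply: (@cvg_final _ _ [set F : 'M[C]_(22, 3) | \rank F = 3%N] (@conic R) _ _ _
  (fun t => cframe (f t))).
- exact: cframe_rank.
- exact: cvg_cframe.
- by apply: (@filterS _ F FF _ _ _ Fc) => t; exact: cframe_rank.
Qed.

(** The chart depends continuously on the conic. The parametrizations [F] whose column space has its
    chart in a given open set form an open set, and this set is saturated because a conic determines
    its column space. *)
Lemma near_Cc M (N : set 'M[C]_(19, 3)) : contractive M -> nbhs M N ->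
  exists O : set (conicsp R), [/\ open O, O (Cc M) &
    forall M', contractive M' -> O (Cc M') -> N M'].
Proof.
move=> cM; rewrite nbhsE => -[N' [oN' N'M] N'N].
pose A : set 'M[C]_(22, 3) := [set F | [/\ \rank F = 3%N, upm S F \in unitmx & N' (chart_of S F)]].
have rank_up F : upm S F \in unitmx -> \rank F = 3%N.
  move=> uF; apply/rank3_injective => u Fu.
  by rewrite -[u](mulKmx uF) /upm -mulmxA Fu !mulmx0.
have oA : open A.
  rewrite openE => F [rF uF NF].
  have id : id @ (nbhs F) --> F by exact: cvg_id.
  have h1 := near_unit_upm (nbhs_filter F) uF id; have h2 := cvg_chart_of (nbhs_filter F) uF id.
  have {}h2 : nbhs F (fun F' => N' (chart_of S F')).
    by apply: h2; apply: open_nbhs_nbhs; split.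
  apply: filterS (filterI h1 h2) => F' [u N'F']; split=> //; exact: rank_up.
have key M' : contractive M' -> upm S (cframe M') \in unitmx /\ chart_of S (cframe M') = M'.
  by move=> cM'; apply: chart_of_gspace; [exact: gspace_cframe|exact: cframe_inj].
have Asat F F' : A F -> conic F = conic F' -> A F'.
  move=> [rF uF NF] FF'.
  have sub1 : (gspace F <= gspace F')%VS by apply: conic_gspace; rewrite FF'.
  have sub2 : (gspace F' <= gspace F)%VS by apply: conic_gspace; rewrite FF'.
  have inj' : forall u : 'cV[C]_3, F' *m u = 0 -> u = 0.
    have [B FB] := sub_gspace_mulmx sub1.
    have uB : B \in unitmx.
      by apply: unitmx_kernel => v Bv; apply: ((rank3_injective F).1 rF); rewrite FB -mulmxA Bv mulmx0.
    move=> u F'u; have : invmx B *m u = 0.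
      by apply: ((rank3_injective F).1 rF); rewrite FB -mulmxA mulKVmx.
    by move=> Bu; rewrite -[u](mulKVmx uB) Bu mulmx0.
  have e : gspace F' = gspace (chart S (chart_of S F)).
    by rewrite gspace_chart_of //; apply/eqP; rewrite eqEsubv sub1 sub2.
  by have [u' eF'] := chart_of_gspace e inj'; split; rewrite ?eF' //; exact: rank_up.
exists [set conic F | F in A]; split.
- by apply: (@open_final_image _ _ [set F : 'M[C]_(22, 3) | \rank F = 3%N] (@conic R)) => // F [].
- have [u e] := key M cM; exists (cframe M) => //; split=> //; first exact: cframe_rank.
  by rewrite e.
- move=> M' cM' [F AF FM']; have [_ _] := Asat F (cframe M') AF FM'.
  by have [_ ->] := key M' cM'; exact: N'N.
Qed.

End conics.

(** * Normal vectors *)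

Section cross_product.
Variable K : fieldType.
Local Notation dot a b := ((a^T *m b) 0 0).
Implicit Types a b c : 'cV[K]_3.

Definition crs a b : 'cV[K]_3 :=
  vec3 (a 1 0 * b 2 0 - a 2 0 * b 1 0) (a 2 0 * b 0 0 - a 0 0 * b 2 0)
       (a 0 0 * b 1 0 - a 1 0 * b 0 0).

Lemma dot_vec3 a b : dot a b = a 0 0 * b 0 0 + a 1 0 * b 1 0 + a 2 0 * b 2 0.
Proof. by rewrite {1}(vec3_eta a) {1}(vec3_eta b) mulmx_tr_vec3. Qed.

Lemma crs_entries a b : [/\ crs a b 0 0 = a 1 0 * b 2 0 - a 2 0 * b 1 0,
  crs a b 1 0 = a 2 0 * b 0 0 - a 0 0 * b 2 0 &
  crs a b 2 0 = a 0 0 * b 1 0 - a 1 0 * b 0 0].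
Proof. by split; rewrite mxE. Qed.

Lemma dot_crsl a b : dot (crs a b) a = 0.
Proof. by have [e0 e1 e2] := crs_entries a b; rewrite dot_vec3 e0 e1 e2; ring. Qed.

Lemma dot_crsr a b : dot (crs a b) b = 0.
Proof. by have [e0 e1 e2] := crs_entries a b; rewrite dot_vec3 e0 e1 e2; ring. Qed.

Lemma dot_crs a b : dot (crs a b) (crs a b) = dot a a * dot b b - dot a b ^+ 2.
Proof. by have [e0 e1 e2] := crs_entries a b; rewrite !dot_vec3 e0 e1 e2; ring. Qed.

(* [(n.n) c - (c.n) n = n x (c x n)] with [c x (a x b) = (c.b) a - (c.a) b]. *)
Lemma crs_unique a b c : let n := crs a b in
  dot n n != 0 -> dot c a = 0 -> dot c b = 0 -> c = (dot c n / dot n n) *: n.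
Proof.
move=> n nn0; have [e0 e1 e2] := crs_entries a b.
rewrite (dot_vec3 c a) (dot_vec3 c b) => ca cb.
suff H : dot n n *: c = dot c n *: n.
  by rewrite [_ / _]mulrC -scalerA -H scalerA mulVf // scale1r.
have E (x : 'cV[K]_3) : x = vec3 (x 0 0) (x 1 0) (x 2 0) by exact: vec3_eta.
rewrite !dot_vec3 [c in LHS]E [n in RHS]E !vec3_scale /n e0 e1 e2.
set a0 := a 0 0 in ca *; set a1 := a 1 0 in ca *; set a2 := a 2 0 in ca *.
set b0 := b 0 0 in cb *; set b1 := b 1 0 in cb *; set b2 := b 2 0 in cb *.
set c0 := c 0 0 in ca cb *; set c1 := c 1 0 in ca cb *; set c2 := c 2 0 in ca cb *.
set n0 := a1 * b2 - a2 * b1; set n1 := a2 * b0 - a0 * b2; set n2 := a0 * b1 - a1 * b0.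
have key (u v w : K) : u - v = (c0 * b0 + c1 * b1 + c2 * b2) * w -> u = v.
  by rewrite cb mul0r => /eqP; rewrite subr_eq0 => /eqP.
have F (u v w w' : K) : u - v = (c0 * b0 + c1 * b1 + c2 * b2) * w - (c0 * a0 + c1 * a1 + c2 * a2) * w' -> u = v.
  by rewrite ca mul0r subr0; exact: key.
have [-> -> ->] := vec3E n0 n1 n2; congr vec3.
- by apply: (F _ _ (n1 * a2 - n2 * a1) (n1 * b2 - n2 * b1)); rewrite /n0 /n1 /n2; ring.
- by apply: (F _ _ (n2 * a0 - n0 * a2) (n2 * b0 - n0 * b2)); rewrite /n0 /n1 /n2; ring.
- by apply: (F _ _ (n0 * a1 - n1 * a0) (n0 * b1 - n1 * b0)); rewrite /n0 /n1 /n2; ring.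
Qed.

End cross_product.

Lemma cvg_crs (K : numFieldType) (T : Type) (F : set_system T) (FF : Filter F)
    (f g : T -> 'cV[K]_3) (a b : 'cV[K]_3) :
  f @ F --> a -> g @ F --> b -> (fun t => crs (f t) (g t)) @ F --> crs a b.
Proof.
move=> fa gb; have e (h : T -> 'cV[K]_3) (c : 'cV[K]_3) i : h @ F --> c -> (fun t => h t i 0) @ F --> c i 0.
  by move=> hc; exact: cvg_entry.
apply: cvg_mx => i j; rewrite mxE; under eq_fun do rewrite mxE.
by case: (ord3_cases i) => -> /=; apply: cvg_subf; apply: cvg_mulf; apply: e.
Qed.

Section cross_frame.
Variables (K : fieldType) (G : 'M[int]_22) (F : 'M[K]_(22, 3)).
Hypothesis (F1 : F^T *m ext K G *m F = 1%:M).
Local Notation B := (bform G).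
Implicit Types x y : 'cV[K]_22.

(** For [x] outside the span of [F] these are the coordinates of its orthogonal projection to the
    span. This matters because [xprod] is applied to the conjugate of a vector, which leaves the
    span unless the latter is real. *)
Definition coef x : 'cV[K]_3 := F^T *m ext K G *m x.
Definition xprod x y : 'cV[K]_22 := F *m crs (coef x) (coef y).

Lemma bform_coef (u : 'cV[K]_3) x : B (F *m u) x = (u^T *m coef x) 0 0.
Proof. by rewrite /bform /coef trmx_mul !mulmxA. Qed.

Lemma coef_mulmx (u : 'cV[K]_3) : coef (F *m u) = u.
Proof. by rewrite /coef mulmxA F1 mul1mx. Qed.

Lemma xprod_perpl x y : B (xprod x y) x = 0.
Proof. by rewrite bform_coef dot_crsl. Qed.

Lemma xprod_perpr x y : B (xprod x y) y = 0.
Proof. by rewrite bform_coef dot_crsr. Qed.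

(** Lagrange's identity for the cross product, in which the product of the two squares vanishes with
    [B x x]. *)
Lemma xprod_sq x y : x \in gspace F -> B x x = 0 -> B (xprod x y) (xprod x y) = - B x y ^+ 2.
Proof.
move=> /memv_gspaceP[u xu] xx; rewrite bform_coef /xprod coef_mulmx dot_crs.
have -> : ((coef x)^T *m coef y) 0 0 = B x y by rewrite xu coef_mulmx -bform_coef.
have -> : ((coef x)^T *m coef x) 0 0 = B x x by rewrite {3}xu bform_coef xu coef_mulmx.
by rewrite xx mul0r sub0r.
Qed.

Lemma xprod_unique x y z : x \in gspace F -> B x x = 0 -> B x y != 0 ->
  z \in gspace F -> B z x = 0 -> B z y = 0 -> exists k, z = k *: xprod x y.
Proof.
move=> xW xx xy /memv_gspaceP[u ->]; rewrite !bform_coef => zx zy.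
have nn : ((crs (coef x) (coef y))^T *m crs (coef x) (coef y)) 0 0 != 0.
  have := xprod_sq y xW xx; rewrite bform_coef /xprod coef_mulmx => ->.
  by rewrite oppr_eq0 expf_neq0.
by rewrite (crs_unique nn zx zy) -scalemxAr; eexists.
Qed.

End cross_frame.

Section normals.
Variables (R : realType) (G : 'M[int]_22) (S : splitting R G).
Local Notation C := R[i].
Local Notation B := (bform G).
Let GT := gram_sym S.

(** In the order of [R[i]] the condition [0 < B y y] also says that the square is real. It cuts the
    complex line of vectors orthogonal to [x] and [conjv x] down to the nonzero points of a real
    line. *)
Definition is_normal (W : {vspace 'cV[C]_22}) (x y : 'cV[C]_22) : Prop :=
  [/\ y \in W, B y x = 0, B y (conjv x) = 0 & 0 < B y y].

(** The square of the cross product is [- <x, conj x>^2], and the factor ['i] makes it positive. *)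
Definition nrml (M : 'M[C]_(19, 3)) (x : 'cV[C]_22) : 'cV[C]_22 :=
  'i *: xprod G (frame S M) x (conjv x).

Lemma nrml_normal M x : contractive M -> x \in gspace (chart S M) -> x != 0 -> B x x = 0 ->
  is_normal (gspace (chart S M)) x (nrml M x).
Proof.
move=> cM xW x0 xx; have F1 := frame_orthonormal S cM.
have WF := gspace_frame S cM.
have [_ /(_ x xW x0) hx] := chart_Gplus S cM.
split.
- by rewrite -WF; apply: memvZ; exact: memv_gspace.
- by rewrite bformZl xprod_perpl mulr0.
- by rewrite bformZl xprod_perpr mulr0.
- rewrite bformZl bformZr mulrA i_i mulN1r (xprod_sq F1 _ _ xx) ?WF // opprK.
  by rewrite exprn_gt0.
Qed.

Lemma cvg_nrml M x (T : Type) (F : set_system T) (FF : Filter F) (f : T -> 'M[C]_(19, 3)) (g : T -> 'cV[C]_22) :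
  contractive M -> f @ F --> M -> g @ F --> x -> (fun t => nrml (f t) (g t)) @ F --> nrml M x.
Proof.
move=> cM fM gx; have cF : (fun t => frame S (f t)) @ F --> frame S M by exact: cvg_frame.
have cc (h : T -> 'cV[C]_22) (z : 'cV[C]_22) : h @ F --> z -> (fun t => coef G (frame S (f t)) (h t)) @ F --> coef G (frame S M) z.
  move=> hz; apply: cvg_mulmx; last exact: hz.
  by apply: cvg_mulmx; [apply: cvg_trmx; exact: cF|exact: cvg_cst].
apply: cvg_scalemx; first exact: cvg_cst.
apply: cvg_mulmx; first exact: cF.
by apply: cvg_crs; apply: cc; [exact: gx|exact: cvg_conjv].
Qed.

Lemma sqr_gt0_real (k : C) : 0 < k ^+ 2 -> exists2 a : R, a != 0 & k = a%:C.
Proof.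
case: k => a b; rewrite expr2 ltcE /= => /andP[/eqP im0 re0].
have /eqP : a * b = 0 by lra.
rewrite mulf_eq0 => /orP[/eqP a0|/eqP b0].
  by move: re0; rewrite a0 mul0r sub0r oppr_gt0 ltNge -expr2 sqr_ge0.
exists a; last by rewrite b0.
by apply: contraTneq re0 => ->; rewrite b0 !mul0r subr0 ltxx.
Qed.

Lemma normal_unique W x y y' : Gplus G W -> x \in W -> x != 0 -> B x x = 0 ->
  is_normal W x y -> is_normal W x y' -> exists2 a : R, a != 0 & y' = a%:C *: y.
Proof.
move=> gW xW x0 xx; have [_ /(_ x xW x0) hx] := gW.
have [M cM WM] := Gplus_chart S gW; move: xW; rewrite WM -gspace_frame // => xW.
have F1 := frame_orthonormal S cM.
have xy : B x (conjv x) != 0 by rewrite gt_eqF.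
move=> [yW y1 y2 y3] [y'W y'1 y'2 y'3].
have [k yk] := xprod_unique F1 xW xx xy yW y1 y2.
have [k' yk'] := xprod_unique F1 xW xx xy y'W y'1 y'2.
have k0 : k != 0 by apply: contraTneq y3 => k0; rewrite yk k0 scale0r bform0l ltxx.
have e : y' = (k' / k) *: y by rewrite yk yk' scalerA divfK.
have : 0 < (k' / k) ^+ 2.
  by move: y'3; rewrite e bformZl bformZr mulrA -expr2 pmulr_lgt0.
by move=> /sqr_gt0_real[a a0 ak]; exists a; rewrite // -ak.
Qed.

Lemma positive_coneP (x : 'cV[C]_22) (k : 'cV[R]_22) :
  positive_cone G (<[x]>%VS : projsp R) k <-> B (complexv k) x = 0 /\ 0 < B k k.
Proof.
split=> [[H kk]|[kx kk]]; first by split=> //; apply: H; exact: memv_line.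
by split=> // z /vlineP[a ->]; rewrite bformZr kx mulr0.
Qed.

(** The numbers [B y y] and [B y (conjv y)] are the difference and the sum of the squares of [Rev y]
    and [Imv y]. Both are positive, hence so is the square of [Rev y]. *)
Lemma normal_cone W x y : Gplus G W -> is_normal W x y ->
  positive_cone G (<[x]>%VS : projsp R) (Rev y).
Proof.
move=> [_ pW] [yW y1 y2 y3]; apply/positive_coneP; split.
  rewrite complexv_Rev bformZl bformDl y1 add0r.
  by rewrite -[x]conjvK bform_conjv y2 conjc0 mulr0.
have y0 : y != 0 by apply: contraTneq y3 => ->; rewrite bform0l ltxx.
have := pW y yW y0; rewrite (hermE GT) ltcR; move: y3; rewrite (bform_selfE GT) ltcE /=.
by move=> /andP[_]; lra.
Qed.

End normals.

(** * The positive cones *)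

Section connectedness.
Variable R : realType.

Lemma connected_path (T : topologicalType) (f : R -> T) :
  (forall s : R, 0 <= s <= 1 -> f @ (within `[0, 1] (nbhs s)) --> f s) ->
  connected [set f s | s in `[0, 1]].
Proof.
move=> cf; apply: connected_continuous_connected; first exact: segment_connected.
by apply/subspace_continuousP => s; rewrite /= in_itv /= => s01; exact: cf.
Qed.

Lemma component_path (T : topologicalType) (A : set T) (f : R -> T) :
  (forall s : R, 0 <= s <= 1 -> f @ (within `[0, 1] (nbhs s)) --> f s) ->
  (forall s : R, 0 <= s <= 1 -> A (f s)) -> connected_component A (f 0) (f 1).
Proof.
move=> cf Af; exists [set f s | s in `[0, 1]].
  split; [|move=> _ [s s01 <-]; apply: Af; by rewrite /= in_itv /= in s01|exact: connected_path].
  by exists 0 => //; rewrite /= in_itv /= lexx ler01.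
by exists 1 => //; rewrite /= in_itv /= lexx ler01.
Qed.

Lemma component_segment m n (A : set 'M[R]_(m, n)) k k' :
  (forall s : R, 0 <= s <= 1 -> A ((1 - s) *: k + s *: k')) -> connected_component A k k'.
Proof.
move=> Ak; pose f (s : R) := (1 - s) *: k + s *: k'.
have f0 : f 0 = k by rewrite /f subr0 scale1r scale0r addr0.
have f1 : f 1 = k' by rewrite /f subrr scale1r scale0r add0r.
rewrite -[X in connected_component _ X _]f0 -[X in connected_component _ _ X]f1.
apply: component_path => [s _|s s01]; last exact: Ak.
apply: cvg_within_filter; apply: (@cvg_addmx _ (nbhs s)).
  apply: (@cvg_scalemx _ (nbhs s) _ _ _ _ (fun s => 1 - s) (fun=> k)); last exact: cvg_cst.
  by apply: (@cvg_subf _ (nbhs s)); [exact: cvg_cst|exact: cvg_id].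
by apply: (@cvg_scalemx _ (nbhs s) _ _ _ _ id (fun=> k')); [exact: cvg_id|exact: cvg_cst].
Qed.

Lemma connected_sign (T : topologicalType) (A : set T) (f : T -> R) (a b : T) :
  connected A -> {within A, continuous f} -> (forall x, A x -> f x != 0) ->
  A a -> A b -> 0 < f a -> 0 < f b.
Proof.
move=> cA cf f0 Aa Ab fa; rewrite ltNge; apply/negP => fb.
have /connected_intervalP cI := connected_continuous_connected cA cf.
have /= [x Ax fx] : [set f x | x in A] 0.
  apply: (cI (f b) (f a)); [by exists b|by exists a|by rewrite fb ltW].
by have := f0 x Ax; rewrite fx eqxx.
Qed.

Lemma connected_component_img (T : topologicalType) (g h : T -> T) (A : set T) (x : T) :
  continuous g -> continuous h -> cancel g h -> cancel h g ->
  [set g y | y in connected_component A x] = connected_component [set g y | y in A] (g x).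
Proof.
move=> cg ch gh hg; have ctn (u : T -> T) B : continuous u -> {within B, continuous u} by move=> cu; exact: continuous_subspaceT.
apply/seteqP; split=> [_ [y [B [Bx BA cB] By] <-]|y [B [Bx BA cB] By]].
  exists [set g z | z in B]; last by exists y.
  split; [by exists x|by move=> _ [z Bz <-]; exists z => //; exact: BA|].
  by apply: connected_continuous_connected => //; exact: ctn.
exists (h y); last exact: hg.
exists [set h z | z in B]; last by exists y.
split; [by exists (g x)|move=> _ [z /BA[w Aw <-] <-]; by rewrite gh|].
by apply: connected_continuous_connected => //; exact: ctn.
Qed.

End connectedness.

Section continuous_form.
Variables (R : realType) (G : 'M[int]_22) (k0 : 'cV[R]_22).

Lemma continuous_bformr : continuous (fun k : 'cV[R]_22 => bform G k0 k).
Proof.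
by move=> y; apply: (@cvg_bform _ (nbhs y) _ R G (fun=> k0) id k0 y); [exact: cvg_cst|exact: cvg_id].
Qed.

Lemma continuous_bforml : continuous (fun k : 'cV[R]_22 => bform G k k0).
Proof.
by move=> y; apply: (@cvg_bform _ (nbhs y) _ R G id (fun=> k0) y k0); [exact: cvg_id|exact: cvg_cst].
Qed.

End continuous_form.

Lemma convex_gt0 (R : realFieldType) (u v s : R) : 0 < u -> 0 < v -> 0 <= s <= 1 ->
  0 < (1 - s) * u + s * v.
Proof.
move=> u0 v0 /andP[s0 s1]; have [->|sn0] := eqVneq s 0; first by rewrite subr0 mul1r mul0r addr0.
by rewrite ltr_wpDl ?mulr_ge0 ?subr_ge0 ?(ltW u0) // mulr_gt0 // lt_neqAle eq_sym sn0.
Qed.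

Lemma convex_square_gt0 (R : realFieldType) (u v w s : R) : 0 < u -> 0 < v -> 0 < w -> 0 <= s <= 1 ->
  0 < (1 - s) * ((1 - s) * u + s * w) + s * ((1 - s) * w + s * v).
Proof. by move=> *; rewrite !convex_gt0. Qed.

Section cones.
Variables (R : realType) (G : 'M[int]_22) (S : splitting R G).
Local Notation C := R[i].
Local Notation B := (bform G).
Let GT := gram_sym S.

Definition rfr (x : 'cV[C]_22) (k : 'cV[R]_22) : 'M[R]_(22, 3) := col3 (Rev x) (Imv x) k.

Definition isotropic_positive (x : 'cV[C]_22) : Prop := B x x = 0 /\ 0 < B x (conjv x).

Lemma isotropic_positive_neq0 x : isotropic_positive x -> x != 0.
Proof. by move=> [_]; apply: contraTneq => ->; rewrite bform0l ltxx. Qed.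

Lemma OmegaP (p : projsp R) : Omega G p <-> exists2 x, p = <[x]>%VS & isotropic_positive x.
Proof. by []. Qed.

Lemma isotropic_positive_ReIm x : isotropic_positive x ->
  [/\ B (Rev x) (Imv x) = 0, B (Imv x) (Imv x) = B (Rev x) (Rev x) & 0 < B (Rev x) (Rev x)].
Proof.
move=> [/(bform_isoE GT)[e1 e2]]; rewrite (hermE GT) ltcR -e2 => h; split=> //; lra.
Qed.

Section at_point.
Variable x : 'cV[C]_22.
Hypothesis ipx : isotropic_positive x.
Local Notation cone := (positive_cone G (<[x]>%VS : projsp R)).

Lemma coneP k : cone k <-> [/\ B k (Rev x) = 0, B k (Imv x) = 0 & 0 < B k k].
Proof.
split=> [/positive_coneP[/bform_complexvl_eq0[? ?] ?]//|[e1 e2 e3]].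
by apply/positive_coneP; split=> //; exact/bform_complexvl_eq0.
Qed.

Lemma rfr_positive k : cone k -> positive_frame G (rfr x k).
Proof.
move=> /coneP[kr ki kk] v v0; have [ri ii rr] := isotropic_positive_ReIm ipx.
rewrite /rfr mulmx_col3 !(bformDl, bformDr, bformZl, bformZr) kr ki ri ii.
rewrite (bformC (Imv x) (Rev x) GT) ri (bformC (Rev x) k GT) kr (bformC (Imv x) k GT) ki.
have vE := vec3_eta v; set a := v 0 0 in vE *; set b := v 1 0 in vE *; set c := v 2 0 in vE *.
set h := B (Rev x) (Rev x) in rr *; set q := B k k in kk *.
have -> : a * (a * h + b * 0 + c * 0) + b * (a * 0 + b * h + c * 0) + c * (a * 0 + b * 0 + c * q) = h * (a ^+ 2 + b ^+ 2) + q * c ^+ 2 by ring.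
have [ab|ab] := eqVneq (a ^+ 2 + b ^+ 2) 0; last first.
  apply: ltr_pwDl; first by rewrite mulr_gt0 // lt_neqAle eq_sym ab addr_ge0 ?sqr_ge0.
  by rewrite mulr_ge0 ?sqr_ge0 // ltW.
rewrite ab mulr0 add0r mulr_gt0 // exprn_even_gt0 //=.
move/eqP: ab; rewrite paddr_eq0 ?sqr_ge0 // !sqrf_eq0 => /andP[/eqP a0 /eqP b0].
apply: contra v0 => /eqP c0; rewrite vE a0 b0 c0; apply/eqP/matrixP => i j.
by rewrite !mxE; do 2?case: ifP.
Qed.

(** A vector of the cone orthogonal to [k] would be orthogonal to the positive three-space of
    [rfr x k], against the signature. *)
Lemma cone_orth k k' : cone k -> cone k' -> B k k' != 0.
Proof.
move=> ck ck'; apply/eqP => kk'.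
have [/coneP[kr ki kk] /coneP[kr' ki' kk2]] := (ck, ck').
have := @perp_frame_neg R G S (rfr x k) k' (rfr_positive ck).
have -> : (rfr x k)^T *m ext R G *m k' = 0.
  apply/matrixP => i j; rewrite (ord1 j) -[k' in LHS](col_id 0) mxE_bform mxE col_id.
  have [c0 c1 c2] := col_col3 (Rev x) (Imv x) k.
  by rewrite /rfr col_id; case: (ord3_cases i) => ->; rewrite ?c0 ?c1 ?c2 // (bformC _ _ GT).
move=> /(_ erefl) H; have : B k' k' < 0.
  by apply: H; apply: contraTneq kk2 => ->; rewrite bform0l ltxx.
by rewrite ltNge ltW.
Qed.

(** By [cone_orth] the sign of [B k0] is constant on connected subsets of the cone; two vectors with
    positive product are joined by a segment inside the cone. *)
Lemma component_cone k0 : cone k0 ->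
  connected_component cone k0 = [set k | cone k /\ 0 < B k0 k].
Proof.
move=> c0; apply/seteqP; split=> [k [A [A0 Ac cA] Ak]|k [ck kk]].
  split; first exact: Ac.
  apply: (@connected_sign _ _ A (fun k => B k0 k) k0 k cA) => //.
  - exact/continuous_subspaceT/continuous_bformr.
  - by move=> y /Ac cy; exact: cone_orth.
  - by have /coneP[] := c0.
apply: component_segment => s /andP[s0 s1].
have [/coneP[r0 i0 q0] /coneP[r1 i1 q1]] := (c0, ck).
apply/coneP; rewrite !bformDl !bformZl r0 i0 r1 i1 !mulr0 addr0; split=> //.
rewrite !bformDr !bformZr (bformC k k0 GT).
by apply: convex_square_gt0; rewrite ?s0.
Qed.

End at_point.

Variable V : projsp R -> set 'cV[R]_22.
Hypothesis hV : continuous_component G V.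

Section component_at_point.
Variable p : projsp R.
Hypothesis Op : Omega G p.
Local Notation cone := (positive_cone G p).

Lemma V_cone k : V p k -> cone k.
Proof. by have [k0 c0 ->] := hV.1 p Op; exact: connected_component_sub. Qed.

Lemma V_inhabited : exists k, V p k.
Proof. by have [k0 c0 ->] := hV.1 p Op; exists k0; exact: connected_component_refl. Qed.

Lemma V_mem k1 k2 : V p k1 -> V p k2 <-> cone k2 /\ 0 < B k1 k2.
Proof.
have [k0 c0 ->] := hV.1 p Op => k01; have c1 := connected_component_sub k01.
rewrite (same_connected_component k01).
have /OmegaP[x px ipx] := Op; move: c0 c1 {k01}; rewrite px => c0 c1.
by rewrite component_cone.
Qed.

Lemma cone_opp k : cone k -> cone (- k).
Proof.
move=> [kp kk]; split; last by rewrite bformNl bformNr opprK.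
move=> y yp; have -> : complexv (- k) = - complexv k.
  by rewrite -scaleN1r complexvZ rmorphN1 scaleN1r.
by rewrite bformNl kp // oppr0.
Qed.

Lemma cone_orthp k k' : cone k -> cone k' -> B k k' != 0.
Proof. by have /OmegaP[x -> ipx] := Op; exact: cone_orth. Qed.

Lemma V_or_opp k : cone k -> V p k \/ V p (- k).
Proof.
move=> ck; have [k1 Vk1] := V_inhabited; have c1 := V_cone Vk1.
have := cone_orthp c1 ck; rewrite neq_lt => /orP[kk|kk]; [right|left]; apply/(V_mem _ Vk1); split=> //.
  exact: cone_opp.
by rewrite bformNr oppr_gt0.
Qed.

Lemma V_not_opp k : V p k -> ~ V p (- k).
Proof.
move=> Vk /(V_mem _ Vk)[_]; rewrite bformNr oppr_gt0.
by have [_ kk] := V_cone Vk; rewrite ltNge ltW.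
Qed.

Lemma V_scale (a : R) k : 0 < a -> V p k -> V p (a *: k).
Proof.
move=> a0 Vk; have [kp kk] := V_cone Vk; apply/(V_mem _ Vk); split; last by rewrite bformZr mulr_gt0.
split; last by rewrite bformZl bformZr !mulr_gt0.
by move=> y yp; rewrite complexvZ bformZl kp // mulr0.
Qed.

Lemma V_convex k k' (s : R) : V p k -> V p k' -> 0 <= s <= 1 -> V p ((1 - s) *: k + s *: k').
Proof.
move=> Vk Vk' /andP[s0 s1]; have [kp kk] := V_cone Vk; have [kp' kk'] := V_cone Vk'.
have /(V_mem _ Vk)[_ q] := Vk'.
apply/(V_mem _ Vk); split; last first.
  by rewrite bformDr !bformZr convex_gt0 ?s0.
split; first by move=> y yp; rewrite complexvD !complexvZ bformDl !bformZl kp // kp' // !mulr0 addr0.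
rewrite bformDl !bformZl !bformDr !bformZr (bformC k' k GT).
by apply: convex_square_gt0; rewrite ?s0.
Qed.

(** The components are the chambers cut out by the walls through [p]: signs cannot change along a
    connected set, and vectors with the same signs are joined by a segment. The one-sided condition
    on signs suffices because [- d] is a root together with [d]. *)
Lemma component_Vcirc k : Vcirc G V p k ->
  connected_component (Vcirc G V p) k = [set k' | Vcirc G V p k' /\
    forall d, Delta G d -> (forall x, x \in (p : {vspace _}) -> B (ext C d) x = 0) ->
    0 < B k (ext R d) -> 0 < B k' (ext R d)].
Proof.
move=> ck; apply/seteqP; split=> [k' [A [Ak Ac cA] Ak']|k' [ck' kk']].
  split=> [|d Dd dp]; first exact: Ac.
  apply: (@connected_sign _ _ A (fun k => B k (ext R d)) k k' cA) => //.
  - exact/continuous_subspaceT/continuous_bforml.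
  - by move=> y /Ac[_]; apply.
have kk d : Delta G d -> (forall x, x \in (p : {vspace _}) -> B (ext C d) x = 0) ->
    0 < B k (ext R d) * B k' (ext R d).
  move=> Dd dp; have [_ /(_ d Dd dp) n1] := ck; have [_ /(_ d Dd dp) n2] := ck'.
  move: n1; rewrite neq_lt => /orP[n1|n1]; last by rewrite mulr_gt0 // kk'.
  have Dd' : Delta G (- d) by rewrite /Delta /= bformNl bformNr opprK.
  have eN (K : pzRingType) : ext K (- d) = - ext K d by exact: map_mxN.
  have := kk' (- d) Dd'; rewrite !eN !bformNr oppr_gt0.
  have dp' : forall x, x \in (p : {vspace _}) -> B (- ext C d) x = 0.
    by move=> y yp; rewrite bformNl dp // oppr0.
  by move=> /(_ dp' n1); rewrite oppr_gt0 => n2'; rewrite nmulr_lgt0.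
apply: component_segment => s s01.
split; first by apply: V_convex => //; [exact: ck.1|exact: ck'.1].
move=> d Dd dp; rewrite bformDl !bformZl; have := kk d Dd dp.
set u := B k _; set v := B k' _ => uv; apply/eqP => e.
have uu : 0 < u * u by rewrite -expr2 exprn_even_gt0 //=; apply: contraTneq uv => ->; rewrite mul0r ltxx.
have := convex_gt0 uu uv s01.
have -> : (1 - s) * (u * u) + s * (u * v) = u * ((1 - s) * u + s * v) by ring.
by rewrite e mulr0 ltxx.
Qed.

Lemma kappa_class_eq k k' : Vcirc G V p k -> Vcirc G V p k' ->
  (forall d, Delta G d -> (forall x, x \in (p : {vspace _}) -> B (ext C d) x = 0) ->
    0 < B k (ext R d) -> 0 < B k' (ext R d)) ->
  kappa_class G V (k, p) = kappa_class G V (k', p).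
Proof.
move=> ck ck' kk'; rewrite /kappa_class /=; congr pair.
by apply: same_connected_component; rewrite component_Vcirc.
Qed.

Lemma Vcirc_scale (a : R) k : 0 < a -> Vcirc G V p k -> Vcirc G V p (a *: k).
Proof.
move=> a0 [Vk H]; split; first exact: V_scale.
by move=> d Dd dp; rewrite bformZl mulf_neq0 ?(H d Dd dp) // gt_eqF.
Qed.

Lemma kappa_class_scale (a : R) k : 0 < a -> Vcirc G V p k ->
  kappa_class G V (a *: k, p) = kappa_class G V (k, p).
Proof.
move=> a0 ck; symmetry; apply: kappa_class_eq => //; first exact: Vcirc_scale.
by move=> d Dd dp dk; rewrite bformZl mulr_gt0.
Qed.

End component_at_point.

(** The openness in [continuous_component] is relative to the total space of the cones; here it is
    restated with neighborhoods in the full product, the two side conditions becoming premises. *)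
Lemma near_V (p : projsp R) k : Omega G p -> V p k ->
  \forall z \near (k, p), Omega G z.2 -> positive_cone G z.2 z.1 -> V z.2 z.1.
Proof.
move=> Op Vk; have := hV.2; rewrite openE => /(_ (k, p)) /=.
have Dkp : [set kp : 'cV[R]_22 * projsp R | Omega G kp.2 /\ positive_cone G kp.2 kp.1] (k, p).
  by split=> //=; exact: V_cone.
move=> /(_ (conj Op Vk)) H.
have : within [set kp : 'cV[R]_22 * projsp R | Omega G kp.2 /\ positive_cone G kp.2 kp.1] (nbhs (k, p))
   [set kp | Omega G kp.2 /\ V kp.2 kp.1] by rewrite nbhs_subspace_in.
rewrite /within /= => W; apply: (@filterS _ (nbhs (k, p)) _ _ _ _ W) => z H' Oz cz.
by have [] := H' (conj Oz cz).
Qed.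

End cones.

Lemma conic_eq_gspace (R : realType) (F F' : 'M[R[i]]_(22, 3)) :
  conic F = conic F' -> gspace F = gspace F'.
Proof. by move=> e; apply/eqP; rewrite eqEsubv !conic_gspace // e. Qed.

#[global] Opaque frame cframe nrml.

(** * Complex conjugation, normal vectors and good three-spaces *)

Section conjugate_spaces.
Variable R : realType.
Local Notation C := R[i].

Lemma memv_conjs (W : {vspace 'cV[C]_22}) v : (v \in conjs W) = (conjv v \in W).
Proof.
apply/idP/idP => [|vW].
  move=> /coord_span ->; elim/big_ind: _ => [|a b ha hb|i _].
  - by rewrite /conjv map_mx0 mem0v.
  - by rewrite conjvD; exact: memvD.
  rewrite conjvZ; apply: memvZ.
  rewrite (nth_map 0) ?size_tuple // conjvK; apply: vbasis_mem; apply: mem_nth.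
  by rewrite size_tuple.
rewrite -[v]conjvK (coord_vbasis vW); elim/big_ind: _ => [|a b ha hb|i _].
- by rewrite /conjv map_mx0 mem0v.
- by rewrite conjvD; exact: memvD.
rewrite conjvZ; apply: memvZ; apply: memv_span; apply: map_f.
by apply: mem_nth; rewrite size_tuple.
Qed.

Lemma conjs_line x : conjs (<[x]>%VS : {vspace 'cV[C]_22}) = <[conjv x]>%VS.
Proof.
apply/vspaceP => v; rewrite memv_conjs; apply/vlineP/vlineP => -[k e].
  by exists k^*; rewrite -[v]conjvK e conjvZ.
by exists k^*; rewrite e conjvZ conjvK.
Qed.

Lemma conjsK (W : {vspace 'cV[C]_22}) : conjs (conjs W) = W.
Proof. by apply/vspaceP => v; rewrite !memv_conjs conjvK. Qed.

End conjugate_spaces.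

Section normal_vectors.
Variables (R : realType) (G : 'M[int]_22) (S : splitting R G).
Local Notation C := R[i].
Local Notation B := (bform G).
Local Notation VS := {vspace 'cV[C]_22}.
Implicit Types (W : VS) (x y v : 'cV[C]_22) (p : projsp R).
Let GT := gram_sym S.

Lemma Cc_gspace M M' : contractive M -> contractive M' -> Cc S M = Cc S M' ->
  gspace (chart S M) = gspace (chart S M').
Proof.
by move=> cM cM'; rewrite -(gspace_cframe S cM) -(gspace_cframe S cM'); exact: conic_eq_gspace.
Qed.

Lemma psi_inj (W W' : VS) : Gplus G W -> Gplus G W' -> psi G W = psi G W' -> W = W'.
Proof.
move=> /(Gplus_chart S)[M cM ->] /(Gplus_chart S)[M' cM' ->].
by rewrite (psi_chart S cM) (psi_chart S cM'); exact: Cc_gspace.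
Qed.

(** A relation that does not involve [V]: it holds for [k] and [- k] alike and for every choice of
    the representative [x]. Goodness, defined through it, is thus a property of [W] alone. *)
Definition normal_at (W : VS) (p : projsp R) (k : 'cV[R]_22) : Prop :=
  exists x y, [/\ p = <[x]>%VS, x \in W, isotropic_positive G x, is_normal G W x y & k = Rev y].

Definition orthp (d : 'cV[int]_22) (p : projsp R) : Prop :=
  forall x, x \in (p : {vspace _}) -> B (ext C d) x = 0.

Definition goodW (W : VS) : Prop :=
  forall p k, normal_at W p k -> forall d, Delta G d -> orthp d p -> B k (ext R d) != 0.

Lemma orthp_line d x : orthp d <[x]>%VS <-> B (ext C d) x = 0.
Proof.
split=> [|dx y /vlineP[a ->]]; first by apply; exact: memv_line.
by rewrite bformZr dx mulr0.
Qed.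

Lemma is_normal_scale W x y a : is_normal G W x y -> is_normal G W (a *: x) y.
Proof. by move=> [y1 y2 y3 y4]; split; rewrite // ?conjvZ bformZr ?y2 ?y3 mulr0. Qed.

Lemma is_normal_opp W x y : is_normal G W x y -> is_normal G W x (- y).
Proof.
move=> [y1 y2 y3 y4]; split; rewrite ?bformNl ?y2 ?y3 ?oppr0 //; first by rewrite memvN.
by rewrite bformNr opprK.
Qed.

Lemma RevN (y : 'cV[C]_22) : Rev (- y) = - Rev y.
Proof. by apply/matrixP => i j; rewrite !mxE; case: (y i j). Qed.

Lemma normal_at_Omega W p k : normal_at W p k -> Omega G p.
Proof. by move=> [x [y [-> xW ipx _ _]]]; exists x. Qed.

Lemma normal_at_cone W p k : Gplus G W -> normal_at W p k -> positive_cone G p k.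
Proof. by move=> gW [x [y [-> xW ipx nxy ->]]]; exact: (normal_cone S gW nxy). Qed.

Lemma normal_at_opp W p k : normal_at W p k -> normal_at W p (- k).
Proof.
move=> [x [y [-> xW ipx nxy ->]]]; exists x, (- y); split=> //; first exact: is_normal_opp.
by rewrite RevN.
Qed.

Lemma normal_at_unique W p k k' : Gplus G W -> normal_at W p k -> normal_at W p k' ->
  exists2 a : R, a != 0 & k' = a *: k.
Proof.
move=> gW [x [y [-> xW ipx nxy ->]]] [x' [y' [xx' x'W ipx' nxy' ->]]].
have x0 := isotropic_positive_neq0 ipx; have x'0 := isotropic_positive_neq0 ipx'.
have [c c0 xE] := line_eqP x'0 (esym xx').
have nxy'' : is_normal G W x y' by rewrite xE; exact: is_normal_scale.
have [a a0 ->] := normal_unique S gW xW x0 ipx.1 nxy nxy''.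
by exists a => //; rewrite RevZ.
Qed.

Lemma nrml_normal_at M x : contractive M -> x \in gspace (chart S M) -> isotropic_positive G x ->
  normal_at (gspace (chart S M)) <[x]>%VS (Rev (nrml S M x)).
Proof.
move=> cM xW ipx; exists x, (nrml S M x); split=> //.
exact: (nrml_normal cM xW (isotropic_positive_neq0 ipx) ipx.1).
Qed.

Lemma psiP W p : psi G W p <-> exists x, [/\ p = <[x]>%VS, x \in W & isotropic_positive G x].
Proof.
split=> [[[x -> ipx]]|[x [-> xW ipx]]]; first by rewrite -memvE => xW; exists x.
by split; [exists x|rewrite -memvE].
Qed.

Lemma normal_at_ex W p : Gplus G W -> psi G W p -> exists k, normal_at W p k.
Proof.
move=> gW /psiP[x [-> xW ipx]]; have [M cM WM] := Gplus_chart S gW.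
by exists (Rev (nrml S M x)); rewrite WM; apply: nrml_normal_at; rewrite -?WM.
Qed.

Lemma Gplus_psi_inhabited W : Gplus G W -> exists p, psi G W p.
Proof.
move=> gW; have [M cM ->] := Gplus_chart S gW; exists (<[pt S M true (0%R : C)]>%VS).
by rewrite psi_chart //; apply/conicP; exists true, 0; rewrite normc0 ler01.
Qed.

(** A root orthogonal to [W] is orthogonal to every point of its conic and to the normal vector
    there, which puts that vector on a wall. *)
Lemma goodW_Tset W : Gplus G W -> goodW W -> Tset G (psi G W).
Proof.
move=> gW good; exists W => //; split=> // d Dd dW.
have [p pW] := Gplus_psi_inhabited gW; have [k nk] := normal_at_ex gW pW.
have [x [y [px xW ipx [yW _ _ _] kE]]] := nk.
have dp : orthp d p.
  by move=> z zp; apply: dW; move: zp; rewrite px => /vlineP[a ->]; exact: memvZ.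
have := good p k nk d Dd dp.
by rewrite kE (bformC _ _ GT) bform_Rev_r complexv_ext (dW _ yW) eqxx.
Qed.

Lemma real_space_decomp W x y v : Gplus G W -> conjs W = W -> x \in W -> isotropic_positive G x ->
  is_normal G W x y -> v \in W -> exists a b c, v = a *: x + b *: conjv x + c *: y.
Proof.
move=> gW rW xW [xx hx] [yW y1 y2 y3] vW.
have [M cM WM] := Gplus_chart S gW; have F1 := frame_orthonormal S cM.
have xcW : conjv x \in W by rewrite -rW memv_conjs conjvK.
have hx0 : B x (conjv x) != 0 by rewrite gt_eqF.
set h := B x (conjv x) in hx0.
have xcxc : B (conjv x) (conjv x) = 0 by rewrite bform_conjv xx conjc0.
have xcx : B (conjv x) x = h by rewrite (bformC _ _ GT).
(* The part of [v] orthogonal to [x] and [conjv x]. Like [y], it is a multiple of the cross product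
   of these two vectors. *)
pose v' := v - (B v (conjv x) / h) *: x - (B v x / h) *: conjv x.
have v'W : v' \in W by apply: memvB; [apply: memvB => //|]; exact: memvZ.
have v'x : B v' x = 0 by rewrite !bformBl !bformZl xx xcx mulr0 subr0 divfK // subrr.
have v'xc : B v' (conjv x) = 0 by rewrite !bformBl !bformZl xcxc mulr0 subr0 divfK // subrr.
have WF : W = gspace (frame S M) by rewrite gspace_frame.
have [c1 vE] := xprod_unique F1 (etrans (esym (congr1 (fun W => x \in W) WF)) xW) xx hx0
  (etrans (esym (congr1 (fun W => v' \in W) WF)) v'W) v'x v'xc.
have [c2 yE] := xprod_unique F1 (etrans (esym (congr1 (fun W => x \in W) WF)) xW) xx hx0
  (etrans (esym (congr1 (fun W => y \in W) WF)) yW) y1 y2.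
have c20 : c2 != 0 by apply: contraTneq y3 => c20; rewrite yE c20 scale0r bform0l ltxx.
exists (B v (conjv x) / h), (B v x / h), (c1 / c2).
rewrite yE scalerA divfK // -vE /v' addrC addrACA.
by rewrite subrK addNr addr0.
Qed.

Lemma Rev_normal W x y : Gplus G W -> conjs W = W -> is_normal G W x y ->
  is_normal G W x (complexv (Rev y)).
Proof.
move=> gW rW nxy; have [_ /= kk] := normal_cone S gW nxy; have [yW y1 y2 y3] := nxy.
have ycW : conjv y \in W by rewrite -rW memv_conjs conjvK.
have yc1 : B (conjv y) x = 0 by rewrite -[x]conjvK bform_conjv y2 conjc0.
have yc2 : B (conjv y) (conjv x) = 0 by rewrite bform_conjv y1 conjc0.
split.
- by rewrite complexv_Rev; apply: memvZ; exact: memvD.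
- by rewrite complexv_Rev bformZl bformDl y1 yc1 addr0 mulr0.
- by rewrite complexv_Rev bformZl bformDl y2 yc2 addr0 mulr0.
- by rewrite bform_complexv ltcR.
Qed.

Lemma bform_ext_conjv d x : B (ext C d) (conjv x) = (B (ext C d) x)^*.
Proof. by rewrite -complexv_ext -{1}conjv_complexv bform_conjv. Qed.

(** A real [W] is spanned by [x], its conjugate and the real vector [Rev y]; a root orthogonal to
    [x] and [Rev y] is therefore orthogonal to [W]. *)
Lemma real_goodW W : Gplus G W -> conjs W = W ->
  (forall d, Delta G d -> ~ (forall v, v \in W -> B (ext C d) v = 0)) -> goodW W.
Proof.
move=> gW rW Tw p k [x [y [-> xW ipx nxy ->]]] d Dd /orthp_line dx; apply/eqP => dk.
have nk := Rev_normal gW rW nxy.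
apply: (Tw d Dd) => v vW.
have [a [b [c ->]]] := real_space_decomp gW rW xW ipx nk vW.
rewrite !bformDr !bformZr bform_ext_conjv dx conjc0 -complexv_ext bform_complexv.
by rewrite (bformC _ _ GT) dk !mulr0 !addr0.
Qed.

Lemma tau_psi W : tau (psi G W) = psi G (conjs W).
Proof.
have sub W' : tau (psi G W') `<=` psi G (conjs W').
  move=> _ [_ /psiP[x [-> xW ipx]] <-]; apply/psiP; exists (conjv x); rewrite conjs_line; split; [by []| |].
    by rewrite memv_conjs conjvK.
  by rewrite /isotropic_positive conjvK bform_conjv ipx.1 conjc0 (bformC _ _ GT); split=> //; exact: ipx.2.
apply/seteqP; split; first exact: sub.
move=> p pW; exists (conjs p); last exact: conjsK.
by rewrite -[W]conjsK; apply: sub; exists p.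
Qed.

Lemma conjs_Gplus W : Gplus G W -> Gplus G (conjs W).
Proof.
move=> gW; have [M cM WM] := Gplus_chart S gW.
have cW : conjs W = gspace (map_mx (@conjc R) (chart S M)).
  apply/vspaceP => v; rewrite memv_conjs WM; apply/memv_gspaceP/memv_gspaceP => -[u e].
    by exists (map_mx (@conjc R) u); rewrite -map_mxM -e; rewrite -/(conjv _) conjvK.
  exists (map_mx (@conjc R) u); rewrite e /conjv map_mxM; congr (_ *m _).
  by apply/matrixP => i j; rewrite !mxE; exact: conjcK.
split.
  rewrite cW; apply: dim_gspace => u /(congr1 (map_mx (@conjc R))).
  rewrite map_mxM map_mx0; have -> : map_mx (@conjc R) (map_mx (@conjc R) (chart S M)) = chart S M.
    by apply/matrixP => i j; rewrite !mxE; exact: conjcK.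
  move=> e; have := upc_chart S M (map_mx (@conjc R) u); rewrite e /upc mulmx0 => /(congr1 (map_mx (@conjc R))).
  by rewrite map_mx0 => e'; apply/matrixP => i j; move/matrixP/(_ i j): e'; rewrite !mxE conjcK.
move=> v; rewrite memv_conjs => vW v0; rewrite (herm_gt0 S) -hsq_conjv -(herm_gt0 S).
by apply: gW.2 => //; rewrite conjv_eq0.
Qed.

Lemma TR_real C : TR G C -> exists W, [/\ Gplus G W, conjs W = W, C = psi G W &
  forall d, Delta G d -> ~ (forall v, v \in W -> B (ext R[i] d) v = 0)].
Proof.
move=> [[W [gW Tw] <-] tC]; exists W; split=> //.
by apply: psi_inj; [exact: conjs_Gplus| |rewrite -tau_psi].
Qed.

Lemma conjs_goodW W : goodW W -> goodW (conjs W).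
Proof.
move=> good p k [x [y [-> xW ipx [y1 y2 y3 y4] ->]]] d Dd /orthp_line dx.
rewrite -Rev_conjv; apply: (good <[conjv x]>%VS) => //.
  exists (conjv x), (conjv y); split; [by []|by rewrite -memv_conjs| | |by []].
  - by rewrite /isotropic_positive conjvK bform_conjv ipx.1 conjc0 (bformC _ _ GT); split=> //; exact: ipx.2.
  split; first by rewrite -memv_conjs.
  - by rewrite bform_conjv y2 conjc0.
  - by rewrite conjvK -[x]conjvK bform_conjv y3 conjc0.
  - by rewrite bform_conjv; move: y4; rewrite !ltcE; case: (B y y) => a b /= /andP[/eqP-> ->]; rewrite oppr0 eqxx.
by apply/orthp_line; rewrite bform_ext_conjv dx conjc0.
Qed.

End normal_vectors.

(** * Local finiteness of the roots *)

Section tube_lemma.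

Lemma tube (X : topologicalType) (K : set X) (I : Type) (F : set_system I) (FF : Filter F)
    (P : I -> X -> Prop) : compact K ->
  (forall x, K x -> filter_prod (nbhs x) F (fun q => P q.2 q.1)) ->
  F (fun i => forall x, K x -> P i x).
Proof. by move=> /compact_near_coveringP cK H; exact: (cK I F P FF H). Qed.

Variable R : realType.
Local Notation C := R[i].

(** Real and imaginary parts place the disc inside the compact square of pairs with entries in
    [[-1, 1]]. *)
Lemma tube_disc (I : Type) (F : set_system I) (FF : Filter F) (P : I -> C -> Prop) :
  (forall z : C, filter_prod (nbhs z) F (fun q => P q.2 q.1)) ->
  F (fun i => forall z : C, normc z <= 1 -> P i z).
Proof.
move=> H; pose cz (w : 'rV[R]_2) : C := w 0 0 +i* w 0 1.
have cK : compact [set w : 'rV[R]_2 | forall i, `[-1, 1]%classic (w 0 i)].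
  by apply: (@rV_compact R 2 (fun=> `[-1, 1]%classic)) => i; exact: segment_compact.
have := tube FF cK (P := fun i w => P i (cz w)).
have H' x : [set w : 'rV[R]_2 | forall i, `[-1, 1]%classic (w 0 i)] x ->
    filter_prod (nbhs x) F (fun q => P q.2 (cz q.1)).
  move=> _; have [[A B] /= [Ax FB] AB] := H (cz x).
  have cx : (fun w : 'rV[R]_2 => cz w) @ (nbhs x) --> cz x.
    by apply: cvg_ReIm => /=; apply: cvg_entry; exact: cvg_id.
  exists ([set w | A (cz w)], B); first by split=> //; exact: cx.
  by move=> [w i] /= [Aw Bi]; exact: (AB (cz w, i)).
move=> /(_ H'); apply: (@filterS _ F FF) => i Hi z z1.
have zE : z = cz (\row_j (if j == 0 then Re z else Im z)) by case: z {z1} => a b; rewrite /cz !mxE.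
rewrite zE; apply: Hi => j; rewrite mxE /= in_itv /=.
have h1 := le_trans (le_Re_normc z) z1; have h2 := le_trans (le_Im_normc z) z1.
by case: ifP => _; rewrite -ler_norml.
Qed.

Lemma mx_neq0_entry (K : nmodType) m n (A : 'M[K]_(m, n)) : A != 0 -> exists i j, A i j != 0.
Proof.
move=> A0; apply: contrapT => H; move/eqP: A0; apply; apply/matrixP => i j; rewrite mxE.
by apply/eqP/negPn/negP => Aij; apply: H; exists i, j.
Qed.

Lemma near_mx_neq0 (K : numFieldType) (T : Type) (F : set_system T) (FF : Filter F) m n
    (f : T -> 'M[K]_(m, n)) (a : 'M[K]_(m, n)) :
  a != 0 -> f @ F --> a -> F (fun t => f t != 0).
Proof.
move=> /mx_neq0_entry[i [j aij]] fa; have fij : (fun t => f t i j) @ F --> a i j by exact: cvg_entry.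
apply: (@filterS _ F FF _ _ _ (nbhs_neq0 FF aij fij)) => t; apply: contra => /eqP ->.
by rewrite mxE.
Qed.

Lemma near_lt (T : Type) (F : set_system T) (FF : Filter F) (f : T -> R) (a b : R) :
  a < b -> f @ F --> a -> F (fun t => f t < b).
Proof. by move=> ab fa; exact: (fa [set x | x < b] (open_nbhs_nbhs (conj (@open_lt R b) ab))). Qed.

Lemma near_gt (T : Type) (F : set_system T) (FF : Filter F) (f : T -> R) (a b : R) :
  b < a -> f @ F --> a -> F (fun t => b < f t).
Proof. by move=> ab fa; exact: (fa [set x | b < x] (open_nbhs_nbhs (conj (@open_gt R b) ab))). Qed.

End tube_lemma.

Lemma bform_ext (K : comNzRingType) (G : 'M[int]_22) (d d' : 'cV[int]_22) :
  bform G (ext K d) (ext K d') = (bform G d d')%:~R.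
Proof.
rewrite /bform; transitivity ((map_mx (intr : int -> K) (d^T *m ext int G *m d')) 0 0); last by rewrite mxE.
rewrite !map_mxM /ext matrix.map_trmx; congr ((_ *m _ *m _) 0 0).
by apply/matrixP => i j; rewrite !mxE intz.
Qed.

Section local_finiteness.
Variables (R : realType) (G : 'M[int]_22) (S : splitting R G).
Local Notation B := (bform G).
Local Notation perp Phi v := ((Phi : 'M[R]_(22, 3))^T *m ext R G *m v = 0).

(** The complement of a positive frame is negative definite; compactness makes this uniform near
    [Phi0]. By homogeneity it suffices to treat vectors whose largest coordinate, at some position
    [j], equals 1. *)
Lemma perp_frame_bound (Phi0 : 'M[R]_(22, 3)) : positive_frame G Phi0 ->
  exists2 c : R, 0 < c & nbhs Phi0 (fun Phi => forall v : 'cV[R]_22, perp Phi v ->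
    forall i, B v v <= - c * v i 0 ^+ 2).
Proof.
move=> pF.
pose A (j i : 'I_22) : set R := if i == j then [set 1] else `[-1, 1]%classic.
have cA j : compact [set w : 'rV[R]_22 | forall i, A j i (w 0 i)].
  apply: rV_compact => i; rewrite /A; case: ifP => _; first exact: compact_set1.
  exact: segment_compact.
(* The constant is a second parameter that tends to 0 beside the frame, so the tube lemma yields the
   neighborhood and the constant together. *)
pose P (q : 'M[R]_(22, 3) * R) (w : 'rV[R]_22) := perp q.1 w^T -> B w^T w^T < - q.2.
have H j : filter_prod (nbhs Phi0) (nbhs (0 : R)) (fun q =>
    forall w : 'rV[R]_22, (forall i, A j i (w 0 i)) -> P q w).
  apply: (tube _ (cA j)) => w Aw.
  set F := filter_prod _ _; have FF : Filter F by exact: filter_prod_filter.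
  have c1 : (fun q : 'rV[R]_22 * ('M[R]_(22, 3) * R) => q.1) @ F --> w by exact: cvg_fst.
  have c2 : (fun q : 'rV[R]_22 * ('M[R]_(22, 3) * R) => q.2.1) @ F --> Phi0.
    by apply: (cvg_comp snd fst (@cvg_snd _ _ _ _ _)); exact: cvg_fst.
  have c3 : (fun q : 'rV[R]_22 * ('M[R]_(22, 3) * R) => q.2.2) @ F --> (0 : R).
    by apply: (cvg_comp snd snd (@cvg_snd _ _ _ _ _)); exact: cvg_snd.
  have c1T : (fun q : 'rV[R]_22 * ('M[R]_(22, 3) * R) => q.1^T) @ F --> w^T by exact: cvg_trmx.
  have [p0|p0] := eqVneq (Phi0^T *m ext R G *m w^T) 0; last first.
    have cp : (fun q : 'rV[R]_22 * ('M[R]_(22, 3) * R) => q.2.1^T *m ext R G *m q.1^T) @ F -->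
        Phi0^T *m ext R G *m w^T.
      apply: cvg_mulmx; last exact: c1T.
      by apply: cvg_mulmx; [exact: cvg_trmx|exact: cvg_cst].
    apply: (@filterS _ F FF _ _ _ (near_mx_neq0 FF p0 cp)) => q q0 qp.
    by rewrite qp eqxx in q0.
  have w0 : w^T != 0.
    apply/eqP => /(congr1 trmx); rewrite trmxK trmx0 => w0; have := Aw j.
    by rewrite w0 mxE /A eqxx /= => /eqP; rewrite eq_sym oner_eq0.
  have neg := perp_frame_neg S pF p0 w0.
  have cq : (fun q : 'rV[R]_22 * ('M[R]_(22, 3) * R) => B q.1^T q.1^T + q.2.2) @ F --> B w^T w^T + 0.
    by apply: cvg_addf; [apply: cvg_bform; exact: c1T|exact: c3].
  have neg' : B w^T w^T + 0 < 0 by rewrite addr0.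
  apply: (@filterS _ F FF _ _ _ (near_lt FF neg' cq)) => q q0 _.
  by rewrite -subr_lt0 opprK.
have [[N1 N2] /= [N1P N20] N12] := @near_all_fin _ _ (filter_prod_filter _ _) _ _ H.
have [c c0 cN] : exists2 c : R, 0 < c & N2 c.
  move/nbhs_ballP: N20 => [e /= e0 eN]; exists (e / 2); first by rewrite divr_gt0.
  by apply: eN; rewrite /ball /= sub0r normrN gtr0_norm ?divr_gt0 // ltr_pdivrMr // ltr_pMr // ltr1n.
exists c => //; apply: filterS N1P => Phi NPhi v pv i.
have [j _ jmax] : exists2 j : 'I_22, true & forall i, `|v i 0| <= `|v j 0|.
  case: (@arg_maxP _ _ 'I_22 i xpredT (fun i => `|v i 0|) isT) => j _ jm.
  by exists j => // k; exact: jm.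
have [vj0|vj0] := eqVneq (v j 0) 0.
  have v0 : v = 0.
    apply/matrixP => k l; rewrite (ord1 l) mxE; apply/eqP; rewrite -normr_le0.
    by apply: le_trans (jmax k) _; rewrite vj0 normr0.
  by rewrite v0 bform0l mxE expr0n /= mulr0.
pose w := ((v j 0)^-1 *: v)^T.
have Aw : forall i, A j i (w 0 i).
  move=> k; rewrite /w !mxE /A; have [->|kj] := eqVneq k j; first by rewrite /= mulVf.
  rewrite /= in_itv /= -ler_norml normrM normfV mulrC ler_pdivrMr ?normr_gt0 //.
  by rewrite mul1r; exact: jmax.
have := N12 (Phi, c) (conj NPhi cN) j w Aw; rewrite /P /= /w trmxK.
rewrite -scalemxAr pv scaler0 bformZl bformZr mulrA -invfM -expr2 => /(_ erefl).
rewrite mulrC ltr_pdivrMr ?exprn_even_gt0 //= => /ltW h; apply: le_trans h _.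
rewrite !mulNr lerN2 ler_wpM2l ?(ltW c0) //.
by rewrite -(real_normK (num_real (v i 0))) -(real_normK (num_real (v j 0))) ler_sqr ?nnegrE.
Qed.

(** By [perp_frame_bound] a root orthogonal to a frame near [Phi0] has coordinates with
    [c * v_i^2 <= 2]. Only finitely many roots remain, and each of them fails to be orthogonal on a
    neighborhood of its own. *)
Lemma near_frame_not_perp (Phi0 : 'M[R]_(22, 3)) : positive_frame G Phi0 ->
  (forall d, Delta G d -> ~ perp Phi0 (ext R d)) ->
  nbhs Phi0 (fun Phi => forall d, Delta G d -> ~ perp Phi (ext R d)).
Proof.
move=> pF H; have [c c0 Hc] := perp_frame_bound pF.
(* For an integer coordinate [n] one has [|n| <= n^2 <= 2 / c < N]. Adding [N] to the coordinates
   encodes the box as functions into ['I_(N + N)], a finite type. *)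
pose N := Num.bound (2 / c).
have Nc : 2 / c < N%:R by apply: archi_boundP; rewrite divr_ge0 // ltW.
pose df (f : {ffun 'I_22 -> 'I_(N + N)}) : 'cV[int]_22 := \col_i ((f i)%:Z - N%:Z).
have Hf f : nbhs Phi0 (fun Phi : 'M[R]_(22, 3) => Delta G (df f) -> ~ perp Phi (ext R (df f))).
  have [Df|nDf] := pselect (Delta G (df f)); last first.
    by apply: (@filterS _ _ (nbhs_filter Phi0) setT); [move=> Phi _ /nDf|exact: filterT].
  have p0 : Phi0^T *m ext R G *m ext R (df f) != 0 by apply/eqP; exact: H.
  have cp : (fun Phi : 'M[R]_(22, 3) => Phi^T *m ext R G *m ext R (df f)) @ (nbhs Phi0) -->
      Phi0^T *m ext R G *m ext R (df f).
    apply: cvg_mulmx; last exact: cvg_cst.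
    by apply: cvg_mulmx; [apply: cvg_trmx; exact: cvg_id|exact: cvg_cst].
  apply: (@filterS _ _ (nbhs_filter Phi0) _ _ _ (near_mx_neq0 (nbhs_filter Phi0) p0 cp)) => Phi q0 _ e.
  by rewrite e eqxx in q0.
have Hall := @near_all_fin _ _ (nbhs_filter Phi0) _ _ Hf.
apply: (@filterS _ _ (nbhs_filter Phi0) _ _ _ (filterI Hc Hall)) => Phi [hc hall] d Dd pd.
pose di (i : 'I_22) : int := d i 0.
have dN i : (absz (di i) < N)%N.
  have := hc _ pd i; have -> : B (ext R d) (ext R d) = -2.
    by rewrite bform_ext Dd.
  rewrite mxE mulNr lerN2 mulrC -ler_pdivlMr // => le2.
  rewrite -(ltr_nat R); apply: le_lt_trans Nc; apply: le_trans le2.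
  rewrite -rmorphXn /= -[(absz (di i))%:R]/((absz (di i))%:Z%:~R) -/(di i) ler_int.
  rewrite -[X in _ <= X]real_normK ?num_real // -abszE expr2.
  by case: (absz _) => // n; rewrite -PoszM lez_nat leq_pmulr.
have fN i : (absz (di i + N%:Z)%R < N + N)%N by have := dN i; lia.
have dE : d = df [ffun i => Ordinal (fN i)].
  by apply/matrixP => i j; rewrite (ord1 j) mxE ffunE /= -/(di i); have := dN i; lia.
by move: Dd pd; rewrite dE; exact: hall.
Qed.

End local_finiteness.

(** * Openness of the good locus *)

Section good_open.
Variables (R : realType) (G : 'M[int]_22) (S : splitting R G).
Local Notation C := R[i].
Local Notation B := (bform G).
Let GT := gram_sym S.

Definition Phi (M : 'M[C]_(19, 3)) (b : bool) (z : C) : 'M[R]_(22, 3) :=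
  rfr (pt S M b z) (Rev (nrml S M (pt S M b z))).

Lemma pt_isotropic_positive M b z : contractive M -> isotropic_positive G (pt S M b z).
Proof.
move=> cM; split; first exact: pt_isotropic.
by have [_ H] := chart_Gplus S cM; apply: H; [exact: pt_mem|exact: pt_neq0].
Qed.

Lemma Phi_perp M b z (d : 'cV[int]_22) : (Phi M b z)^T *m ext R G *m ext R d = 0 <->
  B (ext C d) (pt S M b z) = 0 /\ B (Rev (nrml S M (pt S M b z))) (ext R d) = 0.
Proof.
set x := pt S M b z; set k := Rev _.
have e i : ((Phi M b z)^T *m ext R G *m ext R d) i 0 = B (col i (rfr x k)) (ext R d).
  by have := mxE_bform G (Phi M b z) (ext R d) i 0; rewrite col_id.
have [c0 c1 c2] := col_col3 (Rev x) (Imv x) k.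
have dx : B (ext C d) x = 0 <-> B (Rev x) (ext R d) = 0 /\ B (Imv x) (ext R d) = 0.
  by rewrite -complexv_ext bform_complexvl_eq0 !(bformC (ext R d) _ GT).
split=> [H|[/dx[h0 h1] h2]].
  have h i : B (col i (rfr x k)) (ext R d) = 0 by rewrite -e H mxE.
  by split; [apply/dx; split|]; [rewrite -c0|rewrite -c1|rewrite -c2]; exact: h.
apply/matrixP => i j; rewrite (ord1 j) e mxE /rfr.
by case: (ord3_cases i) => ->; rewrite ?c0 ?c1 ?c2.
Qed.

(** Passing to the representatives [pt S M b z] and to the explicit normal vector changes [x] and
    [k] by nonzero factors only, which do not affect orthogonality. Goodness becomes a condition
    over two closed discs. *)
Lemma goodW_Phi M : contractive M -> goodW G (gspace (chart S M)) <->
  forall b z, normc z <= 1 -> forall d, Delta G d -> ~ ((Phi M b z)^T *m ext R G *m ext R d = 0).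
Proof.
move=> cM; split=> [good b z z1 d Dd /Phi_perp[dx dk]|H p k [x [y [-> xW ipx nxy ->]]] d Dd /orthp_line dx].
  have nk := nrml_normal_at cM (pt_mem S cM b z) (pt_isotropic_positive b z cM).
  by have := good _ _ nk d Dd; rewrite dk eqxx => /(_ ((orthp_line _ _ _).2 dx)).
have [b [z [z1 [c c0 xE]]]] := pt_onto cM xW (isotropic_positive_neq0 ipx) ipx.1.
have dpt : B (ext C d) (pt S M b z) = 0.
  by apply/eqP; move/eqP: dx; rewrite xE bformZr mulf_eq0 (negPf c0).
have nk := nrml_normal_at cM (pt_mem S cM b z) (pt_isotropic_positive b z cM).
have nk' : normal_at G (gspace (chart S M)) <[pt S M b z]>%VS (Rev y).
  by exists x, y; split=> //; rewrite xE line_scale.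
have [a a0 ->] := normal_at_unique S (chart_Gplus S cM) nk nk'.
apply/negP => /eqP; rewrite bformZl => /eqP; rewrite mulf_eq0 (negPf a0) /= => /eqP e.
by apply: (H b z z1 d Dd); apply/Phi_perp.
Qed.

Lemma cvg_Phi M b z (T : Type) (F : set_system T) (FF : Filter F) (f : T -> 'M[C]_(19, 3)) (g : T -> C) :
  contractive M -> f @ F --> M -> g @ F --> z -> (fun t => Phi (f t) b (g t)) @ F --> Phi M b z.
Proof.
move=> cM fM gz.
have cx : (fun t => pt S (f t) b (g t)) @ F --> pt S M b z by exact: cvg_pt.
apply: cvg_col3; [exact: cvg_Remx|exact: cvg_Immx|apply: cvg_Remx; exact: cvg_nrml].
Qed.

Lemma Phi_positive M b z : contractive M -> positive_frame G (Phi M b z).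
Proof.
move=> cM; have ipx := pt_isotropic_positive b z cM.
apply: (rfr_positive S ipx); apply: (normal_at_cone S (chart_Gplus S cM)).
by apply: nrml_normal_at; [exact: cM|exact: pt_mem|exact: ipx].
Qed.

Lemma near_goodW M : contractive M -> goodW G (gspace (chart S M)) ->
  nbhs M (fun M' => contractive M' -> goodW G (gspace (chart S M'))).
Proof.
move=> cM /(goodW_Phi cM) good.
(* The bound on [z] appears twice: one copy belongs to the conclusion of [tube_disc], the other
   makes the local condition vacuous away from the disc, since that lemma asks for it at every
   complex number. *)
have H b : nbhs M (fun M' => forall z, normc z <= 1 -> normc z <= 1 ->
    forall d, Delta G d -> ~ ((Phi M' b z)^T *m ext R G *m ext R d = 0)).
  apply: (@tube_disc R _ (nbhs M) (nbhs_filter M)) => z.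
  set F := filter_prod _ _; have FF : Filter F by exact: filter_prod_filter.
  have [z1|z1] := leP (normc z) 1.
    have c1 : (fun q : C * 'M[C]_(19, 3) => q.1) @ F --> z by exact: cvg_fst.
    have c2 : (fun q : C * 'M[C]_(19, 3) => q.2) @ F --> M by exact: cvg_snd.
    have cP := @cvg_Phi M b z _ F FF _ _ cM c2 c1.
    have := near_frame_not_perp S (Phi_positive b z cM) (good b z z1).
    move=> /cP; apply: (@filterS _ F FF) => q h _; exact: h.
  have c1 : (fun q : C * 'M[C]_(19, 3) => normc q.1) @ F --> normc z.
    by apply: cvg_normc; exact: cvg_fst.
  apply: (@filterS _ F FF _ _ _ (near_gt FF z1 c1)) => q q1 q1'.
  by move: q1; rewrite ltNge q1'.
have Hall := @near_all_fin _ _ (nbhs_filter M) _ _ H.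
apply: (@filterS _ _ (nbhs_filter M) _ _ _ Hall) => M' h cM'.
by apply/(goodW_Phi cM') => b z z1; exact: h.
Qed.

End good_open.

(** * Connectedness of the real locus *)

Lemma finite_roots (F : idomainType) (q : {poly F}) : q != 0 -> finite_set [set t | root q t].
Proof.
have [n] := ubnP (size q); elim: n q => // n IH q qn q0.
have [[a qa]|nr] := pselect (exists a, root q a); last first.
  by rewrite (_ : mkset _ = set0) //; apply/seteqP; split=> // t qt; apply: nr; exists t.
have [q1 qE] := factor_theorem q a qa.
have q10 : q1 != 0 by apply: contra q0 => /eqP q10; rewrite qE q10 mul0r.
have sq1 : (size q1 < n)%N.
  by move: qn; rewrite qE size_Mmonic ?monicXsubC // size_XsubC addn2 ltnS.
apply: (@sub_finite_set _ _ ([set t | root q1 t] `|` [set a])).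
  by move=> t /=; rewrite qE rootM root_XsubC => /orP[?|/eqP->]; [left|right].
by rewrite finite_setU; split; [exact: IH|exact: finite_set1].
Qed.

Lemma unit_interval_not_countable (R : realType) (A : set R) : countable A ->
  exists t, 0 < t < 1 /\ ~ A t.
Proof.
move=> cA; apply: contrapT => H.
have sub : `]0, 1[%classic `<=` A.
  by move=> t; rewrite /= in_itv /= => t01; apply: contrapT => nA; apply: H; exists t.
have /countable_lebesgue_measure0 : countable (`]0, 1[%classic : set R).
  by apply: sub_countable cA; exact: subset_card_le.
by rewrite lebesgue_measure_itv /= lte_fin ltr01 -EFinB subr0 => /eqP; rewrite eqe oner_eq0.
Qed.

Lemma sum_ord3 (K : nmodType) (f : 'I_3 -> K) : \sum_i f i = f 0 + f 1 + f 2.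
Proof.
rewrite !big_ord_recl big_ord0 addr0 addrA.
by congr (f _ + f _ + f _); apply: val_inj.
Qed.

Lemma within_self (T : Type) (F : set_system T) (FF : Filter F) (D P : set T) :
  (forall x, D x -> P x) -> within D F P.
Proof. by move=> DP; apply: (@filterS _ F FF setT) => [x _|]; [exact: DP|exact: filterT]. Qed.

Section real_charts.
Variables (R : realType) (G : 'M[int]_22) (S : splitting R G).
Local Notation C := R[i].
Local Notation B := (bform G).
Local Notation rc := (map_mx (real_complex R)).

(* [Ld d M = 0] says that the real three-space with chart [M] is orthogonal
   to [d]. *)
Definition Ld (d : 'cV[int]_22) (M : 'M[R]_(19, 3)) : 'rV[R]_3 :=
  (up S *m ext R d)^T - (dn S *m ext R d)^T *m M.

Lemma bform_ext_chart d (M : 'M[R]_(19, 3)) (u : 'cV[C]_3) :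
  B (ext C d) (chart S (rc M) *m u) = (rc (Ld d M) *m u) 0 0.
Proof.
rewrite (bform_updn S) upc_chart dnc_chart /upc /dnc -complexv_ext /complexv -!map_mxM.
rewrite !matrix.map_trmx mulmxA -map_mxM /Ld map_mxB mulmxBl.
by rewrite [RHS]mxE; congr (_ + _); rewrite [RHS]mxE.
Qed.

Lemma perp_Ld d (M : 'M[R]_(19, 3)) :
  (forall v, v \in gspace (chart S (rc M)) -> B (ext C d) v = 0) <-> Ld d M = 0.
Proof.
split=> [H|L0 v /memv_gspaceP[u ->]]; last by rewrite bform_ext_chart L0 map_mx0 mul0mx mxE.
apply/matrixP => i j; rewrite (ord1 i) [RHS]mxE.
have := H _ (memv_gspace _ (delta_mx j 0)); rewrite bform_ext_chart -colE mxE mxE.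
by move=> [].
Qed.

Lemma conjs_chart (M : 'M[C]_(19, 3)) :
  conjs (gspace (chart S M)) = gspace (chart S (map_mx (@conjc R) M)).
Proof.
have cE : map_mx (@conjc R) (chart S M) = chart S (map_mx (@conjc R) M).
  have rE m n (A : 'M[R]_(m, n)) : map_mx (@conjc R) (rc A) = rc A.
    by apply/matrixP => i j; rewrite !mxE /= oppr0.
  by rewrite /chart map_mxD map_mxM !rE.
have conjK n (u : 'cV[C]_n) : map_mx (@conjc R) (map_mx (@conjc R) u) = u.
  by apply/matrixP => i j; rewrite !mxE; exact: conjcK.
apply/vspaceP => v; rewrite memv_conjs -cE; apply/memv_gspaceP/memv_gspaceP => -[u e];
  exists (map_mx (@conjc R) u).
- by rewrite -map_mxM -e [RHS]conjvK.
- by rewrite e /conjv map_mxM; congr (_ *m _); apply/matrixP => i j; rewrite !mxE; exact: conjcK.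
Qed.

Definition TRm (M : 'M[R]_(19, 3)) : Prop :=
  contractive (rc M) /\ forall d, Delta G d -> Ld d M != 0.

Lemma TR_chart C0 : TR G C0 <-> exists2 M, TRm M & C0 = Cc S (rc M).
Proof.
split=> [/(TR_real S)[W [gW rW -> Tw]]|[M [cM Lm] ->]].
  have [M cM WM] := Gplus_chart S gW.
  have Mr : map_mx (@conjc R) M = M.
    by apply: (gspace_chart_inj (S := S)); rewrite -conjs_chart -WM rW.
  have ME : M = rc (map_mx (@Re R) M).
    apply/matrixP => i j; move/matrixP/(_ i j): Mr; rewrite !mxE.
    by case: (M i j) => a b [/eqP]; rewrite eq_sym -addr_eq0 -mulr2n mulrn_eq0 /= => /eqP ->.
  exists (map_mx (@Re R) M); last by rewrite -ME WM psi_chart.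
  split=> [|d Dd]; first by rewrite -ME.
  by apply/eqP => /perp_Ld; rewrite -ME -WM; exact: Tw.
have gW := chart_Gplus S cM.
have rW : conjs (gspace (chart S (rc M))) = gspace (chart S (rc M)).
  rewrite conjs_chart; congr (gspace (chart S _)).
  by apply/matrixP => i j; rewrite !mxE /= oppr0.
rewrite -psi_chart //; split; last by rewrite (tau_psi S) rW.
exists (gspace (chart S (rc M))) => //; split=> // d Dd /perp_Ld L0.
by have := Lm d Dd; rewrite L0 eqxx.
Qed.

Lemma TR_Cc_good M : TRm M -> goodW G (gspace (chart S (rc M))).
Proof.
move=> [cM Lm]; apply: (real_goodW S (chart_Gplus S cM)).
  rewrite conjs_chart; congr (gspace (chart S _)).
  by apply/matrixP => i j; rewrite !mxE /= oppr0.
by move=> d Dd /perp_Ld L0; have := Lm d Dd; rewrite L0 eqxx.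
Qed.

(** The constant is [57 = 3 * 19]: each of the 19 coordinates of the image has squared modulus at
    most [3 e^2] times that of [u]. *)
Lemma small_contractive (M : 'M[R]_(19, 3)) (e : R) : 57 * e ^+ 2 < 1 ->
  (forall i j, `|M i j| <= e) -> contractive (rc M).
Proof.
move=> e1 Me u u0.
have sq (a b c x y z : R) : `|a| <= e -> `|b| <= e -> `|c| <= e ->
    (a * x + b * y + c * z) ^+ 2 <= 3 * e ^+ 2 * (x ^+ 2 + y ^+ 2 + z ^+ 2).
  move=> ha hb hc.
  have sqe t : `|t| <= e -> t ^+ 2 <= e ^+ 2.
    move=> te; rewrite -(real_normK (num_real t)) ler_sqr ?nnegrE //.
    exact: le_trans (normr_ge0 _) te.
  have h1 := ler_wpM2r (sqr_ge0 x) (sqe a ha); have h2 := ler_wpM2r (sqr_ge0 y) (sqe b hb).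
  have h3 := ler_wpM2r (sqr_ge0 z) (sqe c hc).
  have g1 := sqr_ge0 (a * x - b * y); have g2 := sqr_ge0 (a * x - c * z); have g3 := sqr_ge0 (b * y - c * z).
  nra.
have row i : Re ((rc M *m u) i 0) ^+ 2 + Im ((rc M *m u) i 0) ^+ 2 <= 3 * e ^+ 2 * nsq u.
  rewrite mxE !sum_ord3 !mxE /nsq sum_ord3.
  move: (Me i 0) (Me i 1) (Me i 2); move: (M i 0) (M i 1) (M i 2) => a b c ha hb hc.
  move: (u 0 0) (u 1 0) (u 2 0) => [x0 y0] [x1 y1] [x2 y2] /=; rewrite !mul0r !subr0 !addr0.
  by have := sq _ _ _ x0 x1 x2 ha hb hc; have := sq _ _ _ y0 y1 y2 ha hb hc; lra.
have le : nsq (rc M *m u) <= \sum_(i < 19) 3 * e ^+ 2 * nsq u by apply: ler_sum => i _; exact: row.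
apply: le_lt_trans le _; rewrite sumr_const card_ord.
have n0 := nsq_gt0 u0; have -> : 3 * e ^+ 2 * nsq u *+ 19 = 57 * e ^+ 2 * nsq u by ring.
by rewrite gtr_pMl.
Qed.

(** A moment curve: the 57 entries carry the distinct powers [t, ..., t^57], so terms from different
    entries cannot cancel and none of them is constant. The factor [57^-1] makes the matrix small
    enough for [small_contractive]. *)
Definition Pt (t : R) : 'M[R]_(19, 3) := \matrix_(i, j) (57^-1 * t ^+ (3 * i + j).+1).

Lemma Pt_contractive t : 0 < t < 1 -> contractive (rc (Pt t)).
Proof.
move=> /andP[t0 t1]; apply: (@small_contractive _ 57^-1).
  by rewrite expr2 mulrA divff ?mul1r ?invf_lt1 ?ltr0n ?ltr1n // pnatr_eq0.
move=> i j; rewrite mxE normrM gtr0_norm ?invr_gt0 ?ltr0n // ger0_norm ?exprn_ge0 ?(ltW t0) //.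
by rewrite ler_piMr ?invr_ge0 ?ler0n // exprn_ile1 ?(ltW t0) ?(ltW t1).
Qed.

Lemma Delta_dn d : Delta G d -> dn S *m ext R d != 0.
Proof.
move=> Dd; apply/eqP => d0; have := bformR_rsq S (ext R d).
rewrite d0; have -> : rsq (0 : 'cV[R]_19) = 0 by apply: big1 => i _; rewrite mxE expr0n.
rewrite subr0 bform_ext Dd => e; have := rsq_ge0 (up S *m ext R d).
by rewrite -e ler0z.
Qed.

Lemma Ld_convex d A M s : Ld d ((1 - s) *: A + s *: M) = (1 - s) *: Ld d A + s *: Ld d M.
Proof.
rewrite /Ld mulmxDr -!scalemxAr !scalerBr addrACA -opprD -scalerDl subrK.
by rewrite scale1r.
Qed.

Definition bad (A : 'M[R]_(19, 3)) (d : 'cV[int]_22) (t : R) : Prop :=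
  exists2 s : R, 0 <= s <= 1 & Ld d ((1 - s) *: A + s *: Pt t) = 0.

(* A bad parameter makes [Ld d (Pt t)] proportional to [Ld d A], so it is a
   root of a 2 x 2 minor, which is a nonzero polynomial in [t]. *)
Lemma finite_bad A d : Delta G d -> Ld d A != 0 -> finite_set (bad A d).
Proof.
move=> Dd /mx_neq0_entry[i0 [j]]; rewrite (ord1 i0) {i0} => aj.
have [i1 [i2]] := mx_neq0_entry (Delta_dn Dd); rewrite (ord1 i2) {i2} => ni.
set a := Ld d A in aj; pose k : 'I_3 := if j == 0 then 1 else 0.
have kj : k != j by rewrite /k; case: (ord3_cases j) => ->.
set u := (up S *m ext R d)^T; set n := dn S *m ext R d in ni.
pose q : {poly R} := (a 0 j * u 0 k - a 0 k * u 0 j)%:P -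
  \sum_(i < 19) (57^-1 * n i 0) *: (a 0 j *: 'X^((3 * i + k).+1) - a 0 k *: 'X^((3 * i + j).+1)).
have LP t l : Ld d (Pt t) 0 l = u 0 l - \sum_(i < 19) n i 0 * (57^-1 * t ^+ (3 * i + l).+1).
  have -> : Ld d (Pt t) 0 l = u 0 l + (- (n^T *m Pt t)) 0 l by rewrite /Ld mxE.
  rewrite [(- _ : 'rV[R]_3) 0 l]mxE [(_ *m _) _ _]mxE; congr (_ - _); apply: eq_bigr => i _.
  by rewrite [Pt t _ _]mxE; congr (_ * _); rewrite mxE.
have qE t : q.[t] = a 0 j * Ld d (Pt t) 0 k - a 0 k * Ld d (Pt t) 0 j.
  rewrite !LP /q hornerD hornerN hornerC horner_sum !mulrBr !mulr_sumr.
  have -> : \sum_(i < 19) ((57^-1 * n i 0) *: (a 0 j *: 'X^((3 * i + k).+1) - a 0 k *: 'X^((3 * i + j).+1))).[t] =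
      \sum_(i < 19) (a 0 j * (n i 0 * (57^-1 * t ^+ (3 * i + k).+1))) -
      \sum_(i < 19) (a 0 k * (n i 0 * (57^-1 * t ^+ (3 * i + j).+1))).
    rewrite -sumrB; apply: eq_bigr => i _; rewrite hornerZ hornerD hornerN !hornerZ !hornerXn.
    by move: (t ^+ _) (t ^+ _) => p1 p2; ring.
  by ring.
(* The coefficient of degree [3 i1 + k + 1] is [- 57^-1 * n i1 0 * a 0 j], since no other exponent
   in the sum equals this one and the constant term of [q] has degree 0. *)
have q0 : q != 0.
  apply: contraNneq (mulf_neq0 aj ni) => q0; have := congr1 (fun p : {poly R} => p`_(3 * i1 + k).+1) q0.
  rewrite coef0 /q coefB coefC /= sub0r coef_sum (bigD1 i1) //= big1 ?addr0; last first.
    move=> i ii1; rewrite coefZ coefB !coefZ !coefXn !eqSS.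
    have l3 (l : 'I_3) : (l < 3)%N by exact: ltn_ord.
    have := l3 k; have := l3 j; move: (nat_of_ord k) (nat_of_ord j) => k' j' hj hk.
    have ii : (i != i1 :> nat) by [].
    have -> : (3 * i1 + k' == 3 * i + k')%N = false by lia.
    have -> : (3 * i1 + k' == 3 * i + j')%N = false by lia.
    by rewrite !mulr0 subr0 mulr0.
  rewrite coefZ coefB !coefZ !coefXn eqxx eqSS eqn_add2l.
  have -> : ((k : nat) == j) = false by exact: negbTE.
  rewrite mulr0 subr0 mulr1 => h.
  have {}h : 57^-1 * n i1 0 * a 0 j = 0 by apply/eqP; rewrite -oppr_eq0 h.
  have -> : a 0 j * n i1 0 = 57 * (57^-1 * n i1 0 * a 0 j) by rewrite -mulrA mulrA divff ?mul1r 1?mulrC // pnatr_eq0.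
  by rewrite h mulr0.
apply: sub_finite_set (finite_roots q0) => t [s /andP[s0 s1]]; rewrite Ld_convex => /matrixP e.
rewrite /root /= /root qE; apply/eqP.
have gen (c : R) (X Y : 'rV[R]_3) : c *: X + s *: Y =2 (0 : 'rV[R]_3) -> forall l, c * X 0 l + s * Y 0 l = 0.
  by move=> h l; have := h 0 l; rewrite !mxE.
have ej := gen _ _ _ e j; have ek := gen _ _ _ e k.
have sn0 : s != 0.
  by apply: contraNneq aj => s00; move: ej; rewrite s00 subr0 mul1r mul0r addr0 => ->.
apply: (mulfI sn0); rewrite mulr0.
have ej' : s * Ld d (Pt t) 0 j = - ((1 - s) * a 0 j) by apply/eqP; rewrite -addr_eq0 addrC ej.
have ek' : s * Ld d (Pt t) 0 k = - ((1 - s) * a 0 k) by apply/eqP; rewrite -addr_eq0 addrC ek.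
have -> : s * (a 0 j * Ld d (Pt t) 0 k - a 0 k * Ld d (Pt t) 0 j) =
   a 0 j * (s * Ld d (Pt t) 0 k) - a 0 k * (s * Ld d (Pt t) 0 j) by ring.
by rewrite ej' ek'; ring.
Qed.

Lemma common_good A A' : TRm A -> TRm A' ->
  exists P, forall s : R, 0 <= s <= 1 -> TRm ((1 - s) *: A + s *: P) /\ TRm ((1 - s) *: A' + s *: P).
Proof.
move=> [cA LA] [cA' LA'].
have cb : countable (\bigcup_(d in Delta G) (bad A d `|` bad A' d)).
  apply: bigcup_countable; first exact: countableP.
  move=> d Dd; apply: finite_set_countable; rewrite finite_setU.
  by split; apply: finite_bad => //; [exact: LA|exact: LA'].
have [t [t01 nt]] := unit_interval_not_countable cb.
exists (Pt t) => s s01.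
have rcE (A0 : 'M[R]_(19, 3)) : rc ((1 - s) *: A0 + s *: Pt t) = (1 - s)%:C *: rc A0 + s%:C *: rc (Pt t).
  by rewrite map_mxD !map_mxZ.
split; split.
- by rewrite rcE; exact: (contractive_convex cA (Pt_contractive t01) s01).
- by move=> d Dd; apply/eqP => e; apply: nt; exists d => //; left; exists s.
- by rewrite rcE; exact: (contractive_convex cA' (Pt_contractive t01) s01).
- by move=> d Dd; apply/eqP => e; apply: nt; exists d => //; right; exists s.
Qed.

Lemma connected_TR : connected (@TR R G).
Proof.
have seg A P : (forall s : R, 0 <= s <= 1 -> TRm ((1 - s) *: A + s *: P)) ->
    connected_component (@TR R G) (Cc S (rc A)) (Cc S (rc P)).
  move=> H; pose f (s : R) := (1 - s) *: A + s *: P.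
  have f0 : f 0 = A by rewrite /f subr0 scale1r scale0r addr0.
  have f1 : f 1 = P by rewrite /f subrr scale1r scale0r add0r.
  rewrite -f0 -f1; apply: (@component_path _ _ _ (fun s => Cc S (rc (f s)))) => s s01; last first.
    by apply/TR_chart; exists (f s) => //; exact: H.
  have FF : Filter (within `[0, 1] (nbhs s)) by exact: within_filter.
  apply: cvg_Cc.
  - exact: (H s s01).1.
  - by apply: within_self => s'; rewrite /= in_itv /= => s'01; exact: (H s' s'01).1.
  apply: cvg_within_filter; apply: cvg_map_mx; first by move=> g b gb; exact: cvg_real_complex.
  apply: (@cvg_addmx _ (nbhs s)).
    apply: (@cvg_scalemx _ (nbhs s) _ _ _ _ (fun s => 1 - s) (fun=> A)); last exact: cvg_cst.
    by apply: (@cvg_subf _ (nbhs s)); [exact: cvg_cst|exact: cvg_id].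
  by apply: (@cvg_scalemx _ (nbhs s) _ _ _ _ id (fun=> P)); [exact: cvg_id|exact: cvg_cst].
have conn C0 C1 : TR G C0 -> TR G C1 -> connected_component (@TR R G) C0 C1.
  move=> /TR_chart[A TA ->] /TR_chart[A' TA' ->].
  have [P HP] := common_good TA TA'.
  apply: (@connected_component_trans _ _ (Cc S (rc P))); first by apply: seg => s /HP[].
  by apply: connected_component_sym; apply: seg => s /HP[].
have [[C0 T0]|nT] := pselect (exists C0 : conicsp R, TR G C0); last first.
  rewrite (_ : @TR R G = set0); first exact: connected0.
  by apply/seteqP; split=> // C0 T0; apply: nT; exists C0.
rewrite (_ : @TR R G = connected_component (@TR R G) C0); first exact: component_connected.
by apply/seteqP; split=> [C1 T1|]; [exact: conn|exact: connected_component_sub].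
Qed.

End real_charts.

(** * Orientations and isometries *)

Section complex_segments.
Variable R : realType.
Local Notation C := R[i].

Lemma cvg_segmx m n (A A' : 'M[C]_(m, n)) (s : R) :
  (fun t : R => (1 - t)%:C *: A + t%:C *: A') @ nbhs s --> (1 - s)%:C *: A + s%:C *: A'.
Proof.
apply: cvg_addmx.
  apply: (@cvg_scalemx _ (nbhs s) _ _ _ _ (fun t : R => (1 - t)%:C) (fun=> A)); last exact: cvg_cst.
  apply: (@cvg_real_complex _ _ (nbhs s) _ (fun t : R => 1 - t)).
  by apply: (@cvg_subf _ (nbhs s) _ _ (fun=> 1) id); [exact: cvg_cst|exact: cvg_id].
apply: (@cvg_scalemx _ (nbhs s) _ _ _ _ (fun t : R => t%:C) (fun=> A')); last exact: cvg_cst.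
by apply: (@cvg_real_complex _ _ (nbhs s) _ id); exact: cvg_id.
Qed.

Lemma cvg_segf (a a' : C) (s : R) :
  (fun t : R => (1 - t)%:C * a + t%:C * a') @ nbhs s --> (1 - s)%:C * a + s%:C * a'.
Proof.
apply: cvg_addf.
  apply: (@cvg_mulf _ (nbhs s) _ _ (fun t : R => (1 - t)%:C) (fun=> a)); last exact: cvg_cst.
  apply: (@cvg_real_complex _ _ (nbhs s) _ (fun t : R => 1 - t)).
  by apply: (@cvg_subf _ (nbhs s) _ _ (fun=> 1) id); [exact: cvg_cst|exact: cvg_id].
apply: (@cvg_mulf _ (nbhs s) _ _ (fun t : R => t%:C) (fun=> a')); last exact: cvg_cst.
by apply: (@cvg_real_complex _ _ (nbhs s) _ id); exact: cvg_id.
Qed.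

End complex_segments.

Section cauchy_schwarz.
Variable R : realType.
Local Notation C := R[i].

Lemma mulcJ (c : C) : c * c^* = (Re c ^+ 2 + Im c ^+ 2)%:C.
Proof. by case: c => a b; apply/eqP; rewrite eq_complex /=; apply/andP; split; apply/eqP; ring. Qed.

Lemma nsqZ n (a : C) (v : 'cV[C]_n) : nsq (a *: v) = (Re a ^+ 2 + Im a ^+ 2) * nsq v.
Proof.
rewrite /nsq mulr_sumr; apply: eq_bigr => k _; rewrite mxE.
by case: a (v k 0) => [x y] [z t] /=; ring.
Qed.

Lemma dot_comb (K : comPzRingType) n (u w u' w' : 'cV[K]_n) (a c a' c' : K) :
  ((a *: w - c *: u)^T *m (a' *: w' - c' *: u')) 0 0 =
  a * a' * (w^T *m w') 0 0 - a * c' * (w^T *m u') 0 0 - c * a' * (u^T *m w') 0 0 +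
  c * c' * (u^T *m u') 0 0.
Proof.
rewrite !mxE !mulr_sumr -!sumrB -big_split; apply: eq_bigr => k _.
by rewrite !mxE /=; ring.
Qed.

(** This is the expansion of [0 <= nsq (nsq u *: w - c *: u)]. Keeping the factor [nsq u] on both
    sides avoids a division. *)
Lemma cauchy_schwarz n (u w : 'cV[C]_n) (c : C) : c = (w^T *m map_mx (@conjc R) u) 0 0 ->
  nsq u * (Re c ^+ 2 + Im c ^+ 2) <= nsq u ^+ 2 * nsq w.
Proof.
move=> cE; set cj := map_mx (@conjc R) in cE *; set al := (nsq u)%:C.
have uw : (u^T *m cj w) 0 0 = c^*.
  by rewrite cE !mxE rmorph_sum; apply: eq_bigr => k _; rewrite !mxE rmorphM /= conjcK mulrC.
have E : (nsq (al *: w - c *: u))%:C = al ^+ 2 * (nsq w)%:C - al * (c * c^*).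
  rewrite -[LHS]nsqE raddfB /= mulmxBl.
  have -> : map_mx (@conjc R) (al *: w - c *: u) = al *: cj w - c^* *: cj u.
    by apply/matrixP => i j; rewrite !mxE rmorphB !rmorphM /= oppr0.
  have ww := nsqE w; have uu := nsqE u; rewrite -/cj in ww uu.
  rewrite -mulmxBl -raddfB dot_comb -cE uw ww uu -/al.
  by ring.
have h := nsq_ge0 (al *: w - c *: u).
rewrite -subr_ge0; move: E; rewrite mulcJ /al -!rmorphXn -!rmorphM -rmorphB /= => -[<-].
exact: h.
Qed.

End cauchy_schwarz.

Section orientation.
Variables (R : realType) (G : 'M[int]_22) (S : splitting R G).
Local Notation C := R[i].
Local Notation B := (bform G).
Let GT := gram_sym S.

Lemma locally_constant (T : topologicalType) (A : set T) (P : T -> Prop) : connected A ->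
  (forall x, A x -> within A (nbhs x) (fun y => P y <-> P x)) ->
  forall x y, A x -> A y -> P x <-> P y.
Proof.
move=> cA lP; pose f x : R := if `[< P x >] then 1 else -1.
have fP x : 0 < f x <-> P x.
  by rewrite /f; case: asboolP => Px; split=> // h; exfalso; move: h; rewrite oppr_gt0 ltr10.
have f0 x : f x != 0 by rewrite /f; case: ifP; rewrite ?oppr_eq0 oner_eq0.
have cf : {within A, continuous f}.
  apply/subspace_continuousP => x Ax.
  have FF : Filter (within A (nbhs x)) by exact: within_filter.
  apply: cvg_trans (@cvg_cst _ (f x) _ (within A (nbhs x)) FF); apply: near_eq_cvg.
  apply: (@filterS _ _ FF _ _ _ (lP x Ax)) => y e.
  by rewrite /f; congr (if _ then _ else _); apply: asbool_equiv_eq; split; apply e.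
by move=> x y Ax Ay; split=> /fP p; apply/fP;
  [apply: (connected_sign cA cf _ Ax Ay p)|apply: (connected_sign cA cf _ Ay Ax p)] => z _; exact: f0.
Qed.

(** A kernel vector would produce a positive vector in the span of [F] orthogonal to the span of
    [E]. *)
Lemma det_frames_neq0 (E F : 'M[R]_(22, 3)) : positive_frame G E -> positive_frame G F ->
  \det (E^T *m ext R G *m F) != 0.
Proof.
move=> pE pF; rewrite -unitfE -unitmxE; apply: unitmx_kernel => v Ev.
apply/eqP; apply/negP => /negP v0; have p := pF v v0.
have Fv0 : F *m v != 0 by apply: contraTneq p => ->; rewrite bform0l ltxx.
have EFv : E^T *m ext R G *m (F *m v) = 0 by rewrite mulmxA.
by have := perp_frame_neg S pE EFv Fv0; rewrite ltNge ltW.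
Qed.

Lemma det_rfr_self x k : isotropic_positive G x -> positive_cone G (<[x]>%VS : projsp R) k ->
  0 < \det ((rfr x k)^T *m ext R G *m rfr x k).
Proof.
move=> ipx /coneP[kr ki kk]; have [ri ii rr] := isotropic_positive_ReIm S ipx.
have -> : (rfr x k)^T *m ext R G *m rfr x k =
    diag_mx (vec3 (B (Rev x) (Rev x)) (B (Rev x) (Rev x)) (B k k))^T.
  apply/matrixP => i j; rewrite mxE_bform !mxE /rfr.
  have [c0 c1 c2] := col_col3 (Rev x) (Imv x) k.
  case: (ord3_cases i) => ->; case: (ord3_cases j) => -> /=; rewrite ?c0 ?c1 ?c2 ?ri ?kr ?ki ?ii //;
    by rewrite (bformC _ _ GT) ?ri ?kr ?ki.
rewrite det_diag !big_ord_recl big_ord0 mulr1 !mxE /=.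
by rewrite !mulr_gt0.
Qed.

Lemma cvg_det_rfr (Th : 'M[R]_(22, 3)) (T : Type) (F : set_system T) (FF : Filter F)
    (f : T -> 'cV[C]_22) (g : T -> 'cV[R]_22) x k : f @ F --> x -> g @ F --> k ->
  (fun t => \det (Th^T *m ext R G *m rfr (f t) (g t))) @ F --> \det (Th^T *m ext R G *m rfr x k).
Proof.
move=> fx gk; apply: cvg_det; apply: cvg_mulmx; first exact: cvg_cst.
by apply: cvg_col3; [exact: cvg_Remx|exact: cvg_Immx|exact: gk].
Qed.

Variable V : projsp R -> set 'cV[R]_22.
Hypothesis hV : continuous_component G V.

(** [Th] is a fixed reference frame. The component chosen by [V] is connected and the determinant
    does not vanish on it, so a single [k] decides ([oriented_one]). *)
Definition oriented (Th : 'M[R]_(22, 3)) (x : 'cV[C]_22) : Prop :=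
  forall k, V <[x]>%VS k -> 0 < \det (Th^T *m ext R G *m rfr x k).

Lemma oriented_one Th x k : positive_frame G Th -> isotropic_positive G x -> V <[x]>%VS k ->
  0 < \det (Th^T *m ext R G *m rfr x k) -> oriented Th x.
Proof.
move=> pT ipx Vk dk k' Vk'; have Op : Omega G (<[x]>%VS : projsp R) by exists x.
have [k0 c0 VE] := hV.1 _ Op.
have cV : connected (V <[x]>%VS) by rewrite VE; exact: component_connected.
apply: (@connected_sign R _ (V <[x]>%VS) (fun k1 => \det (Th^T *m ext R G *m rfr x k1)) k k' cV _ _ Vk Vk' dk).
  apply: continuous_subspaceT => k1; apply: (@cvg_det_rfr Th _ (nbhs k1) _ (fun=> x) id).
  - exact: cvg_cst.
  - exact: cvg_id.
move=> k1 /(V_cone hV Op) c1; apply: det_frames_neq0 => //; exact: rfr_positive.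
Qed.

(** Carries a vector of the cone at one point continuously into the cones at nearby points. No
    three-space [W] is involved, so it works along any path of isotropic vectors. *)
Definition proj_perp (k : 'cV[R]_22) (x : 'cV[C]_22) : 'cV[R]_22 :=
  k - (B k (Rev x) / B (Rev x) (Rev x)) *: Rev x - (B k (Imv x) / B (Rev x) (Rev x)) *: Imv x.

Lemma proj_perp_perp k x : isotropic_positive G x ->
  B (proj_perp k x) (Rev x) = 0 /\ B (proj_perp k x) (Imv x) = 0.
Proof.
move=> ipx; have [ri ii rr] := isotropic_positive_ReIm S ipx.
have r0 : B (Rev x) (Rev x) != 0 by rewrite gt_eqF.
rewrite !bformBl !bformZl (bformC (Imv x) (Rev x) GT) ri ii !mulr0 !subr0 !divfK //.
by rewrite !subrr.
Qed.

Lemma proj_perp_id k x : B k (Rev x) = 0 -> B k (Imv x) = 0 -> proj_perp k x = k.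
Proof. by move=> e1 e2; rewrite /proj_perp e1 e2 !mul0r !scale0r !subr0. Qed.

Lemma cvg_proj_perp k x (T : Type) (F : set_system T) (FF : Filter F) (f : T -> 'cV[C]_22) :
  isotropic_positive G x -> f @ F --> x -> (fun t => proj_perp k (f t)) @ F --> proj_perp k x.
Proof.
move=> ipx fx; have [ri ii rr] := isotropic_positive_ReIm S ipx.
have fr : (fun t => Rev (f t)) @ F --> Rev x by exact: cvg_Remx.
have fi : (fun t => Imv (f t)) @ F --> Imv x by exact: cvg_Immx.
have fn : (fun t => (B (Rev (f t)) (Rev (f t)))^-1) @ F --> (B (Rev x) (Rev x))^-1.
  by apply: cvg_invf; [rewrite gt_eqF|apply: cvg_bform; exact: fr].
apply: cvg_addmx; first apply: cvg_addmx; first exact: cvg_cst.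
- apply: cvg_oppmx; apply: cvg_scalemx; last exact: fr.
  by apply: cvg_mulf; [apply: cvg_bform; [exact: cvg_cst|exact: fr]|exact: fn].
- apply: cvg_oppmx; apply: cvg_scalemx; last exact: fi.
  by apply: cvg_mulf; [apply: cvg_bform; [exact: cvg_cst|exact: fi]|exact: fn].
Qed.

Lemma oriented_path Th (f : R -> 'cV[C]_22) : positive_frame G Th ->
  (forall s : R, 0 <= s <= 1 -> f @ (within `[0, 1] (nbhs s)) --> f s) ->
  (forall s : R, 0 <= s <= 1 -> isotropic_positive G (f s)) ->
  oriented Th (f 0) <-> oriented Th (f 1).
Proof.
move=> pT cf ipf; have c01 : connected (`[0, 1]%classic : set R) by exact: segment_connected.
have i0 : (`[0, 1]%classic : set R) 0 by rewrite /= in_itv /= lexx ler01.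
have i1 : (`[0, 1]%classic : set R) 1 by rewrite /= in_itv /= lexx ler01.
apply: (@locally_constant _ _ (fun s => oriented Th (f s)) c01 _ 0 1 i0 i1) => s; rewrite /= in_itv /= => s01.
have ipx := ipf s s01; set x := f s in ipx *.
have Op : Omega G (<[x]>%VS : projsp R) by exists x.
have [k Vk] := V_inhabited hV Op; have ck := V_cone hV Op Vk.
have /coneP[kr ki kk] := ck.
set F := within _ _; have FF : Filter F by exact: within_filter.
have fx : f @ F --> x := cf s s01.
have kx : (fun t => proj_perp k (f t)) @ F --> k.
  by have := @cvg_proj_perp k x _ F FF f ipx fx; rewrite proj_perp_id.
have px : (fun t => <[f t]>%VS : projsp R) @ F --> (<[x]>%VS : projsp R).
  by apply: cvg_line => //; exact: isotropic_positive_neq0 ipx.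
have nV : F (fun t => 0 <= t <= 1 -> V <[f t]>%VS (proj_perp k (f t))).
  have h1 := near_V hV Op Vk.
  have h2 : F (fun t => Omega G (<[f t]>%VS : projsp R) -> positive_cone G (<[f t]>%VS : projsp R) (proj_perp k (f t)) ->
      V <[f t]>%VS (proj_perp k (f t))).
    by pose proof (cvg_pair kx px) as H; pose proof (H _ h1) as H'; exact: H'.
  have h3 : F (fun t => 0 < B (proj_perp k (f t)) (proj_perp k (f t))).
    by apply: (near_gt FF kk); apply: cvg_bform; exact: kx.
  apply: (@filterS _ F FF _ _ _ (filterI h2 h3)) => t [h2t h3t] t01.
  have ipt := ipf t t01; apply: h2t; first by exists (f t).
  by apply/coneP; have [e1 e2] := proj_perp_perp k ipt.
have det_cvg := @cvg_det_rfr Th _ F FF f _ x k fx kx.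
have d0 : \det (Th^T *m ext R G *m rfr x k) != 0.
  by apply: det_frames_neq0 => //; exact: rfr_positive.
have t01F : F (fun t => 0 <= t <= 1).
  by apply: within_self => t; rewrite /= in_itv.
move: d0; rewrite neq_lt => /orP[d0|d0].
  have nd := near_lt FF d0 det_cvg.
  apply: (@filterS _ F FF _ _ _ (filterI nV (filterI nd t01F))) => t [hV' [dt t01]].
  split=> [h|h]; exfalso.
    by have := h _ (hV' t01); rewrite ltNge ltW.
  by have := h _ Vk; rewrite ltNge ltW.
have nd := near_gt FF d0 det_cvg.
apply: (@filterS _ F FF _ _ _ (filterI nV (filterI nd t01F))) => t [hV' [dt t01]].
split=> _; first by apply: (oriented_one pT ipx Vk).
by apply: (oriented_one pT (ipf t t01) (hV' t01)).
Qed.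

Lemma isotropic_positive_scale (a : C) x : a != 0 -> isotropic_positive G x -> isotropic_positive G (a *: x).
Proof.
move=> a0 [xx hx]; split; first by rewrite bformZl bformZr xx !mulr0.
rewrite conjvZ bformZl bformZr mulrA mulr_gt0 //.
by rewrite lt_neqAle mulcJ_ge0 andbT eq_sym mulf_neq0 // conjc_eq0.
Qed.

(** The segment from 1 to a factor that is not real avoids 0, so it gives a path of isotropic
    vectors. A real factor [a] is split into ['i] and [- 'i * a]. *)
Lemma oriented_scale Th x (a : C) : positive_frame G Th -> isotropic_positive G x -> a != 0 ->
  oriented Th x <-> oriented Th (a *: x).
Proof.
move=> pT.
have seg y (c : C) : isotropic_positive G y -> (forall s : R, 0 <= s <= 1 -> (1 - s)%:C + s%:C * c != 0) ->
    oriented Th y <-> oriented Th (c *: y).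
  move=> ipy H; have := @oriented_path Th (fun s => ((1 - s)%:C + s%:C * c) *: y) pT.
  rewrite subr0 mul0r addr0 scale1r subrr mul1r add0r; apply.
    move=> s _; apply: cvg_within_filter; rewrite scalerDl -scalerA.
    have := @cvg_segmx R _ _ y (c *: y) s; apply: cvg_trans; apply: near_eq_cvg; apply: nearW => s'.
    by rewrite scalerDl scalerA.
  by move=> s s01; apply: isotropic_positive_scale; [exact: H|exact: ipy].
have ok (c : C) : Im c != 0 -> forall s : R, 0 <= s <= 1 -> (1 - s)%:C + s%:C * c != 0.
  move=> c0 s s01; rewrite eq_complex negb_and /=; case: c c0 => u v /= v0.
  rewrite !mul0r subr0 addr0 add0r; have [->|s0] := eqVneq s 0; last by rewrite mulf_neq0 ?orbT.
  by rewrite subr0 mul0r addr0 oner_eq0.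
have im1 : Im ('i : C) != 0 by rewrite /= oner_eq0.
move=> ipx a0; have [ai|ai] := eqVneq (Im a) 0; last by apply: seg => //; exact: ok.
have e : a *: x = (- 'i * a) *: ('i *: x).
  by rewrite scalerA mulrAC mulNr i_i opprK mul1r.
rewrite e; apply: (iff_trans (B := oriented Th ('i *: x))); first by apply: seg => //; exact: ok.
apply: seg; first exact: (isotropic_positive_scale (im_neq0 (@i_i R)) ipx).
apply: ok; case: a a0 ai {e} => u v /= uv v0; rewrite v0 in uv *.
rewrite oppr0 mul0r add0r mulN1r oppr_eq0.
by move: uv; rewrite eq_complex /= eqxx andbT.
Qed.

(** Pairs of a contraction and a complex parameter form a convex set, which gives paths within each
    affine chart of the conics; the two charts are linked at [z = 1]. *)
Lemma oriented_pt Th M b (z : C) : positive_frame G Th -> contractive M ->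
  oriented Th (pt S M b z) <-> oriented Th (pt S 0 true 0).
Proof.
move=> pT cM.
have path A A' b' (z1 z2 : C) : contractive A -> contractive A' ->
    oriented Th (pt S A b' z1) <-> oriented Th (pt S A' b' z2).
  move=> cA cA'.
  pose fM (s : R) := (1 - s)%:C *: A + s%:C *: A'; pose fz (s : R) := (1 - s)%:C * z1 + s%:C * z2.
  have := @oriented_path Th (fun s => pt S (fM s) b' (fz s)) pT.
  have -> : fM 0 = A by rewrite /fM subr0 scale1r scale0r addr0.
  have -> : fM 1 = A' by rewrite /fM subrr scale1r scale0r add0r.
  have -> : fz 0 = z1 by rewrite /fz subr0 mul1r mul0r addr0.
  have -> : fz 1 = z2 by rewrite /fz subrr mul1r mul0r add0r.
  apply=> s s01; last by apply: pt_isotropic_positive; exact: contractive_convex.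
  apply: cvg_within_filter; apply: (@cvg_pt _ _ _ _ _ _ (nbhs s)).
  - exact: contractive_convex.
  - exact: cvg_segmx.
  - exact: cvg_segf.
have c0 := @contractive0 R.
case: b; first exact: path.
apply: (iff_trans (path _ 0 false z 1 cM c0)).
have -> : pt S 0 false 1 = pt S 0 true 1 by rewrite /pt /cvec !expr1n.
exact: path.
Qed.

(** Every vector with line in [Omega] lies in some member of [Gplus], so [oriented_pt] and
    [oriented_scale] reduce it to one base point. *)
Lemma oriented_const Th x x' : positive_frame G Th -> isotropic_positive G x ->
  isotropic_positive G x' -> oriented Th x <-> oriented Th x'.
Proof.
move=> pT.
suff H y : isotropic_positive G y -> oriented Th y <-> oriented Th (pt S 0 true 0).
  by move=> /H e /H e'; apply: (iff_trans e); apply: iff_sym.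
move=> ipy; have [M cM yM] : exists2 M, contractive M & y \in gspace (chart S M).
  have [yy hy] := ipy; rewrite (herm_gt0 S) /hsq subr_gt0 in hy.
  have u0 : nsq (upc S y) != 0 by rewrite gt_eqF // (le_lt_trans _ hy) // nsq_ge0.
  (* It sends [upc S y] to [dnc S y] and kills the Hermitian complement of [upc S y]. By
     Cauchy-Schwarz it is a contraction, because [y] has positive Hermitian square. *)
  pose M : 'M[C]_(19, 3) := ((nsq (upc S y))^-1)%:C *: (dnc S y *m (map_mx (@conjc R) (upc S y))^T).
  have My : M *m upc S y = dnc S y.
    rewrite /M -scalemxAl -mulmxA; have -> : (map_mx (@conjc R) (upc S y))^T *m upc S y = ((nsq (upc S y))%:C)%:M.
      apply/matrixP => i j; rewrite (ord1 i) (ord1 j) [RHS]mxE eqxx mulr1n -nsqE.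
      by rewrite !mxE; apply: eq_bigr => k _; rewrite !mxE mulrC.
    by rewrite mul_mx_scalar scalerA -rmorphM mulVf // scale1r.
  exists M; last first.
    apply/memv_gspaceP; exists (upc S y).
    by rewrite /chart mulmxDl -mulmxA My -updncE.
  move=> w w0; rewrite /M -scalemxAl -mulmxA.
  have -> : (map_mx (@conjc R) (upc S y))^T *m w = ((w^T *m map_mx (@conjc R) (upc S y)) 0 0)%:M.
    apply/matrixP => i j; rewrite (ord1 i) (ord1 j) [RHS]mxE eqxx mulr1n !mxE.
    by apply: eq_bigr => k _; rewrite !mxE mulrC.
  rewrite mul_mx_scalar !nsqZ /=.
  set c := (_ *m _) 0 0; have cs : nsq (upc S y) * (Re c ^+ 2 + Im c ^+ 2) <= nsq (upc S y) ^+ 2 * nsq w by exact: cauchy_schwarz.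
  have wp := nsq_gt0 w0; set a := nsq (upc S y) in u0 hy cs *; set d := nsq (dnc S y) in hy *.
  set m := Re c ^+ 2 + Im c ^+ 2 in cs *; have ap : 0 < a by rewrite lt_neqAle eq_sym u0 nsq_ge0.
  have dp : 0 <= d by exact: nsq_ge0.
  have m_le : m <= a * nsq w by rewrite -(ler_pM2l ap) mulrA -expr2.
  have -> : (a^-1 ^+ 2 + 0 ^+ 2) * (m * d) = m / a * (d / a) by field.
  have ma : m / a <= nsq w by rewrite ler_pdivrMr // mulrC.
  have da : d / a < 1 by rewrite ltr_pdivrMr // mul1r.
  apply: (le_lt_trans (y := nsq w * (d / a))); last by rewrite gtr_pMr.
  by rewrite ler_wpM2r // divr_ge0 // ltW.
have [b [z [_ [c c0 yE]]]] := pt_onto cM yM (isotropic_positive_neq0 ipy) ipy.1.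
apply: (iff_trans (B := oriented Th (pt S M b z))); last exact: oriented_pt.
rewrite yE; apply: iff_sym; exact: (oriented_scale pT (pt_isotropic_positive S b z cM) c0).
Qed.

End orientation.

(** * The action of the orthogonal group on cones, conics and roots *)

Section isometries.
Variables (R : realType) (G : 'M[int]_22) (S : splitting R G).
Local Notation C := R[i].
Local Notation VS := {vspace 'cV[C]_22}.
Let GT := gram_sym S.

Lemma Gamma_inv g : Gamma R G g -> Gamma R G (invmx g).
Proof.
move=> [gu gG gO]; have gv : g *m invmx g = 1%:M by exact: mulmxV.
have iG : (invmx g)^T *m G *m invmx g = G.
  by rewrite -{1}gG !mulmxA -trmx_mul gv trmx1 mul1mx -!mulmxA gv mulmx1.
split; [by rewrite unitmx_inv|exact: iG|move=> E pE].
set E' := ext R (invmx g) *m E.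
have pE' : positive_frame G E'.
  by move=> v v0; rewrite /E' -mulmxA bform_mulmx //; exact: pE.
have EE : ext R g *m E' = E by rewrite /E' mulmxA -ext_mul gv ext1 mul1mx.
have GR : (ext R G)^T = ext R G by rewrite /ext matrix.map_trmx GT.
have tr (A D : 'M[R]_(22, 3)) : (A^T *m ext R G *m D)^T = D^T *m ext R G *m A.
  by rewrite !trmx_mul trmxK GR mulmxA.
by have := gO _ pE'; rewrite EE -det_tr tr.
Qed.

Lemma act_line_line g x : act_line g (<[x]>%VS : projsp R) = <[ext C g *m x]>%VS.
Proof. by rewrite /act_line limg_line lfunE. Qed.

Section action.
Variable g : 'M[int]_22.
Hypothesis gG : Gamma R G g.

Let gu : g \in unitmx. Proof. by have [] := gG. Qed.
Let gI : g^T *m G *m g = G. Proof. by have [] := gG. Qed.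

Lemma ext_actK (K : pzRingType) : cancel (mulmx (ext K g) : 'cV[K]_22 -> 'cV[K]_22) (mulmx (ext K (invmx g))).
Proof. by move=> x; rewrite mulmxA -ext_mul mulVmx // ext1 mul1mx. Qed.

Lemma ext_actKV (K : pzRingType) : cancel (mulmx (ext K (invmx g)) : 'cV[K]_22 -> 'cV[K]_22) (mulmx (ext K g)).
Proof. by move=> x; rewrite mulmxA -ext_mul mulmxV // ext1 mul1mx. Qed.

Lemma mem_act_line (W : VS) x : (ext C g *m x \in (act_line g W : VS)) = (x \in W).
Proof.
apply/idP/idP => [/memv_imgP[y yW]|xW].
  by rewrite lfunE => /(can_inj (@ext_actK C)) ->.
by apply/memv_imgP; exists x => //; rewrite lfunE.
Qed.

Lemma mem_act_lineV (W : VS) x : (x \in (act_line g W : VS)) = (ext C (invmx g) *m x \in W).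
Proof. by rewrite -[in LHS](ext_actKV x) mem_act_line. Qed.

Lemma Gplus_act (W : VS) : Gplus G W -> Gplus G (act_line g W : VS).
Proof.
move=> [dW pW]; split.
  apply: etrans dW; apply: limg_dim_eq; apply/eqP; rewrite -subv0; apply/subvP => v.
  rewrite memv_cap memv_ker lfunE => /andP[_ /eqP gv]; rewrite memv0.
  by rewrite -(ext_actK v) /= gv mulmx0.
move=> v; rewrite mem_act_lineV => vW v0.
rewrite -(ext_actKV v) conjv_mulmx_ext bform_mulmx //; apply: pW => //.
by apply: contra_neq v0 => e; rewrite -(ext_actKV v) e mulmx0.
Qed.

Lemma isotropic_positive_act x : isotropic_positive G x -> isotropic_positive G (ext C g *m x).
Proof. by move=> [xx hx]; split; rewrite ?conjv_mulmx_ext bform_mulmx. Qed.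

Lemma isotropic_positive_actV x : isotropic_positive G (ext C g *m x) -> isotropic_positive G x.
Proof. by rewrite /isotropic_positive conjv_mulmx_ext !bform_mulmx. Qed.

Lemma act_conic_psi (W : VS) : act_conic g (psi G W) = psi G (act_line g W : VS).
Proof.
apply/seteqP; split=> [_ [p /psiP[x [-> xW ipx]] <-]|p /psiP[x [-> xW ipx]]].
  apply/psiP; exists (ext C g *m x); split; first exact: act_line_line.
  - by rewrite mem_act_line.
  - exact: isotropic_positive_act.
exists (<[ext C (invmx g) *m x]>%VS : projsp R); last by rewrite act_line_line ext_actKV.
apply/psiP; exists (ext C (invmx g) *m x); split; [reflexivity|by rewrite -mem_act_lineV|].
by apply: isotropic_positive_actV; rewrite ext_actKV.
Qed.

Lemma normal_at_act (W : VS) p k : normal_at G W p k ->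
  normal_at G (act_line g W : VS) (act_line g p) (ext R g *m k).
Proof.
move=> [x [y [-> xW ipx [yW yx yxc yy] ->]]]; exists (ext C g *m x), (ext C g *m y); split.
- exact: act_line_line.
- by rewrite mem_act_line.
- exact: isotropic_positive_act.
- by split; rewrite ?conjv_mulmx_ext ?bform_mulmx // mem_act_line.
- by rewrite Rev_mulmx_ext.
Qed.

Lemma bform_ext_act (K : comNzRingType) (x : 'cV[K]_22) d :
  bform G (ext K g *m x) (ext K d) = bform G x (ext K (invmx g *m d)).
Proof. by rewrite ext_mul -(@bform_mulmx _ G g x _ gI) ext_actKV. Qed.

Lemma Delta_actV d : Delta G d -> Delta G (invmx g *m d).
Proof.
rewrite /Delta /= => <-; have iG := Gamma_inv gG.
have [_ iI _] := iG; have := @bform_mulmx int G (invmx g) d d iI.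
by have ei (M : 'M[int]_22) : ext int M = M; [apply/matrixP => i j; rewrite mxE intz|rewrite ei].
Qed.

Lemma orthp_actV d (p : projsp R) : orthp G d (act_line g p) -> orthp G (invmx g *m d) p.
Proof.
move=> dp x xp; rewrite (bformC _ _ GT) -bform_ext_act (bformC _ _ GT); apply: dp.
by rewrite mem_act_line.
Qed.

Lemma goodW_act (W : VS) : goodW G W -> goodW G (act_line g W : VS).
Proof.
move=> gW p k [x [y [-> xW ipx [yW yx yxc yy] ->]]] d Dd dp.
rewrite -(ext_actKV y) Rev_mulmx_ext bform_ext_act.
have ix : isotropic_positive G (ext C (invmx g) *m x) by apply: isotropic_positive_actV; rewrite ext_actKV.
apply: (gW (<[ext C (invmx g) *m x]>%VS : projsp R)); last 2 first.
- exact: Delta_actV.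
- by apply: orthp_actV; rewrite act_line_line ext_actKV.
exists (ext C (invmx g) *m x), (ext C (invmx g) *m y); split=> //; first by rewrite -mem_act_lineV.
have [_ iI _] := Gamma_inv gG.
by split; rewrite ?conjv_mulmx_ext ?bform_mulmx // -mem_act_lineV.
Qed.

Lemma conjs_act (W : VS) : conjs (act_line g W : VS) = (act_line g (conjs W) : VS).
Proof.
apply/vspaceP => x; rewrite memv_conjs !mem_act_lineV memv_conjs.
by rewrite conjv_mulmx_ext.
Qed.

Lemma TR_act (D : conicsp R) : TR G D -> TR G (act_conic g D).
Proof.
move=> TD; have [W [gW rW DE dW]] := TR_real S TD; rewrite DE act_conic_psi.
have gW' := Gplus_act gW.
have rW' : conjs (act_line g W : VS) = (act_line g W : VS) by rewrite conjs_act rW.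
split; last by rewrite (tau_psi S) rW'.
apply: (goodW_Tset S gW'); apply: goodW_act; exact: (real_goodW S gW rW dW).
Qed.

Variable V : projsp R -> set 'cV[R]_22.
Hypothesis hV : continuous_component G V.

Lemma positive_cone_act p k : positive_cone G p k -> positive_cone G (act_line g p) (ext R g *m k).
Proof.
move=> [kp kk]; split; last by rewrite bform_mulmx.
by move=> x; rewrite mem_act_lineV -(ext_actKV x) complexv_mulmx_ext bform_mulmx // ext_actKV => /kp.
Qed.

(* If g k were in the opposite component, the frames rfr (g x) (- g k) and
   g (rfr x k) would have opposite orientations. *)
Lemma V_act p k : Omega G p -> V p k -> V (act_line g p) (ext R g *m k).
Proof.
move=> Op Vk; have ck := V_cone hV Op Vk; have cgk := positive_cone_act ck.
have /OmegaP[x px ipx] := Op; rewrite px in Op Vk ck cgk *.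
have Ogx : Omega G (act_line g (<[x]>%VS : projsp R)).
  by rewrite act_line_line; exists (ext C g *m x); [reflexivity|exact: isotropic_positive_act].
have [//|] := V_or_opp S hV Ogx cgk; rewrite act_line_line => Vn; exfalso.
have pT := rfr_positive S ipx ck; have gpT := isotropic_positive_act ipx.
have o1 : oriented G V (rfr x k) x by apply: (oriented_one S hV pT ipx Vk); exact: det_rfr_self.
have o2 : oriented G V (rfr x k) (ext C g *m x) by apply/(oriented_const S hV pT ipx gpT).
have := o2 _ Vn.
have -> : rfr (ext C g *m x) (- (ext R g *m k)) = ext R g *m rfr x k *m diag_mx (\row_j (-1) ^+ (j == 2 :> nat)).
  rewrite /rfr Rev_mulmx_ext Imv_mulmx_ext; apply/matrixP => i j; rewrite mul_mx_diag !mxE.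
  case: (ord3_cases j) => -> /=; rewrite ?expr0 ?expr1 ?mulr1 ?mulrN1.
  - by apply: eq_bigr => l _; rewrite [col3 _ _ _ l _]mxE.
  - by apply: eq_bigr => l _; rewrite [col3 _ _ _ l _]mxE.
  - by congr (- _); apply: eq_bigr => l _; rewrite [col3 _ _ _ l _]mxE.
rewrite mulmxA det_mulmx det_diag; have [_ _ gO] := gG.
rewrite pmulr_rgt0; last by have := gO _ pT; rewrite !mulmxA.
by rewrite !big_ord_recl big_ord0 !mxE /= !mul1r mulr1 ltr0N1.
Qed.

Lemma Vcirc_act p k : Omega G p -> Vcirc G V p k -> Vcirc G V (act_line g p) (ext R g *m k).
Proof.
move=> Op [Vk dk]; split; first exact: V_act.
move=> d Dd dp; rewrite bform_ext_act; apply: dk; first exact: Delta_actV.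
exact: orthp_actV.
Qed.

End action.

End isometries.

(** * The neighborhood *)

Section good_conics.
Variables (R : realType) (G : 'M[int]_22) (S : splitting R G).
Local Notation C := R[i].
Local Notation VS := {vspace 'cV[C]_22}.

Definition goodC : set (conicsp R) :=
  [set D | exists W, [/\ Gplus G W, D = psi G W & goodW G W]].

(** The union over all real conics spares the choice of a base point and covers the case of an empty
    [TR]; [TRnbhdE] identifies it with a single component. *)
Definition TRnbhd : set (conicsp R) :=
  \bigcup_(D in @TR R G) connected_component goodC D.

Lemma goodC_chart D : goodC D ->
  exists M, [/\ contractive M, D = Cc S M & goodW G (gspace (chart S M))].
Proof.
move=> [W [gW -> good]]; have [M cM WM] := Gplus_chart S gW.
by exists M; rewrite -WM; split=> //; rewrite WM psi_chart.
Qed.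

Lemma goodC_Cc M : contractive M -> goodW G (gspace (chart S M)) -> goodC (Cc S M).
Proof. by move=> cM good; exists (gspace (chart S M)); rewrite psi_chart //; split=> //; exact: chart_Gplus. Qed.

Lemma near_goodC M (N : set 'M[C]_(19, 3)) : contractive M -> nbhs M N ->
  nbhs (Cc S M : conicsp R) (fun D : conicsp R => goodC D ->
    exists M', [/\ contractive M', D = Cc S M' & N M']).
Proof.
move=> cM /(near_Cc S cM)[Q [oQ QM QP]].
have : nbhs (Cc S M : conicsp R) Q by apply: open_nbhs_nbhs; split.
apply: filterS => D QD /goodC_chart[M' [cM' DE _]]; exists M'; split; [exact: cM'|exact: DE|].
by apply: QP; [exact: cM'|rewrite -DE].
Qed.

Lemma goodC_C1 D : goodC D -> C1 G D.
Proof. by move=> /goodC_chart[M [cM -> _]]; exact: Cc_C1. Qed.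

Lemma TR_goodC : @TR R G `<=` goodC.
Proof.
by move=> D /(TR_chart S)[M TM ->]; apply: goodC_Cc; [exact: TM.1|exact: TR_Cc_good].
Qed.

Lemma TRnbhd_goodC : TRnbhd `<=` goodC.
Proof. by move=> D [D0 _]; exact: connected_component_sub. Qed.

Lemma TR_TRnbhd : @TR R G `<=` TRnbhd.
Proof. by move=> D TD; exists D => //; apply: connected_component_refl; exact: TR_goodC. Qed.

Lemma TRnbhdE D0 : TR G D0 -> TRnbhd = connected_component goodC D0.
Proof.
move=> T0; apply/seteqP; split=> [D [D1 T1]|D cD]; last by exists D0.
have -> // : connected_component goodC D1 = connected_component goodC D0.
apply: same_connected_component; exists (@TR R G) => //.
by split=> //; [exact: TR_goodC|exact: (connected_TR S)].
Qed.

Lemma connected_TRnbhd : connected TRnbhd.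
Proof.
have [[D TD]|] := pselect (exists D : conicsp R, TR G D).
  by rewrite (TRnbhdE TD); exact: component_connected.
move=> H; have -> : TRnbhd = set0.
  by apply/seteqP; split=> // D [D0 T0 _]; apply: H; exists D0.
exact: connected0.
Qed.

(** Such an [f] maps connected sets of good conics that meet [TR] to sets of the same kind. Its
    continuity on good conics is checked in charts, where it is given by [h]. It is applied to [tau]
    and to isometries. *)
Lemma TRnbhd_stable (f : conicsp R -> conicsp R) (h : 'M[C]_(19, 3) -> 'M[C]_(19, 3)) :
  {homo f : D / goodC D} -> {homo f : D / TR G D} ->
  (forall M, contractive M -> contractive (h M) /\ f (Cc S M) = Cc S (h M)) ->
  (forall M, contractive M -> h @ nbhs M --> h M) ->
  {homo f : D / TRnbhd D}.
Proof.
move=> fg ft fh ch D [D0 T0 [A [A0 AG cA] AD]]; exists (f D0); first exact: ft.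
exists [set f D | D in A]; last by exists D.
split; [by exists D0|by move=> _ [D' /AG/fg ? <-]|].
apply: connected_continuous_connected => //.
apply/subspace_continuousP => E /AG/goodC_chart[M [cM EM _]] N NE; have [hM fM] := fh M cM; rewrite EM in NE *.
have NM : nbhs (Cc S (h M) : conicsp R) N by rewrite -fM.
have FF : Filter (within (@contractive R) (nbhs M)) by exact: within_filter.
have H : within (@contractive R) (nbhs M) (fun M' => N (Cc S (h M'))).
  have hc : h @ within (@contractive R) (nbhs M) --> h M by apply: cvg_within_filter; exact: ch.
  by apply: (cvg_Cc FF hM _ hc) => //; apply: within_self => M' c'; exact: (fh M' c').1.
have H' : nbhs M (fun M' => contractive M' -> N (Cc S (h M'))) by exact: H.
have := near_goodC cM H'; apply: filterS => D' sub /AG/sub[M' [cM' -> NM']].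
by change (N (f (Cc S M'))); have [_ ->] := fh M' cM'; exact: NM'.
Qed.

Lemma tau_Cc M : contractive M -> contractive (map_mx (@conjc R) M) /\
  tau (Cc S M) = Cc S (map_mx (@conjc R) M).
Proof.
move=> cM; have gW := chart_Gplus S cM.
have cM' : contractive (map_mx (@conjc R) M).
  by apply: (Gplus_contractive (S := S)); rewrite -conjs_chart; exact: conjs_Gplus.
by split=> //; rewrite -!psi_chart // (tau_psi S) conjs_chart.
Qed.

Lemma TRnbhd_tau D : TRnbhd D -> TRnbhd (tau D).
Proof.
apply: (TRnbhd_stable (h := map_mx (@conjc R))) D => [D [W [gW -> good]]|D TD|M cM|M cM].
- exists (conjs W); split; [exact: (conjs_Gplus S)|exact: (tau_psi S)|exact: (conjs_goodW S)].
- by have [_ ->] := TD.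
- exact: tau_Cc.
- apply: (@cvg_map_mx _ (nbhs M) _ _ _ _ _ (@conjc R) id) => [g b|]; [exact: cvg_conjc|exact: cvg_id].
Qed.

Section isometry.
Variable g : 'M[int]_22.
Hypothesis gG : Gamma R G g.

Let gch (M : 'M[C]_(19, 3)) := chart_of S (ext C g *m chart S M).

Lemma act_conic_Cc M : contractive M ->
  [/\ upm S (ext C g *m chart S M) \in unitmx, contractive (gch M) & act_conic g (Cc S M) = Cc S (gch M)].
Proof.
move=> cM; have gW := Gplus_act gG (chart_Gplus S cM).
have gE : (act_line g (gspace (chart S M)) : VS) = gspace (ext C g *m chart S M).
  apply/vspaceP => v; rewrite (mem_act_lineV gG); apply/memv_gspaceP/memv_gspaceP => -[u e]; exists u.
    by rewrite -mulmxA -e (ext_actKV gG).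
  by rewrite e -mulmxA (ext_actK gG).
have [M' cM' E] := Gplus_chart S gW.
have inj (u : 'cV[C]_3) : ext C g *m chart S M *m u = 0 -> u = 0.
  rewrite -mulmxA => /(congr1 (mulmx (ext C (invmx g)))); rewrite (ext_actK gG) mulmx0 => e.
  by have := upc_chart S M u; rewrite e /upc mulmx0.
have [u e] := chart_of_gspace (etrans (esym gE) E) inj.
by rewrite /gch e -!psi_chart // act_conic_psi // E.
Qed.

Lemma TRnbhd_act D : TRnbhd D -> TRnbhd (act_conic g D).
Proof.
apply: (TRnbhd_stable (h := gch)) D => [D [W [gW -> good]]|D|M cM|M cM].
- exists (act_line g W : VS); split; [exact: Gplus_act|exact: act_conic_psi|exact: (goodW_act S)].
- exact: (TR_act S gG).
- by have [_ cM' E] := act_conic_Cc cM.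
have [uM _ _] := act_conic_Cc cM.
apply: (cvg_chart_of (nbhs_filter M) uM); apply: (@cvg_mulmx _ (nbhs M)); first exact: cvg_cst.
by apply: (@cvg_chart _ _ _ _ (nbhs M)); exact: cvg_id.
Qed.

End isometry.

(** The good locus is locally path connected: by [near_goodW] the contractions in some ball around
    the chart of [D] are good, and segments of contractions join them to the center. *)
Lemma TRnbhd_near D : TRnbhd D -> exists Q : set (conicsp R),
  [/\ open Q, Q D & Tset G `&` Q `<=` TRnbhd].
Proof.
move=> UD; have [M [cM DE good]] := goodC_chart (TRnbhd_goodC UD); subst D.
have := near_goodW cM good; rewrite -nbhs_ballE => -[e e0 Me].
have /(near_Cc S cM)[Q [oQ QM QP]] : nbhs M (ball M e) by exact: nbhsx_ballx.
exists Q; split; [exact: oQ|exact: QM|] => _ [[W [gW _] <-] QW].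
have [M' cM' WM] := Gplus_chart S gW.
have E : psi G W = Cc S M' by rewrite WM; exact: psi_chart.
rewrite E in QW *.
have M'e := QP M' cM' QW.
have [D0 T0 c0] := UD; exists D0; first exact: T0.
rewrite (same_connected_component c0).
pose f (s : R) := (1 - s)%:C *: M + s%:C *: M'.
have fc (s : R) : 0 <= s <= 1 -> contractive (f s) by exact: contractive_convex.
have <- : f 0 = M by rewrite /f subr0 scale1r scale0r addr0.
have <- : f 1 = M' by rewrite /f subrr scale1r scale0r add0r.
apply: (@component_path R _ goodC (fun s => Cc S (f s))) => s s01.
  set F := within _ _; have FF : Filter F by exact: within_filter.
  apply: (cvg_Cc FF (fc s s01)); last by apply: cvg_within_filter; exact: cvg_segmx.
  by apply: within_self => t; rewrite /= in_itv; exact: fc.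
apply: goodC_Cc; first exact: fc.
apply: Me; last exact: fc.
have [_ M'e'] := M'e; split=> [|i j]; first exact: e0.
have h : `|M i j - M' i j| < e := M'e' i j.
change (`|M i j - f s i j| < e); rewrite !mxE.
have -> : M i j - ((1 - s)%:C * M i j + s%:C * M' i j) = s%:C * (M i j - M' i j).
  by rewrite rmorphB rmorph1; ring.
rewrite normrM; have [s0 s1] := andP s01; apply: le_lt_trans h.
have s0' : 0 <= s%:C by rewrite lecR.
have s1' : s%:C <= 1 by rewrite -[1]/(1%:C) lecR.
by rewrite (ger0_norm s0') ler_piMl.
Qed.

Lemma TRnbhd_relatively_open : exists2 Q : set (conicsp R), open Q & TRnbhd = Tset G `&` Q.
Proof.
exists (\bigcup_(Q in [set Q : set (conicsp R) | open Q /\ Tset G `&` Q `<=` TRnbhd]) Q).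
  by apply: bigcup_open => Q [].
apply/seteqP; split=> [D UD|D [TD [Q [_ QU] QD]]]; last exact: QU.
split; last by have [Q [oQ QD QU]] := TRnbhd_near UD; exists Q.
by have [W [gW -> good]] := TRnbhd_goodC UD; exact: (goodW_Tset S).
Qed.

End good_conics.

(** * The section *)

Section canonical_section.
Variables (R : realType) (G : 'M[int]_22) (S : splitting R G).
Local Notation C := R[i].
Local Notation B := (bform G).
Local Notation VS := {vspace 'cV[C]_22}.
Local Notation goodC := (@goodC R G).
Variable V : projsp R -> set 'cV[R]_22.
Hypothesis hV : continuous_component G V.

(* The positive vectors of W orthogonal to x and its conjugate form a line;
   k is the real part of such a vector, with the sign fixed by V. *)
Definition Kap (z : conicsp R * projsp R) (k : 'cV[R]_22) : Prop :=
  V z.2 k /\ exists W, [/\ Gplus G W, z.1 = psi G W & normal_at G W z.2 k].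

(** The arbitrary choice made by [xget] is harmless: candidates differ by positive factors
    ([Kap_unique]), which preserve the class. At the points of good conics a candidate exists, so
    the default [0] does not occur there. *)
Definition sect (z : conicsp R * projsp R) : conicsp R * tOmegasp G V :=
  (z.1, kappa_class G V (xget 0 (Kap z), z.2)).

Lemma Kap_Omega z k : Kap z k -> Omega G z.2.
Proof. by move=> [_ [W [_ _ /normal_at_Omega]]]. Qed.

Lemma Kap_sign W p k : Gplus G W -> normal_at G W p k ->
  Kap (psi G W, p) k \/ Kap (psi G W, p) (- k).
Proof.
move=> gW nk; have ck := normal_at_cone S gW nk.
by have [Vk|Vk] := V_or_opp S hV (normal_at_Omega nk) ck; [left|right]; split=> //;
  exists W; split=> //; exact: normal_at_opp.
Qed.

Lemma Kap_ex z : goodC z.1 -> z.1 z.2 -> exists k, Kap z k.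
Proof.
case: z => D p /= [W [gW -> _]] Dp; have [k nk] := normal_at_ex S gW Dp.
by have [K|K] := Kap_sign gW nk; [exists k|exists (- k)].
Qed.

Lemma Kap_unique z k k' : Kap z k -> Kap z k' -> exists2 a : R, 0 < a & k' = a *: k.
Proof.
move=> [Vk [W [gW zW nk]]] [Vk' [W' [gW' zW' nk']]].
have Op := normal_at_Omega nk.
have E : W' = W by apply: (psi_inj S gW' gW); rewrite -zW -zW'.
rewrite E in nk'; have [a a0 kE] := normal_at_unique S gW nk nk'.
exists a => //; rewrite lt_neqAle eq_sym a0 /= leNgt; apply/negP => an.
apply: (V_not_opp S hV Op Vk).
have -> : - k = (- a)^-1 *: k' by rewrite kE scalerA invrN mulNr mulVf // scaleN1r.
by apply: (V_scale S hV Op) => //; rewrite invr_gt0 oppr_gt0.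
Qed.

Lemma Kap_Vcirc z k : goodC z.1 -> Kap z k -> Vcirc G V z.2 k.
Proof.
move=> [W [gW zW good]] [Vk [W' [gW' zW' nk]]]; split; first exact: Vk.
have E : W' = W by apply: (psi_inj S gW' gW); rewrite -zW -zW'.
by rewrite E in nk; exact: good nk.
Qed.

Lemma sectE z k : goodC z.1 -> Kap z k -> sect z = (z.1, kappa_class G V (k, z.2)).
Proof.
move=> gz Kk; have Op := Kap_Omega Kk; congr pair.
have [a a0 ->] := Kap_unique Kk (@xgetPex _ (0 : 'cV[R]_22) (Kap z) (ex_intro _ k Kk)).
by apply: (kappa_class_scale S hV Op a0); exact: Kap_Vcirc.
Qed.

Lemma sect_tuniv z : goodC z.1 -> z.1 z.2 -> tuniv (sect z) /\ q1 (sect z) = z.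
Proof.
move=> gz zz; have [k Kk] := Kap_ex gz zz; rewrite (sectE gz Kk).
split; last by rewrite /q1 /=; case: z {gz zz Kk}.
split; [exact: (goodC_C1 S gz)| |exact: zz].
by exists (k, z.2) => //; split; [exact: Kap_Omega Kk|exact: Kap_Vcirc].
Qed.

(** The isometry carries normal vectors to normal vectors and, by [V_act], respects the chosen
    components; acting as a homeomorphism with [Vcirc] mapped onto [Vcirc], it takes chambers to
    chambers. *)
Lemma sect_invariant g z : Gamma R G g -> goodC z.1 -> z.1 z.2 ->
  goodC (act_conic (invmx g) z.1) -> act_section g sect z = sect z.
Proof.
case: z => D p /= gG gD Dp gD'; have hG := Gamma_inv S gG.
have lineK (W : VS) : (act_line g (act_line (invmx g) W : VS) : VS) = W.
  apply/vspaceP => v; rewrite (mem_act_lineV gG); exact: (mem_act_line hG W v).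
have D'p' : act_conic (invmx g) D (act_line (invmx g) p) by exists p.
have [k Kk] := @Kap_ex (act_conic (invmx g) D, act_line (invmx g) p) gD' D'p'.
have [Vk [W [gW DW nk]]] := Kk; simpl in Vk, DW, nk.
have Op' := normal_at_Omega nk.
have DE : D = psi G (act_line g W : VS).
  have [W0 [gW0 DE _]] := gD; rewrite DE in DW *.
  move: DW; rewrite (act_conic_psi hG) => /(psi_inj S (Gplus_act hG gW0) gW) <-.
  by rewrite lineK.
have ngk : normal_at G (act_line g W : VS) p (ext R g *m k).
  by rewrite -[p](lineK p); exact: normal_at_act.
have Kgk : Kap (D, p) (ext R g *m k).
  split; last by exists (act_line g W : VS); split; [exact: Gplus_act|exact: DE|exact: ngk].
  by rewrite /= -[X in V X](lineK p); exact: (V_act S gG hV Op' Vk).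
have sD := @sectE (D, p) _ gD Kgk.
have sD' := @sectE (act_conic (invmx g) D, act_line (invmx g) p) _ gD' Kk.
rewrite sD /act_section /act_univ /= sD' /act_tuniv /=.
have -> : act_conic g (act_conic (invmx g) D) = D by rewrite DW act_conic_psi.
congr pair; rewrite /kappa_class /= lineK; congr pair.
have cg (h : 'M[int]_22) : continuous (fun k : 'cV[R]_22 => ext R h *m k).
  by move=> k1; apply: (@cvg_mulmx _ (nbhs k1)); [exact: cvg_cst|exact: cvg_id].
rewrite (connected_component_img _ _ (cg g) (cg (invmx g)) (ext_actK gG (K := R)) (ext_actKV gG (K := R))).
congr (connected_component _ _); apply/seteqP; split=> [_ [k1 ck1 <-]|k1 ck1].
  by rewrite -[X in Vcirc _ _ X](lineK p); exact: (Vcirc_act S gG hV Op' ck1).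
exists (ext R (invmx g) *m k1); last by rewrite (ext_actKV gG).
have Op : Omega G p by exact: normal_at_Omega ngk.
exact: (Vcirc_act S hG hV Op ck1).
Qed.

Lemma is_kappa_Kap z k : z.1 z.2 -> is_kappa G V z k -> Kap z k.
Proof.
case: z => D p /= Dp [[Vk _] kk [W [gW rW /= DW WE _]]]; split=> //; exists W; split=> //.
rewrite DW in Dp; have /psiP[x [px xW ipx]] := Dp; rewrite px /= in Vk WE *.
have Op : Omega G (<[x]>%VS : projsp R) by exists x.
have [ck _] := V_cone hV Op Vk; have yx : B (complexv k) x = 0 by apply: ck; exact: memv_line.
exists x, (complexv k); split=> //; last by rewrite Rev_complexv.
split=> //; last by rewrite bform_complexv kk ltcR ltr01.
  rewrite WE; apply: (subvP (addvSl _ _)); apply: (subvP (addvSr _ _)); exact: memv_line.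
by rewrite -conjv_complexv bform_conjv yx conjc0.
Qed.

Lemma is_kappa_ex z : TR G z.1 -> z.1 z.2 -> exists k, is_kappa G V z k.
Proof.
case: z => D p /= TD Dp; have gD := TR_goodC S TD.
have [W [gW rW DE _]] := TR_real S TD.
have [k Kk] := @Kap_ex (D, p) gD Dp; have Op := Kap_Omega Kk.
have [Vk [W' [gW' DW' nk]]] := Kk; simpl in Op, Vk, DW', nk.
have E : W' = W by apply: (psi_inj S gW' gW); rewrite -DE -DW'.
rewrite E in nk; have [x [y [px xW ipx nxy ky]]] := nk; have nxk := Rev_normal S gW rW nxy.
rewrite -ky in nxk; have [_ kk] := V_cone hV Op Vk.
pose a := (Num.sqrt (B k k))^-1; have a0 : 0 < a by rewrite invr_gt0 sqrtr_gt0.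
exists (a *: k); split.
- by apply: (Vcirc_scale S hV Op a0); exact: (@Kap_Vcirc (D, p)).
- rewrite bformZl bformZr mulrA -expr2 exprVn sqr_sqrtr ?(ltW kk) //.
  by rewrite mulVf // gt_eqF.
have kE : <[complexv (a *: k)]>%VS = <[complexv k]>%VS.
  by rewrite complexvZ line_scale // eq_complex negb_and /= gt_eqF.
have WE : W = (p + <[complexv (a *: k)]> + conjs p)%VS.
  apply/eqP; rewrite eqEsubv kE px conjs_line; apply/andP; split; last first.
    have [yW _ _ _] := nxk.
    by rewrite !subv_add -!memvE xW yW /= -rW memv_conjs conjvK.
  apply/subvP => v /(real_space_decomp S gW rW xW ipx nxk)[b [c [d ->]]].
  rewrite -addrA [c *: _ + _]addrC addrA.
  by apply: memv_add; [apply: memv_add|]; apply: memvZ; exact: memv_line.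
exists W; split=> //.
rewrite directvE /= -WE (gW.1) kE px conjs_line !dim_vline.
have x0 := isotropic_positive_neq0 ipx; rewrite x0 conjv_eq0 x0 /=.
suff -> : complexv k != 0 by [].
apply/eqP => k0; have := bform_complexv G k k; rewrite k0 bform0l => -[] k1.
by move: kk; rewrite -k1 ltxx.
Qed.

Lemma sect_sigma_R z : TR G z.1 -> z.1 z.2 -> sect z = sigma_R G V z.
Proof.
move=> Tz zz; have [k kk] := is_kappa_ex Tz zz.
rewrite /sigma_R; have Kx := is_kappa_Kap zz (@xgetPex _ (0 : 'cV[R]_22) (is_kappa G V z) (ex_intro _ k kk)).
by rewrite (sectE (TR_goodC S Tz) Kx).
Qed.

End canonical_section.

(** Points outside [D] are isolated in [subspace D], so openness has to be tested only at points of
    [D]. *)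
Lemma open_final (S : topologicalType) (X : choiceType) (D : set S) (f : S -> X)
    (A : set (final_topology (fun x : subspace D => f x))) :
  (forall x, D x -> A (f x) -> within D (nbhs x) (fun y => A (f y))) -> open A.
Proof.
move=> H; change (open ((fun x : subspace D => f x) @^-1` A)); rewrite openE => x Ax.
rewrite /interior /=; set B := preimage _ _ in Ax *.
have [Dx|nDx] := pselect (D x).
  by have := H x Dx Ax; rewrite nbhs_subspace_in.
have gA : globally [set x : S] B by move=> _ ->.
by have E := @nbhs_subspace_out S D x nDx; rewrite E in gA; exact: gA.
Qed.

(** * Continuity of the canonical section *)

Section continuity.
Variables (R : realType) (G : 'M[int]_22) (S : splitting R G).
Local Notation C := R[i].
Local Notation VS := {vspace 'cV[C]_22}.
Local Notation goodC := (@goodC R G).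
Variable V : projsp R -> set 'cV[R]_22.
Hypothesis hV : continuous_component G V.

Lemma psi_line (W : VS) y : y != 0 -> psi G W <[y]>%VS -> y \in W /\ isotropic_positive G y.
Proof.
move=> y0 /psiP[x [yx xW ipx]]; have x0 := isotropic_positive_neq0 ipx.
have [a a0 ->] := line_eqP x0 (esym yx).
by split; [exact: memvZ|exact: isotropic_positive_scale].
Qed.

Let dom : set ('M[C]_(19, 3) * 'cV[C]_22) := [set t |
  [/\ contractive t.1, goodW G (gspace (chart S t.1)), t.2 \in gspace (chart S t.1) &
      isotropic_positive G t.2]].

Let pr (t : 'M[C]_(19, 3) * 'cV[C]_22) : conicsp R * projsp R := (Cc S t.1, <[t.2]>%VS).

Let pr_good t : dom t -> goodC (pr t).1.
Proof. by move=> [cM good _ _]; exact: (goodC_Cc cM good). Qed.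

Let pr_Omega t : dom t -> Omega G (pr t).2.
Proof. by move=> [_ _ _ ipx]; exists t.2. Qed.

(** The candidate is the real part of the explicit normal vector times a sign fixed at [t0]; by
    [near_V] the same sign remains correct nearby. *)
Lemma near_Kap t0 : dom t0 ->
  exists kap : 'M[C]_(19, 3) * 'cV[C]_22 -> 'cV[R]_22,
    kap @ nbhs t0 --> kap t0 /\
    nbhs t0 (fun t => dom t -> Kap G V (pr t) (kap t)).
Proof.
move=> d0; have [cM good xW ipx] := d0.
have gW := chart_Gplus S cM; have nx := nrml_normal_at cM xW ipx.
have [e [e1 K0]] : exists e : R, (e = 1 \/ e = -1) /\ Kap G V (pr t0) (e *: Rev (nrml S t0.1 t0.2)).
  rewrite /pr -(psi_chart S cM); have [K|K] := Kap_sign S hV gW nx; [exists 1|exists (-1)].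
    by split; [left|rewrite scale1r].
  by split; [right|rewrite scaleN1r].
pose kap (t : 'M[C]_(19, 3) * 'cV[C]_22) := e *: Rev (nrml S t.1 t.2); exists kap.
have kc : kap @ nbhs t0 --> kap t0.
  apply: (@cvg_scalemx _ (nbhs t0)); first exact: cvg_cst.
  by apply: (cvg_Remx (nbhs_filter t0)); apply: (cvg_nrml (nbhs_filter t0) cM); [exact: cvg_fst|exact: cvg_snd].
split; first exact: kc.
have pc : (fun t : 'M[C]_(19, 3) * 'cV[C]_22 => (pr t).2) @ nbhs t0 --> (pr t0).2.
  by apply: (@cvg_line _ _ (nbhs t0)); [exact: isotropic_positive_neq0 ipx|exact: cvg_snd].
have nV := near_V hV (pr_Omega d0) K0.1.
pose proof (cvg_pair kc pc) as cp; pose proof (cp _ nV) as cpV.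
apply: (@filterS _ (nbhs t0) _ _ _ _ cpV) => t H dt.
have [cMt goodt xWt ipxt] := dt; have gWt := chart_Gplus S cMt.
have nt : normal_at G (gspace (chart S t.1)) (pr t).2 (kap t).
  have n1 := nrml_normal_at cMt xWt ipxt; rewrite /kap.
  by case: e1 => ->; rewrite ?scale1r ?scaleN1r //; exact: normal_at_opp.
split; first by apply: H; [exact: pr_Omega|exact: normal_at_cone nt].
exists (gspace (chart S t.1)); split; [exact: gWt| |exact: nt].
by rewrite /pr /= -(psi_chart S cMt).
Qed.

(** Continuity is established for pairs of a chart and a vector, where [near_Kap] gives a continuous
    representative of the class, and then descends through [near_goodC] and [near_line]. *)
Lemma sect_continuous (U : set (conicsp R)) : U `<=` goodC ->
  {within univ G U, continuous (@sect R G V)}.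
Proof.
move=> UG; apply/subspace_continuousP => -[D p] [/= _ UD Dp].
have [M [cM DE good]] := goodC_chart S (UG _ UD); subst D.
have [x [px xW ipx]] : exists x, [/\ p = <[x]>%VS, x \in gspace (chart S M) & isotropic_positive G x].
  by apply/psiP; rewrite psi_chart.
subst p; pose t0 := (M, x); have d0 : dom t0 by split.
have [kap [kc near_kap]] := near_Kap d0; have K0 : Kap G V (pr t0) (kap t0) := nbhs_singleton near_kap d0.
have S0 := sectE S hV (pr_good d0) K0.
pose F := within dom (nbhs t0); have FF : Filter F by exact: within_filter.
pose g (t : 'M[C]_(19, 3) * 'cV[C]_22) := (kap t, (pr t).2).
have kt t : dom t -> Kap G V (pr t) (kap t) -> kappa_total G V (g t).
  by move=> dt Kt; split; [exact: pr_Omega|exact: (Kap_Vcirc S (pr_good dt) Kt)].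
have cg : g @ F --> g t0.
  have pc : (fun t : 'M[C]_(19, 3) * 'cV[C]_22 => (pr t).2) @ nbhs t0 --> (pr t0).2.
    by apply: (@cvg_line _ _ (nbhs t0)); [exact: isotropic_positive_neq0 ipx|exact: cvg_snd].
  have cp : g @ nbhs t0 --> g t0 by pose proof (cvg_pair kc pc) as cp; exact: cp.
  by apply: cvg_within_filter; exact: cp.
have FK : F (fun t => kappa_total G V (g t)).
  by move: near_kap; apply: filterS => t Kt dt; apply: kt => //; exact: Kt.
have := @cvg_final _ _ (kappa_total G V) (kappa_class G V) _ F FF g (g t0) (kt t0 d0 K0) cg FK.
move=> cl; change (sect G V @ within (univ G U) (nbhs (pr t0)) --> sect G V (pr t0)); rewrite S0.
move=> N [[N1 N2] /= [nN1 nN2] N12].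
have H : nbhs t0 (fun t => dom t -> N2 (sect G V (pr t)).2).
  have h2 : nbhs t0 (fun t => dom t -> N2 (kappa_class G V (g t))) := cl _ nN2.
  apply: (@filterS _ (nbhs t0) _ _ _ _ (filterI near_kap h2)) => t [Kt Nt] dt.
  by rewrite (sectE S hV (pr_good dt) (Kt dt)); exact: Nt.
have [[A A'] /= [nA nA'] AA] := H.
exists (N1 `&` [set D | goodC D -> exists M', [/\ contractive M', D = Cc S M' & A M']],
        [set <[y]>%VS | y in [set y | A' y /\ y != 0]]).
  split; first by apply: filterI; [exact: nN1|exact: near_goodC].
  by apply: near_line; [exact: isotropic_positive_neq0 ipx|exact: nA'].
move=> [D p] /= [[N1D AD] [y [A'y y0] py]] [/= _ UD' Dp'].
have gD := UG _ UD'; have [M' [cM' DE AM']] := AD gD; subst D p.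
have [W' [gW' DW goodW']] := gD.
have WE : W' = gspace (chart S M').
  by apply: (psi_inj S gW' (chart_Gplus S cM')); rewrite -DW psi_chart.
rewrite WE in goodW'; rewrite -(psi_chart S cM') in Dp'.
have [yW ipy] := psi_line y0 Dp'.
have dt : dom (M', y) by split.
apply: N12; split; first exact: N1D.
by apply: (AA (M', y)).
Qed.

End continuity.

(** * Uniqueness *)

Section quadratic_roots.
Variable R : realType.
Local Notation C := R[i].

(* Otherwise the inverses w1, w2 of the roots satisfy normc w <= r^-1, and
   c1 / c0 = - (w1 + w2), c2 / c0 = w1 * w2. *)
Lemma quadratic_small_root (c0 c1 c2 : C) (r : R) : 0 < r ->
  2 * normc c0 < normc c1 * r \/ normc c0 < normc c2 * r ^+ 2 ->
  exists2 w, normc w < r & c0 + c1 * w + c2 * w ^+ 2 = 0.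
Proof.
move=> r0 big; have [->|c00] := eqVneq c0 0.
  by exists 0; rewrite ?normc0 // expr0n /= !mulr0 !addr0.
pose p := c1 / c0; pose q := c2 / c0; pose s := sqrtC (p ^+ 2 - 4 * q).
have s2 : s ^+ 2 = p ^+ 2 - 4 * q by exact: sqrtCK.
pose w1 := (- p + s) / 2; pose w2 := (- p - s) / 2.
have e1 : c1 = - c0 * (w1 + w2).
  have -> : w1 + w2 = - p by rewrite /w1 /w2; field.
  by rewrite mulrNN mulrC divfK.
have e2 : c2 = c0 * (w1 * w2).
  have -> : w1 * w2 = (p ^+ 2 - s ^+ 2) / 4 by rewrite /w1 /w2; field.
  by rewrite s2 subKr /q; field.
clearbody w1 w2.
have E w : c0 + c1 * w + c2 * w ^+ 2 = c0 * (1 - w1 * w) * (1 - w2 * w) by rewrite e1 e2; ring.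
have root w : r^-1 < normc w -> normc w^-1 < r /\ w * w^-1 = 1.
  move=> rw; have n0 : 0 < normc w by apply: lt_trans rw; rewrite invr_gt0.
  split; first by rewrite normcV -[r]invrK ltf_pV2 ?posrE ?invr_gt0.
  by rewrite divff //; apply: contraTneq n0 => ->; rewrite normc0 ltxx.
have [n1|n1] := ltP r^-1 (normc w1).
  by have [h e] := root _ n1; exists w1^-1 => //; rewrite E e subrr mulr0 mul0r.
have [n2|n2] := ltP r^-1 (normc w2).
  by have [h e] := root _ n2; exists w2^-1 => //; rewrite E e subrr mulr0.
exfalso; have g0 := normc_ge0 c0; have g1 := normc_ge0 w1; have g2 := normc_ge0 w2.
case: big => big.
  have : normc c1 * r <= 2 * normc c0.
    rewrite e1 normcM normcN -mulrA [2 * _]mulrC ler_wpM2l //.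
    apply: (@le_trans _ _ ((normc w1 + normc w2) * r)).
      by rewrite ler_wpM2r ?(ltW r0) // le_normcD.
    have : (normc w1 + normc w2) * r <= (r^-1 + r^-1) * r by rewrite ler_wpM2r ?(ltW r0) // lerD.
    by rewrite mulrDl [in X in _ <= X]mulrDl !mulVf ?gt_eqF.
  by rewrite leNgt big.
have : normc c2 * r ^+ 2 <= normc c0.
  rewrite e2 !normcM -[X in _ <= X]mulr1 -mulrA ler_wpM2l //.
  have <- : r^-1 * r^-1 * r ^+ 2 = 1 by field; rewrite gt_eqF.
  by rewrite ler_wpM2r ?exprn_ge0 ?(ltW r0) // ler_pM.
by rewrite leNgt big.
Qed.

End quadratic_roots.

Lemma bform_mulmx_vec3 (K : comNzRingType) (G : 'M[int]_22) y (E : 'M[K]_(22, 3)) a b c :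
  bform G y (E *m vec3 a b c) =
  a * bform G y (col 0 E) + b * bform G y (col 1 E) + c * bform G y (col 2 E).
Proof. by rewrite mulmx_vec3 !(bformDr, bformZr). Qed.

Lemma cvg_col (K : numFieldType) m n j (T : Type) (F : set_system T) (FF : Filter F)
    (f : T -> 'M[K]_(m, n)) (A : 'M[K]_(m, n)) :
  f @ F --> A -> (fun t => col j (f t)) @ F --> col j A.
Proof.
move=> fA; rewrite colE; under eq_fun do rewrite colE.
by apply: (cvg_mulmx FF); [exact: fA|exact: cvg_cst].
Qed.

(** * Points of a conic on the wall of a root *)

Section walls.
Variables (R : realType) (G : 'M[int]_22) (S : splitting R G).
Local Notation C := R[i].
Local Notation B := (bform G).

(** With [wall1] below, the Taylor coefficients at [z] of the quadratic polynomial whose roots are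
    the points of the conic on [d^perp] in one affine chart ([bform_pt]). The leading one does not
    depend on [z]. *)
Definition wall2 (d : 'cV[int]_22) M (b : bool) : C :=
  B (ext C d) (col (if b then 2 else 0) (cframe S M)).
Definition wall1 (d : 'cV[int]_22) M (b : bool) (z : C) : C :=
  B (ext C d) (col 1 (cframe S M)) + 2 * z * wall2 d M b.

Lemma bform_pt d M b z w : B (ext C d) (pt S M b (z + w)) =
  B (ext C d) (pt S M b z) + wall1 d M b z * w + wall2 d M b * w ^+ 2.
Proof.
rewrite /wall1 /wall2 /pt /cvec; case: b; rewrite !bform_mulmx_vec3;
  move: (B _ (col 0 _)) (B _ (col 1 _)) (B _ (col 2 _)) => a0 a1 a2; ring.
Qed.

(** If the polynomial vanished identically, [d] would be orthogonal to the whole three-space, which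
    [goodW_Tset] forbids. *)
Lemma wall_neq0 d M b z : contractive M -> goodW G (gspace (chart S M)) -> Delta G d ->
  B (ext C d) (pt S M b z) = 0 -> wall1 d M b z = 0 -> wall2 d M b = 0 -> False.
Proof.
move=> cM good Dd z0 w1 w2; have gW := chart_Gplus S cM.
have [W' [gW' T] E] := goodW_Tset S gW good; apply: (T d Dd).
have -> : W' = gspace (chart S M) by apply: (psi_inj S gW' gW).
rewrite -(gspace_cframe S cM) => v /memv_gspaceP[u ->].
have a1 : B (ext C d) (col 1 (cframe S M)) = 0 by move: w1; rewrite /wall1 w2 mulr0 addr0.
have [a0 a2] : B (ext C d) (col 0 (cframe S M)) = 0 /\ B (ext C d) (col 2 (cframe S M)) = 0.
  move: z0 w2; rewrite /wall2 /pt /cvec; case: b {w1}; rewrite bform_mulmx_vec3 a1 => z0 e.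
    by move: z0; rewrite e !mulr0 !addr0 mul1r.
  by move: z0; rewrite e !mulr0 !add0r mul1r.
rewrite [u]vec3_eta bform_mulmx_vec3 a0 a1 a2.
by rewrite !mulr0 !addr0.
Qed.

Lemma cvg_wall2 d M b (T : Type) (F : set_system T) (FF : Filter F) (f : T -> 'M[C]_(19, 3)) :
  contractive M -> f @ F --> M -> (fun t => wall2 d (f t) b) @ F --> wall2 d M b.
Proof.
move=> cM fM; apply: (cvg_bform FF); first exact: cvg_cst.
by apply: (cvg_col FF); exact: (cvg_cframe cM FF fM).
Qed.

Lemma cvg_wall1 d M b z (T : Type) (F : set_system T) (FF : Filter F) (f : T -> 'M[C]_(19, 3)) :
  contractive M -> f @ F --> M -> (fun t => wall1 d (f t) b z) @ F --> wall1 d M b z.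
Proof.
move=> cM fM; apply: (cvg_addf FF).
  apply: (cvg_bform FF); first exact: cvg_cst.
  by apply: (cvg_col FF); exact: (cvg_cframe cM FF fM).
by apply: (cvg_mulf FF); [exact: cvg_cst|exact: cvg_wall2].
Qed.

(** Wall points persist: a small change of [M] makes the constant term at [z] small while the linear
    or the quadratic coefficient stays away from 0, and [quadratic_small_root] then finds a root
    close to [z]. *)
Lemma near_wall_point d M b z (A : set C) : contractive M -> goodW G (gspace (chart S M)) ->
  Delta G d -> B (ext C d) (pt S M b z) = 0 -> nbhs z A ->
  nbhs M (fun M' => exists2 z', A z' & B (ext C d) (pt S M' b z') = 0).
Proof.
move=> cM good Dd z0 /nbhs_ballP[e /= e0 eA].
pose r := Re e; have [eE r0] : e = r%:C /\ 0 < r.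
  by move: e0; rewrite /r; case: (e) => u v; rewrite ltcE /= => /andP[/eqP-> ?].
have FF := nbhs_filter M; have id : id @ nbhs M --> M by exact: cvg_id.
have c0 : (fun M' => 2 * normc (B (ext C d) (pt S M' b z))) @ nbhs M --> (0 : R).
  rewrite -[X in _ --> X](mulr0 2) -(normc0 R) -z0.
  apply: (cvg_mulf FF); first exact: cvg_cst.
  apply: (cvg_normc FF); apply: (cvg_bform FF); first exact: cvg_cst.
  by apply: (cvg_pt cM FF id); exact: cvg_cst.
have c1 : (fun M' => normc (wall1 d M' b z) * r) @ nbhs M --> normc (wall1 d M b z) * r.
  apply: (cvg_mulf FF); last exact: cvg_cst.
  by apply: (cvg_normc FF); exact: cvg_wall1.
have c2 : (fun M' => 2 * (normc (wall2 d M' b) * r ^+ 2)) @ nbhs M --> 2 * (normc (wall2 d M b) * r ^+ 2).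
  apply: (cvg_mulf FF); first exact: cvg_cst.
  apply: (cvg_mulf FF); last exact: cvg_cst.
  by apply: (cvg_normc FF); exact: cvg_wall2.
have normc_gt0 (c : C) : c != 0 -> 0 < normc c.
  by move=> cn; rewrite lt_neqAle normc_ge0 andbT eq_sym; apply: contra_neq cn => /eq0_normc.
have small : nbhs M (fun M' => 2 * normc (B (ext C d) (pt S M' b z)) < normc (wall1 d M' b z) * r \/
    normc (B (ext C d) (pt S M' b z)) < normc (wall2 d M' b) * r ^+ 2).
  have [w1|w1] := eqVneq (wall1 d M b z) 0; last first.
    have p : 0 < normc (wall1 d M b z) * r by rewrite mulr_gt0 // normc_gt0.
    pose m := normc (wall1 d M b z) * r / 2; have m0 : 0 < m by rewrite divr_gt0.
    have m1 : m < normc (wall1 d M b z) * r by rewrite ltr_pdivrMr // ltr_pMr // ltr1n.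
    apply: (@filterS _ _ FF _ _ _ (filterI (near_lt FF m0 c0) (near_gt FF m1 c1))) => M' [h1 h2].
    by left; exact: lt_trans h1 h2.
  have w2 : wall2 d M b != 0 by apply/eqP => w2; exact: (wall_neq0 cM good Dd z0 w1 w2).
  have p : 0 < 2 * (normc (wall2 d M b) * r ^+ 2).
    by rewrite !mulr_gt0 ?normc_gt0 ?exprn_gt0 // ltr0n.
  pose m := normc (wall2 d M b) * r ^+ 2; have m0 : 0 < m by rewrite mulr_gt0 ?normc_gt0 ?exprn_gt0.
  have m1 : m < 2 * (normc (wall2 d M b) * r ^+ 2) by rewrite -/m ltr_pMl // ltr1n.
  apply: (@filterS _ _ FF _ _ _ (filterI (near_lt FF m0 c0) (near_gt FF m1 c2))) => M' [h1 h2].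
  by right; have := lt_trans h1 h2; rewrite ltr_pM2l // ltr0n.
apply: (@filterS _ _ FF _ _ _ small) => M' /(quadratic_small_root r0)[w wr w0].
exists (z + w); last by rewrite bform_pt.
apply: eA; rewrite eE; change (`|z - (z + w)| < r%:C).
by rewrite opprD addNKr normrN; change ((normc w)%:C < r%:C); rewrite ltcR.
Qed.

End walls.

Section uniqueness.
Variables (R : realType) (G : 'M[int]_22) (S : splitting R G).
Local Notation C := R[i].
Local Notation B := (bform G).
Local Notation goodC := (@goodC R G).
Variable V : projsp R -> set 'cV[R]_22.
Hypothesis hV : continuous_component G V.

(** Asked of every vector in the class; when [d] is orthogonal to the point, one vector decides for
    all ([pos_class]). *)
Definition pos (d : 'cV[int]_22) (w : tOmegasp G V) : Prop :=
  forall k, w.1 k -> 0 < B k (ext R d).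

Lemma pos_class p k d : Omega G p -> Vcirc G V p k -> Delta G d -> orthp G d p ->
  pos d (kappa_class G V (k, p)) <-> 0 < B k (ext R d).
Proof.
move=> Op Vk Dd dp; split=> [|dk k' /=].
  by apply; rewrite /=; exact: connected_component_refl.
by rewrite (component_Vcirc S hV Op Vk) => -[_]; apply.
Qed.

Lemma DeltaN d : Delta G d -> Delta G (- d).
Proof. by rewrite /Delta /= bformNl bformNr opprK. Qed.

Lemma extN (K : pzRingType) (d : 'cV[int]_22) : ext K (- d) = - ext K d.
Proof. by apply/matrixP => i j; rewrite !mxE rmorphN. Qed.

Lemma orthpN d (p : projsp R) : orthp G d p -> orthp G (- d) p.
Proof. by move=> dp x /dp e; rewrite extN bformNl e oppr0. Qed.

Lemma posN d w : tOmega w -> Delta G d -> orthp G d w.2 -> pos (- d) w <-> ~ pos d w.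
Proof.
move=> [[k p] [/= Op Vk] <-] Dd /= dp.
rewrite (pos_class Op Vk (DeltaN Dd) (orthpN dp)) (pos_class Op Vk Dd dp).
rewrite extN bformNr oppr_gt0; have := Vk.2 d Dd dp.
by split=> [h1 h2|h]; [move: h1; rewrite ltNge ltW|rewrite lt_neqAle H leNgt; exact/negP].
Qed.

Lemma near_not_orthp d (p : projsp R) : Omega G p -> ~ orthp G d p ->
  nbhs p (fun p' : projsp R => ~ orthp G d p').
Proof.
move=> /OmegaP[x -> ipx] nd.
have dx : B (ext C d) x != 0 by apply/eqP => dx; apply: nd; exact/orthp_line.
have x0 := isotropic_positive_neq0 ipx.
have near0 : nbhs x (fun y => B (ext C d) y != 0).
  apply: (nbhs_neq0 (nbhs_filter x) dx).
  by apply: (cvg_bform (nbhs_filter x)); [exact: cvg_cst|exact: cvg_id].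
by apply: filterS (near_line x0 near0) => _ [y [dy y0] <-] /orthp_line e; rewrite e eqxx in dy.
Qed.

(** Tested on pairs [(k, p)]. If [d] is orthogonal to [p], positivity of [B k (ext R d)] is an open
    condition; otherwise [d] is orthogonal to no nearby point and nothing is asked. *)
Lemma near_pos d w : tOmega w -> Delta G d -> orthp G d w.2 -> pos d w ->
  nbhs w (fun w' : tOmegasp G V => tOmega w' -> orthp G d w'.2 -> pos d w').
Proof.
move=> tw Dd dw pw; pose A : set (tOmegasp G V) := fun w' => tOmega w' -> orthp G d w'.2 -> pos d w'.
suff oA : open A by apply: open_nbhs_nbhs; split.
apply: open_final => -[k p] [/= Op Vk] Akp.
have Akp' : orthp G d p -> 0 < B k (ext R d).
  by move=> dp; apply/(pos_class Op Vk Dd dp); apply: Akp => //; exists (k, p).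
have FF := nbhs_filter (k, p).
have near_k : nbhs (k, p) (fun kp : 'cV[R]_22 * projsp R => orthp G d kp.2 -> 0 < B kp.1 (ext R d)).
  have [dp|ndp] := pselect (orthp G d p).
    have c : (fun kp : 'cV[R]_22 * projsp R => B kp.1 (ext R d)) @ nbhs (k, p) --> B k (ext R d).
      by apply: (cvg_bform FF); [exact: cvg_fst|exact: cvg_cst].
    by apply: filterS (near_gt FF (Akp' dp) c) => kp h _.
  have c : (fun kp : 'cV[R]_22 * projsp R => kp.2) @ nbhs (k, p) --> p by exact: cvg_snd.
  pose proof (c _ (near_not_orthp Op ndp)) as cn.
  by apply: (@filterS _ _ FF _ _ _ cn) => kp h dk; case: (h dk).
apply: filterS near_k => -[k' p'] /= h [Op' Vk'] tw' dp'.
by apply/(pos_class Op' Vk' Dd dp'); exact: h.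
Qed.

Section sections.
Variable U : set (conicsp R).
Hypothesis UG : U `<=` goodC.

Lemma univP D p : U D -> D p -> univ G U (D, p).
Proof. by move=> UD Dp; split=> //; exact: (goodC_C1 S (UG UD)). Qed.

Lemma section_tOmega (s : conicsp R * projsp R -> conicsp R * tOmegasp G V) z : is_section U s -> univ G U z ->
  [/\ tOmega (s z).2, (s z).1 = z.1 & (s z).2.2 = z.2].
Proof.
move=> [_ /(_ z)] H uz; have [[_ ts _] q] := H uz; split=> //; by rewrite -[in RHS]q.
Qed.

(** Positivity on [d] is open along the wall by [near_pos], and so is its negation, which by [posN]
    is positivity on [- d]. *)
Lemma section_sign d (s : conicsp R * projsp R -> conicsp R * tOmegasp G V) z : is_section U s -> univ G U z -> Delta G d -> orthp G d z.2 ->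
  within (univ G U) (nbhs z) (fun z' => orthp G d z'.2 -> pos d (s z').2 <-> pos d (s z).2).
Proof.
move=> ss uz Dd dz; have [tz _ sz] := section_tOmega ss uz.
have key e : Delta G e -> orthp G e z.2 -> pos e (s z).2 ->
    within (univ G U) (nbhs z) (fun z' => orthp G e z'.2 -> pos e (s z').2).
  move=> De ez pe; have ez' : orthp G e (s z).2.2 by rewrite sz.
  have np := near_pos tz De ez' pe.
  have nps : nbhs (s z) (fun v : conicsp R * tOmegasp G V => tOmega v.2 -> orthp G e v.2.2 -> pos e v.2).
    have c : (fun v : conicsp R * tOmegasp G V => v.2) @ nbhs (s z) --> (s z).2 by exact: cvg_snd.
    exact: c _ np.
  have cs := (subspace_continuousP _ _).1 ss.1 z uz.
  have cs' : within (univ G U) (nbhs z) (fun z' => tOmega (s z').2 -> orthp G e (s z').2.2 -> pos e (s z').2) := cs _ nps.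
  apply: (@filterS _ (nbhs z) _ _ _ _ cs') => z' h' uz' ez''; have [tz' _ sz'] := section_tOmega ss uz'.
  have h := h' uz'.
  by apply: h; rewrite ?sz'.
have [pd|npd] := pselect (pos d (s z).2).
  by apply: (@filterS _ (nbhs z) _ _ _ _ (key d Dd dz pd)) => z' h uz' dz'; split=> // _; exact: h.
have dsz : orthp G d (s z).2.2 by rewrite sz.
have pn : pos (- d) (s z).2 by apply/(posN tz Dd dsz).
apply: (@filterS _ (nbhs z) _ _ _ _ (key _ (DeltaN Dd) (orthpN dz) pn)) => z' h uz' dz'; split=> // p'.
have [tz' _ sz'] := section_tOmega ss uz'; have dsz' : orthp G d (s z').2.2 by rewrite sz'.
by exfalso; apply: ((posN tz' Dd dsz').1 _ p'); apply: h => //; exact: orthpN.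
Qed.

Variables s s' : conicsp R * projsp R -> conicsp R * tOmegasp G V.
Hypotheses (ss : is_section U s) (ss' : is_section U s').

Let agree d z := pos d (s z).2 <-> pos d (s' z).2.

Lemma agree_locally_constant d z : univ G U z -> Delta G d -> orthp G d z.2 ->
  within (univ G U) (nbhs z) (fun z' => orthp G d z'.2 -> agree d z' <-> agree d z).
Proof.
move=> uz Dd dz; have FF : Filter (within (univ G U) (nbhs z)) by exact: within_filter.
apply: (@filterS _ _ FF _ _ _ (filterI (section_sign ss uz Dd dz) (section_sign ss' uz Dd dz))).
by move=> z' [h h'] dz'; rewrite /agree (h dz') (h' dz').
Qed.

Let near_charts (M : 'M[C]_(19, 3)) := within [set M' | contractive M' /\ U (Cc S M')] (nbhs M).

Lemma conic_pt M b z : contractive M -> Cc S M <[pt S M b z]>%VS.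
Proof.
move=> cM; rewrite -(psi_chart S cM); apply/psiP; exists (pt S M b z).
by split; [reflexivity|exact: pt_mem|exact: pt_isotropic_positive].
Qed.

(** Being off the wall is an open condition, so wall points arbitrarily close to [pt S M b z] force
    that point onto the wall. There [agree] is locally constant. *)
Lemma agree_near_pt d M b z : contractive M -> U (Cc S M) -> Delta G d ->
  filter_prod (nbhs z) (near_charts M) (fun q => orthp G d <[pt S q.2 b q.1]>%VS ->
    orthp G d <[pt S M b z]>%VS /\
    (agree d (Cc S q.2, <[pt S q.2 b q.1]>%VS) <-> agree d (Cc S M, <[pt S M b z]>%VS))).
Proof.
move=> cM UM Dd; set F := filter_prod _ _.
have FM : Filter (near_charts M) by exact: within_filter.
have FF : Filter F by exact: filter_prod_filter.
have c1 : (fun q : C * 'M[C]_(19, 3) => q.1) @ F --> z by exact: cvg_fst.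
have c2' : (fun q : C * 'M[C]_(19, 3) => q.2) @ F --> near_charts M by exact: cvg_snd.
have c2 : (fun q : C * 'M[C]_(19, 3) => q.2) @ F --> M.
  by apply: cvg_trans c2' _; exact: cvg_within.
have Fch : F (fun q => contractive q.2 /\ U (Cc S q.2)).
  pose proof (c2' (fun M' => contractive M' /\ U (Cc S M'))) as c3; apply: c3.
  by apply: within_self => M'; exact.
have cp : (fun q : C * 'M[C]_(19, 3) => <[pt S q.2 b q.1]>%VS : projsp R) @ F --> (<[pt S M b z]>%VS : projsp R).
  by apply: (cvg_line FF); [exact: pt_neq0|exact: (cvg_pt cM FF c2)].
have [dz|ndz] := pselect (orthp G d (<[pt S M b z]>%VS : projsp R)); last first.
  pose proof (cp _ (near_not_orthp (pt_Omega S cM b z) ndz)) as cn.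
  by apply: (@filterS _ F FF _ _ _ cn) => q h dq; case: (h dq).
have cC : (fun q : C * 'M[C]_(19, 3) => Cc S q.2) @ F --> Cc S M.
  by apply: (cvg_Cc FF cM _ c2); apply: (@filterS _ F FF _ _ _ Fch) => q [].
have nz := agree_locally_constant (univP UM (conic_pt b z cM)) Dd dz.
pose proof (cvg_pair cC cp) as c; pose proof (c _ nz) as cn.
apply: (@filterS _ F FF _ _ _ (filterI Fch cn)) => q [[cq Uq] h] dq; split; first exact: dz.
by apply: h => //; apply: univP; [exact: Uq|exact: conic_pt].
Qed.

Let agreeC d (D : conicsp R) := forall p, D p -> orthp G d p -> agree d (D, p).

(** Agreement at all wall points of a conic spreads to nearby conics by the tube lemma over the two
    discs. A disagreement at one wall point spreads as well, because [near_wall_point] finds a wall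
    point close to it on every nearby conic. *)
Lemma agreeC_locally_constant d D : U D -> Delta G d ->
  within U (nbhs D) (fun D' => agreeC d D' <-> agreeC d D).
Proof.
move=> UD Dd; have [M [cM DE good]] := goodC_chart S (UG UD); subst D.
have FM : Filter (near_charts M) by exact: within_filter.
suff H : near_charts M (fun M' => agreeC d (Cc S M') <-> agreeC d (Cc S M)).
  have H' : nbhs M (fun M' => contractive M' /\ U (Cc S M') -> agreeC d (Cc S M') <-> agreeC d (Cc S M)) := H.
  have := near_goodC S cM H'; apply: filterS => D' h UD'.
  by have [M' [cM' DE h']] := h (UG UD'); subst D'; exact: h'.
have [aM|naM] := pselect (agreeC d (Cc S M)).
  have near_b b : near_charts M (fun M' => forall z, normc z <= 1 ->
      orthp G d <[pt S M' b z]>%VS -> agree d (Cc S M', <[pt S M' b z]>%VS)).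
    apply: (@tube_disc R _ _ FM) => z.
    have FF : Filter (filter_prod (nbhs z) (near_charts M)) by exact: filter_prod_filter.
    apply: (@filterS _ _ FF _ _ _ (agree_near_pt b z cM UD Dd)) => q h dq.
    by have [dz e] := h dq; apply/e; apply: aM; [exact: conic_pt|exact: dz].
  apply: (@filterS _ _ FM _ _ _ (filterI (near_b true) (near_b false))) => M' [h1 h2].
  split=> _; first exact: aM.
  move=> p Dp dp; have [b [z [z1 pE]]] := (conicP (cframe S M') p).1 Dp.
  have {}pE : p = <[pt S M' b z]>%VS := pE.
  by subst p; case: b dp {Dp} => dp; [exact: h1|exact: h2].
have [p Dp /not_implyP[dp na]] : exists2 p, Cc S M p & ~ (orthp G d p -> agree d (Cc S M, p)).
  apply: contrapT => H; apply: naM => p Dp dp; apply: contrapT => na.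
  by apply: H; exists p => // h; exact: na (h dp).
have [b [z [_ pE]]] := (conicP (cframe S M) p).1 Dp.
have {}pE : p = <[pt S M b z]>%VS := pE.
subst p; have [[A A'] /= [nA nA'] AA] := agree_near_pt b z cM UD Dd.
have wz : B (ext C d) (pt S M b z) = 0 by exact/orthp_line.
have nw := near_wall_point cM good Dd wz nA.
have nw' : near_charts M (fun M' => exists2 z', A z' & B (ext C d) (pt S M' b z') = 0).
  by apply: filterS nw => M' h _.
have Fch : near_charts M (fun M' => contractive M') by apply: within_self => M' [].
apply: (@filterS _ _ FM _ _ _ (filterI Fch (filterI nA' nw'))) => M' [cM' [A'M' [z' Az' wz']]].
split=> aM'; last by case: (naM aM').
exfalso; apply: na.
have dz' : orthp G d (<[pt S M' b z']>%VS : projsp R) by exact/orthp_line.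
have [_ e] := AA (z', M') (conj Az' A'M') dz'.
by apply/e; apply: aM'; [exact: conic_pt|exact: dz'].
Qed.

(** By [kappa_class_eq] a class is determined by the signs of the roots orthogonal to its point.
    Agreement is therefore propagated from [D0] along the connected [U] for each root separately. *)
Lemma section_unique D0 : connected U -> U D0 ->
  (forall p, D0 p -> s (D0, p) = s' (D0, p)) -> forall z, univ G U z -> s z = s' z.
Proof.
move=> cU U0 e0 [D p] uz; have [_ /= UD Dp] := uz.
have agreed d : Delta G d -> agreeC d D.
  move=> Dd; have lc E (UE : U E) := agreeC_locally_constant UE Dd.
  have [h _] := @locally_constant R _ U (agreeC d) cU lc D0 D U0 UD.
  by apply: h => p0 D0p0 _; rewrite /agree e0.
have [[[k q] [/= Op Vk] kE] s1 s2] := section_tOmega ss uz.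
have [[[k' q'] [/= Op' Vk'] kE'] s1' s2'] := section_tOmega ss' uz.
have qp : q = p by rewrite -s2 -kE.
have qp' : q' = p by rewrite -s2' -kE'.
subst q q'; rewrite [s _]surjective_pairing [s' _]surjective_pairing s1 s1' -kE -kE'.
congr pair; apply: (kappa_class_eq S hV Op Vk Vk') => d Dd dp.
have := agreed d Dd p Dp dp; rewrite /agree -kE -kE'.
by rewrite (pos_class Op Vk Dd dp) (pos_class Op Vk' Dd dp) => -[].
Qed.

End sections.

End uniqueness.

Theorem corollary6p20 (R : realType) (G : 'M[int]_22)
    (V : projsp R -> set 'cV[R]_22)
    (hG : K3_gram R G) (hV : continuous_component G V) :
  exists U : set (conicsp R),
    [/\ TR G `<=` U,
        exists2 O : set (conicsp R), open O & U = Tset G `&` O,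
        connected U,
        forall g C, Gamma R G g -> U C -> U (act_conic g C) &
        forall C, U C -> U (tau C)] /\
    exists s : conicsp R * projsp R -> conicsp R * tOmegasp G V,
      invariant_extension U s /\
      forall s', invariant_extension U s' -> {in univ G U, s' =1 s}.

Proof.
have [S] := K3_splitting hG; have UG := @TRnbhd_goodC R G.
exists (@TRnbhd R G); split.
  split; [exact: (TR_TRnbhd S)|exact: (TRnbhd_relatively_open S)|exact: (connected_TRnbhd S)| |].
    by move=> g C gG; exact: (TRnbhd_act S gG).
  by move=> C; exact: (TRnbhd_tau S).
have section_sect : is_section (@TRnbhd R G) (@sect R G V).
  split; first exact: (sect_continuous S hV UG).
  by move=> z [_ Uz zz]; exact: (sect_tuniv S hV (UG _ Uz) zz).
exists (@sect R G V); split.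
  split; first exact: section_sect.
    move=> g gG z /set_mem[_ Uz zz].
    apply: (sect_invariant S hV gG (UG _ Uz) zz); apply: UG.
    exact: (TRnbhd_act S (Gamma_inv S gG) Uz).
  by move=> z /set_mem[_ Tz zz]; exact: (sect_sigma_R S hV Tz zz).
(* Membership in the neighborhood provides a real conic [D0], over which both sections coincide with
   [sigma_R]. *)
move=> s' [ss' _ s'R] z /set_mem uz; have [_ [D0 T0 _] _] := uz.
have U0 := TR_TRnbhd S T0.
apply: (section_unique S hV UG ss' section_sect (connected_TRnbhd S) U0 _ uz) => p Dp.
have u0 : univ G (@TR R G) (D0, p) by split; [exact: (goodC_C1 S (UG _ U0))|exact: T0|exact: Dp].
have e := sect_sigma_R S hV (z := (D0, p)) T0 Dp.
by rewrite s'R ?inE // e.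
Qed.
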